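(* Let $M$ be an $n$-dimensional torus $\mathbb T^n$. There are (nonempty) open sets $\mathcal U\subset C^2(M,M)$, in the $C^2$ topology, such that every map $f\in\mathcal U$ is a stochastically stable non-uniformly expanding local diffeomorphism.
   Context: $m$ (Lebesgue measure) is the normalized Riemannian volume on $M$. Non-uniformly expanding: a $C^2$ local diffeomorphism $f:M\to M$ is non-uniformly expanding if there is $c>0$ with $\limsup_{n\to\infty}\frac1n\sum_{j=0}^{n-1}\log\|Df(f^j(x))^{-1}\|\le -c<0$ for $m$-almost every $x\in M$. SRB measure: an $f$-invariant Borel probability measure $\mu$ such that, for $x$ in a set of positive $m$-measure, $\lim_n\frac1n\sum_{j=0}^{n-1}\varphi(f^j(x))=\int\varphi\,d\mu$ for every continuous $\varphi:M\to\mathbb R$. (Known fact: a non-uniformly expanding local diffeomorphism has finitely many SRB measures.) Random perturbation of $f$: a pair $\{\Phi,(\theta_\epsilon)_{\epsilon>0}\}$ where $\Phi:T\to C^2(M,M)$, $t\mapsto f_t$, is a continuous map from a metric space $T$ with $f=f_{t^*}$ for some $t^*\in T$; the $\theta_\epsilon$ are Borel probability measures on $T$ such that $(\operatorname{supp}\theta_\epsilon)_{\epsilon>0}$ is a nested family of connected compact sets (decreasing as $\epsilon$ decreases) with $\operatorname{supp}\theta_\epsilon\to\{t^*\}$ as $\epsilon\to0$. For $\underline t=(t_1,t_2,\dots)\in T^{\mathbb N}$ put $f^0_{\underline t}=\mathrm{id}$, $f^n_{\underline t}=f_{t_n}\circ\cdots\circ f_{t_1}$ for $n\ge1$, and $f^n_x(\underline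 t)=f^n_{\underline t}(x)$. The following nondegeneracy conditions are part of the definition: there is $0<\epsilon_0<1$ such that for every $0<\epsilon<\epsilon_0$ there is $n_0=n_0(\epsilon)\in\mathbb N$ for which (i) there is $\xi=\xi(\epsilon)>0$ such that $\{f^n_{\underline t}(x):\underline t\in(\operatorname{supp}\theta_\epsilon)^{\mathbb N}\}$ contains the ball of radius $\xi$ around $f^n(x)$ for all $x\in M$, $n\ge n_0$; (ii) $(f^n_x)_*\theta_\epsilon^{\mathbb N}\ll m$ for all $x\in M$, $n\ge n_0$. Physical measure (of level $\epsilon$): a Borel probability measure $\mu^\epsilon$ on $M$ such that, for $x$ in a set of positive $m$-measure, for $\theta_\epsilon^{\mathbb N}$-almost every $\underline t\in T^{\mathbb N}$, $\lim_{n\to\infty}\frac1n\sum_{j=0}^{n-1}\varphi(f^j_{\underline t}(x))=\int\varphi\,d\mu^\epsilon$ for all continuous $\varphi:M\to\mathbb R$. Stochastically stable: for every random perturbation $\{\Phi,(\theta_\epsilon)_{\epsilon>0}\}$ of $f$, all weak$^*$ accumulation points, as $\epsilon\to0$, of physical measures of level $\epsilon$ are convex linear combinations of the (finitely many) SRB measures of $f$. *)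

(* Defs.v *)
From HB Require Import structures.
From mathcomp Require Import all_boot all_order all_algebra.
From mathcomp Require Import ring lra.
From mathcomp Require Import all_classical all_reals all_analysis.
From mathcomp Require Import measurable_realfun.

Set Implicit Arguments.
Unset Strict Implicit.
Unset Printing Implicit Defensive.

Import Order.TTheory GRing.Theory Num.Theory.
Import numFieldTopology.Exports numFieldNormedType.Exports.

Local Open Scope classical_set_scope.
Local Open Scope ring_scope.

Section euclidean_norm.
Context {R : realType} {n : nat}.
Implicit Types (v w : 'rV[R]_n) (A : 'M[R]_n).

(* The norm the library puts on 'rV[R]_n is the sup norm. *)
Definition enorm v : R := Num.sqrt (\sum_j v 0 j ^+ 2).

Definition opnorm A : R :=
  sup [set enorm (v *m A) | v in [set v | enorm v <= 1]].

Lemma enorm_ge0 v : 0 <= enorm v.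
Proof. exact: sqrtr_ge0. Qed.

Lemma enorm0 : enorm 0 = 0.
Proof. by rewrite /enorm big1 ?sqrtr0// => j _; rewrite mxE expr0n. Qed.

Lemma enormN v : enorm (- v) = enorm v.
Proof. by congr Num.sqrt; apply: eq_bigr => j _; rewrite mxE sqrrN. Qed.

Lemma sumsq_ge0 v : 0 <= \sum_j v 0 j ^+ 2.
Proof. by apply: sumr_ge0 => j _; exact: sqr_ge0. Qed.

Lemma coord_le_enorm v j : `|v 0 j| <= enorm v.
Proof.
rewrite -sqrtr_sqr ler_sqrt ?sumsq_ge0// (bigD1 j)//= lerDl.
by apply: sumr_ge0 => k _; exact: sqr_ge0.
Qed.

Lemma cauchy_schwarz v w : \sum_j v 0 j * w 0 j <= enorm v * enorm w.
Proof.
rewrite (le_trans (ler_norm _))// -sqrtr_sqr -sqrtrM ?sumsq_ge0//.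
rewrite ler_sqrt ?mulr_ge0 ?sumsq_ge0//.
set s := \sum_j _; set a := \sum_j _; set b := \sum_j _.
have : 0 <= \sum_j \sum_k (v 0 j * w 0 k - v 0 k * w 0 j) ^+ 2.
  by apply: sumr_ge0 => j _; apply: sumr_ge0 => k _; exact: sqr_ge0.
have -> : \sum_j \sum_k (v 0 j * w 0 k - v 0 k * w 0 j) ^+ 2 =
    (a * b - s ^+ 2) *+ 2.
  transitivity (\sum_j \sum_k
      ((v 0 j ^+ 2 * w 0 k ^+ 2 + w 0 j ^+ 2 * v 0 k ^+ 2) -
       ((v 0 j * w 0 j) * (v 0 k * w 0 k)) *+ 2)).
    by apply: eq_bigr => j _; apply: eq_bigr => k _; ring.
  transitivity (\sum_j (v 0 j ^+ 2 * b + w 0 j ^+ 2 * a -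
      (v 0 j * w 0 j * s) *+ 2)).
    apply: eq_bigr => j _; rewrite sumrB big_split/= !mulr_sumr; congr (_ - _).
    by rewrite -sumrMnl.
  rewrite sumrB big_split/= sumrMnl -!mulr_suml -/s -/a -/b.
  by ring.
by rewrite pmulrn_lge0// subr_ge0.
Qed.

Lemma enorm_le_norm v : enorm v <= Num.sqrt n%:R * `|v|.
Proof.
rewrite -[`|v|]ger0_norm// -sqrtr_sqr -sqrtrM// ler_sqrt ?mulr_ge0 ?sqr_ge0//.
rewrite -[n in n%:R]card_ord mulr_natl -sumr_const ler_sum// => j _.
rewrite -real_normK ?num_real// lerXn2r ?nnegrE//.
by rewrite [leRHS]mx_normrE; apply: (le_bigmax _ (fun ij => `|v ij.1 ij.2|) (0, j)).
Qed.

Lemma enormD v w : enorm (v + w) <= enorm v + enorm w.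
Proof.
rewrite -ler_sqr ?nnegrE ?addr_ge0 ?enorm_ge0// sqrrD !sqr_sqrtr ?sumsq_ge0//.
under eq_bigr do rewrite mxE sqrrD.
rewrite big_split/= big_split/= lerD2r lerD2l sumrMnl lerMn2r/=.
exact: cauchy_schwarz.
Qed.

End euclidean_norm.

Section lattice.
Context {R : realType} {n : nat}.

Definition int_lattice : {pred 'rV[R]_n} := fun v => v \is a mxOver Num.int.

Lemma int_lattice_zmod_closed : zmod_closed int_lattice.
Proof.
split=> [|v w /mxOverP vZ /mxOverP wZ]; apply/mxOverP => i j; rewrite !mxE.
  exact: rpred0.
by rewrite rpredB// ?vZ ?wZ.
Qed.

HB.instance Definition _ :=
  GRing.isZmodClosed.Build 'rV[R]_n int_lattice int_lattice_zmod_closed.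
End lattice.

Definition torus (R : realType) (n : nat) : Type :=
  Quotient.quot (@int_lattice R n).

Section torus_structure.
Context {R : realType} {n : nat}.
Local Notation T := (torus R n).

HB.instance Definition _ := GRing.Zmodule.on T.
HB.instance Definition _ := isPointed.Build T 0.

Definition tproj (v : 'rV[R]_n) : T := \pi_(T)%qT v.

Lemma tprojD v w : tproj (v + w) = tproj v + tproj w.
Proof. by rewrite /tproj !piE. Qed.

Lemma tprojN v : tproj (- v) = - tproj v.
Proof. by rewrite /tproj !piE. Qed.

Lemma tproj0 : tproj 0 = 0.
Proof. by rewrite /tproj !piE. Qed.

Lemma tproj_repr (p : T) : tproj (repr p) = p.
Proof. by rewrite /tproj reprK. Qed.

Lemma tproj_eq v w : tproj v = tproj w <-> v - w \in int_lattice.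
Proof.
by split=> [/eqP|h]; [rewrite -Quotient.idealrBE|apply/eqP; rewrite -Quotient.idealrBE].
Qed.

(* The representative of q in [-1/2, 1/2)^n: the inverse of tproj near 0. *)
Definition tlog (q : T) : 'rV[R]_n :=
  \row_j (repr q 0 j - (Num.floor (repr q 0 j + 2^-1))%:~R).

(* Riemannian distance of the flat metric: shortest vector of R^n lifting
   q - p. *)
Definition tdist (p q : T) : R :=
  inf [set enorm v | v in [set v | tproj v = q - p]].

Let lifts (p q : T) := [set enorm v | v in [set v | tproj v = q - p]].

Let lifts_inf p q : has_inf (lifts p q).
Proof.
split; first by exists (enorm (repr (q - p))); exists (repr (q - p)); rewrite //= tproj_repr.
by exists 0 => _ [v _ <-]; exact: enorm_ge0.
Qed.

Lemma tdist_le (p q : T) v : tproj v = q - p -> tdist p q <= enorm v.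
Proof. by move=> vE; apply: ge_inf; [have [] := lifts_inf p q|exists v]. Qed.

Lemma tdist_lt (p q : T) e : tdist p q < e -> exists2 v, tproj v = q - p & enorm v < e.
Proof. by move=> /(inf_lt (lifts_inf p q).1)[_ [v vE <-]] ve; exists v. Qed.

Lemma tdist_ge0 p q : 0 <= tdist p q.
Proof.
by apply: lb_le_inf; [have [] := lifts_inf p q|move=> _ [v _ <-]; exact: enorm_ge0].
Qed.

Lemma tdistxx p : tdist p p = 0.
Proof.
apply/eqP; rewrite eq_le tdist_ge0 andbT -(@enorm0 R n).
by apply: tdist_le; rewrite subrr tproj0.
Qed.

Lemma tdist_positivity p q : tdist p q = 0 -> p = q.
Proof.
move=> pq0.
have [v0 v0E v0h] : exists2 v, tproj v = q - p & enorm v < 2^-1.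
  by apply: tdist_lt; rewrite pq0 invr_gt0.
suff v00 : enorm v0 <= 0.
  apply/esym/subr0_eq; rewrite -v0E (_ : v0 = 0) ?tproj0//.
  apply/rowP => j; rewrite mxE; apply: normr0_eq0; apply/eqP; rewrite eq_le normr_ge0 andbT.
  by rewrite (le_trans _ v00)// coord_le_enorm.
apply/ler_addgt0Pr => e e0; rewrite add0r.
have [v vE vh] : exists2 v, tproj v = q - p & enorm v < Num.min e 2^-1.
  by apply: tdist_lt; rewrite pq0 lt_min e0 invr_gt0/=.
move: vh; rewrite lt_min => /andP[ve vh].
suff -> : v0 = v by exact: ltW.
have /tproj_eq/mxOverP vv : tproj v0 = tproj v by rewrite v0E vE.
apply/rowP => j; apply/subr0_eq/eqP.
have := vv 0 j; rewrite !mxE => /norm_intr_ge1 h.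
apply/negPn/negP => /h; apply/negP; rewrite -ltNge.
rewrite (le_lt_trans (ler_normB _ _))// (le_lt_trans (lerD (coord_le_enorm _ _) (coord_le_enorm _ _)))//.
by rewrite [ltRHS](splitr 1) ltrD ?mul1r.
Qed.

Lemma tdist_sym p q : tdist p q = tdist q p.
Proof.
suff h a b : tdist a b <= tdist b a by apply/eqP; rewrite eq_le !h.
apply/ler_addgt0Pr => e e0.
have [v vE ve] : exists2 v, tproj v = a - b & enorm v < tdist b a + e.
  by apply: tdist_lt; rewrite ltrDl.
by rewrite (le_trans _ (ltW ve))// -enormN; apply: tdist_le; rewrite tprojN vE opprB.
Qed.

Lemma tdist_triangle q p r : tdist p r <= tdist p q + tdist q r.
Proof.
apply/ler_addgt0Pr => e e0.
have [v vE ve] : exists2 v, tproj v = q - p & enorm v < tdist p q + e / 2.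
  by apply: tdist_lt; rewrite ltrDl divr_gt0.
have [w wE we] : exists2 v, tproj v = r - q & enorm v < tdist q r + e / 2.
  by apply: tdist_lt; rewrite ltrDl divr_gt0.
rewrite (@le_trans _ _ (enorm (v + w)))//.
  by apply: tdist_le; rewrite tprojD vE wE addrC subrKA.
by rewrite (le_trans (enormD _ _))// [e]splitr addrACA lerD// ltW.
Qed.

HB.instance Definition _ := isMetric.Build R T
  tdistxx tdist_positivity tdist_sym tdist_triangle.

Lemma tproj_continuous : continuous tproj.
Proof.
move=> v A /nbhs_ballP[e /= e0 eA].
have s0 : 0 < Num.sqrt n%:R + 1 :> R by rewrite ltr_wpDl ?sqrtr_ge0.
apply/nbhs_ballP; exists (e / (Num.sqrt n%:R + 1)) => [|w]; first exact: divr_gt0.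
rewrite -ball_normE/= => vw; apply: eA.
rewrite ballEmdist/= -[mdist _ _]/(tdist (tproj v) (tproj w)).
apply: (@le_lt_trans _ _ (enorm (w - v))).
  by apply: tdist_le; rewrite tprojD tprojN.
apply: (le_lt_trans (enorm_le_norm _)).
apply: (@le_lt_trans _ _ ((Num.sqrt n%:R + 1) * `|w - v|)).
  by rewrite ler_wpM2r// lerDl.
by rewrite -ltr_pdivlMl// mulrC distrC.
Qed.

End torus_structure.

Definition borel (X : ptopologicalType) := g_sigma_algebraType (@open X).

Section volume.
Context {R : realType}.
Local Notation RR := (measurableTypeR R).

Definition tuple_cons n (x : RR * n.-tuple RR) : n.+1.-tuple RR :=
  [tuple of x.1 :: x.2].

Lemma measurable_tuple_cons n : measurable_fun setT (@tuple_cons n).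
Proof. exact: (measurable_cons measurable_fst measurable_snd). Qed.

HB.instance Definition _ n :=
  isMeasurableFun.Build _ _ _ _ (@tuple_cons n) (@measurable_tuple_cons n).

(* Lebesgue measure on [0, 1]^n; uniform_prob is Lebesgue measure on [0, 1]. *)
Fixpoint cube_lebesgue n : probability (n.-tuple RR) R :=
  match n with
  | 0 => \d_ [tuple]
  | k.+1 => distribution (uniform_prob (@ltr01 R) \x cube_lebesgue k)%E (@tuple_cons k)
  end.

Context {n : nat}.

Definition cube_proj (t : n.-tuple RR) : borel (torus R n) :=
  tproj (\row_j tnth t j).

Lemma measurable_row_open (O : set 'rV[R]_n) : open O ->
  measurable [set t : n.-tuple RR | O (\row_j tnth t j)].
Proof.
move=> oO.
pose B (q : 'rV[rat]_n * nat) : set 'rV[R]_n := @ball R 'rV[R]_n (map_mx ratr q.1) q.2.+1%:R^-1.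
have -> : [set t : n.-tuple RR | O (\row_j tnth t j)] =
    \bigcup_(q in [set q | B q `<=` O]) [set t : n.-tuple RR | B q (\row_j tnth t j)].
  apply/seteqP; split=> [t /= Ot|t [q /= qO]]; last exact: qO.
  have /nbhs_ballP[e /= e0 eO] := open_nbhs_nbhs (conj oO Ot).
  have [k ke] : exists k : nat, k.+1%:R^-1 < e / 2.
    have [k _ /(_ k (leqnn k)) ke] := @near_infty_natSinv_lt R
      (PosNum (divr_gt0 e0 (ltr0Sn R 1))).
    by exists k.
  have k0 : 0 < k.+1%:R^-1 :> R by rewrite invr_gt0.
  have rat_near j : exists q : rat, `|tnth t j - ratr q| < k.+1%:R^-1.
    have tj : tnth t j - k.+1%:R^-1 < tnth t j + k.+1%:R^-1 :> R.
      by rewrite ltrD2l gtrN.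
    have [q] := rat_in_itvoo tj.
    by rewrite in_itv/= => /andP[q1 q2]; exists q; rewrite ltr_distlC q1.
  have [q qh] := choice rat_near.
  exists (\row_j q j, k) => /=.
    move=> y /= yq; apply: eO; rewrite [e]splitr.
    apply: (@ball_triangle _ _ (map_mx ratr (\row_j q j) : 'rV[R]_n)).
      apply/ball_sym; split; first by rewrite divr_gt0.
      by move=> i j; rewrite !mxE; apply: lt_trans ke; rewrite /= distrC.
    exact: le_ball (ltW ke) _ yq.
  by split=> // i j; rewrite !mxE /ball /= distrC.
rewrite bigcup_mkcond; apply: countable_bigcupT_measurable => [|[q k]].
  exact: countableP.
case: ifPn => // _.
rewrite (_ : [set t | _] = \big[setI/setT]_(j < n)
    ((fun t : n.-tuple RR => tnth t j) @^-1` ball (ratr (q 0 j) : R) k.+1%:R^-1)).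
  apply: bigsetI_measurable => j _; rewrite -[X in measurable X]setTI.
  apply: (measurable_tnth j) => //.
  exact: measurable_ball.
apply/seteqP; split=> [t [_ tq]|t].
  by rewrite -bigcap_seq => j _ /=; have := tq 0 j; rewrite !mxE.
rewrite -bigcap_seq => tq; split=> // i j; rewrite !mxE ord1.
by have /= := tq j; apply; rewrite mem_index_enum.
Qed.

Lemma measurable_cube_proj : measurable_fun setT cube_proj.
Proof.
apply: (@measurability _ _ _ (borel (torus R n)) setT cube_proj (@open (torus R n))) => //.
move=> _ [U oU <-]; rewrite setTI.
apply: (@measurable_row_open (@tproj R n @^-1` U)).
apply: open_comp oU => v _; exact: tproj_continuous.
Qed.

HB.instance Definition _ :=
  isMeasurableFun.Build _ _ _ _ cube_proj measurable_cube_proj.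

Definition volume : probability (borel (torus R n)) R :=
  distribution (cube_lebesgue n) cube_proj.

End volume.

Section smooth_maps.
Context {R : realType} {n : nat}.
Local Notation M := (torus R n).
Implicit Types (f g : M -> M) (p : M) (V : set M).

(* f in the charts h |-> p + tproj h and h |-> f p + tproj h, both centred at
   h = 0. *)
Definition local_rep f p (h : 'rV[R]_n) : 'rV[R]_n :=
  tlog (f (p + tproj h) - f p).

(* The derivative acts on row vectors, v |-> v *m tderiv f p: row i is the
   i-th partial derivative. *)
Definition tderiv f p : 'M[R]_n :=
  \matrix_(i < n) 'D_(delta_mx 0 i) (local_rep f p) 0.

Definition tderiv2 f (i : 'I_n) p : 'M[R]_n :=
  'D_(delta_mx 0 i) (fun h => tderiv f (p + tproj h)) 0.

(* Only meaningful for V open. *)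
Record C2_on V f : Prop := {
  C2_on_cont : forall p, V p -> {for p, continuous f} ;
  C2_on_derivable : forall p i, V p ->
    derivable (local_rep f p) 0 (delta_mx 0 i) ;
  C2_on_cont1 : forall p, V p -> {for p, continuous (tderiv f)} ;
  C2_on_derivable2 : forall p i, V p ->
    derivable (fun h => tderiv f (p + tproj h)) 0 (delta_mx 0 i) ;
  C2_on_cont2 : forall p i, V p -> {for p, continuous (tderiv2 f i)}
}.

(* C2_on on all of f @` U makes the inverse branch g a C2 map there. *)
Definition local_diffeo f :=
  C2_on setT f /\
  forall p, exists U : set M, [/\ open U, U p, open (f @` U) &
    exists g, {in U, cancel f g} /\ C2_on (f @` U) g].

End smooth_maps.

Record C2map (R : realType) (n : nat) := {
  C2map_fun :> torus R n -> torus R n ;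
  C2mapP : C2_on setT C2map_fun
}.

Section C2_topology.
Context {R : realType} {n : nat}.
Local Notation C2 := (C2map R n).
Implicit Types (f g h : C2) (e : R).

HB.instance Definition _ := gen_eqMixin C2.
HB.instance Definition _ := gen_choiceMixin C2.

(* The C2 topology on maps of a compact manifold: uniform closeness of the
   maps and of their derivatives of order 1 and 2. *)
Definition C2_ball f e g := forall p : torus R n,
  [/\ ball (f p) e (g p), ball (tderiv f p) e (tderiv g p) &
      forall i, ball (tderiv2 f i p) e (tderiv2 g i p)].

Let C2_ball_center f e : 0 < e -> C2_ball f e f.
Proof. by move=> e0 p; split=> [||i]; exact: ballxx. Qed.

Let C2_ball_sym f g e : C2_ball f e g -> C2_ball g e f.
Proof. by move=> fg p; have [h0 h1 h2] := fg p; split=> [||i]; exact: ball_sym. Qed.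

Let C2_ball_triangle f g h e1 e2 :
  C2_ball f e1 g -> C2_ball g e2 h -> C2_ball f (e1 + e2) h.
Proof.
move=> fg gh p; have [a0 a1 a2] := fg p; have [b0 b1 b2] := gh p.
split=> [||i]; [exact: ball_triangle a0 b0|exact: ball_triangle a1 b1|].
exact: ball_triangle (a2 i) (b2 i).
Qed.

Let C2_ent : set_system (C2 * C2) := entourage_ C2_ball.

Let C2_nbhs f : set_system C2 := nbhs_ C2_ent f.

Let C2_nbhsE : C2_nbhs = nbhs_ C2_ent. Proof. by []. Qed.

HB.instance Definition _ := hasNbhs.Build C2 C2_nbhs.

Let C2_entE : C2_ent = entourage_ C2_ball. Proof. by []. Qed.

HB.instance Definition _ := @Nbhs_isPseudoMetric.Build R C2
  C2_ent C2_nbhsE C2_ball C2_ball_center C2_ball_sym C2_ball_triangle C2_entE.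

End C2_topology.

Section deterministic.
Context {R : realType} {n : nat}.
Local Notation M := (torus R n).
Implicit Types (f : M -> M) (mu : probability (borel M) R).

Definition nonuniformly_expanding f :=
  exists2 c : R, 0 < c & \forall x \ae (@volume R n),
    (limn_esup (fun k => (k%:R^-1 * \sum_(j < k)
       ln (opnorm (invmx (tderiv f (iter j f x)))))%:E) <= (- c)%:E)%E.

Definition distributed_as (orbit : nat -> M) mu := forall phi : M -> R,
  continuous phi ->
  (fun k => k%:R^-1 * \sum_(j < k) phi (orbit j)) @ \oo -->
    Rintegral mu setT phi.

Definition invariant f mu := forall A : set (borel M),
  measurable A -> mu (f @^-1` A) = mu A.

Definition SRB f mu := invariant f mu /\
  exists A : set (borel M), [/\ measurable A, (0 < volume A)%E &
    forall x, A x -> distributed_as (fun j => iter j f x) mu].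

Definition convex_combination_SRB f mu :=
  exists k (nu : 'I_k -> probability (borel M) R) (a : 'I_k -> R),
  [/\ forall i, SRB f (nu i), forall i, 0 <= a i, \sum_i a i = 1 &
      forall A : set (borel M), measurable A ->
        mu A = (\sum_i (a i)%:E * nu i A)%E].

End deterministic.

(* Borel sigma-algebras need an inhabited type. *)
#[short(type="pmetricType")]
HB.structure Definition PMetric (R : numDomainType) :=
  {T of Metric R T & Pointed T}.

Definition support (R : realType) (X : ptopologicalType)
    (P : probability (borel X) R) : set X :=
  [set x | forall U : set (borel X), open (U : set X) -> U x -> (0 < P U)%E].

Definition cylinders (X : ptopologicalType) : set (set (nat -> X)) :=
  [set C | exists i (A : set (borel X)),
    measurable A /\ C = [set t | A (t i)]].

Definition seqs (X : ptopologicalType) :=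
  g_sigma_algebraType (@cylinders X).

(* P = theta^N; this determines P since finite intersections of cylinders
   generate the sigma-algebra. *)
Definition infinite_product (R : realType) (X : ptopologicalType)
    (theta : probability (borel X) R) (P : probability (seqs X) R) :=
  forall k (A : nat -> set (borel X)), (forall i, measurable (A i)) ->
    P [set t | forall i, (i < k)%N -> A i (t i)] =
    (\prod_(i < k) theta (A i))%E.

Section random.
Context {R : realType} {n : nat} {T : pmetricType R}.
Local Notation M := (torus R n).
Variables (f : C2map R n) (tstar : T) (Phi : T -> C2map R n).
Variables (theta : R -> probability (borel T) R).
Variables (thetaN : R -> probability (seqs T) R).

(* The sequence (t_1, t_2, ...) is indexed from 0: t_(k+1) is t k. *)
Fixpoint random_orbit (t : nat -> T) (x : M) (k : nat) : M :=
  if k is j.+1 then Phi (t j) (random_orbit t x j) else x.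

Record random_perturbation : Prop := {
  rp_cont : continuous Phi ;
  rp_star : Phi tstar = f ;
  rp_prod : forall e, 0 < e -> infinite_product (theta e) (thetaN e) ;
  (* theta_e is carried by its support: automatic when T is separable. *)
  rp_supp : forall e, 0 < e -> theta e (support (theta e)) = 1%E ;
  rp_compact : forall e, 0 < e -> compact (support (theta e)) ;
  rp_connected : forall e, 0 < e -> connected (support (theta e)) ;
  rp_nested : forall e e', 0 < e -> e <= e' ->
    support (theta e) `<=` support (theta e') ;
  rp_shrink : forall d, 0 < d ->
    \forall e \near 0^'+, support (theta e) `<=` ball tstar d ;
  rp_nondegenerate : exists e0, [/\ 0 < e0, e0 < 1 &
    forall e, 0 < e -> e < e0 -> exists n0 : nat,
      (exists2 xi, 0 < xi & forall x k, (n0 <= k)%N ->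
         ball (iter k f x) xi `<=`
         [set random_orbit t x k |
            t in [set t | forall i, support (theta e) (t i)]]) /\
      (forall x k, (n0 <= k)%N -> forall A : set (borel M), measurable A ->
         volume A = 0%E ->
         (thetaN e).-negligible [set t | A (random_orbit t x k)])]
}.

Definition physical_measure (e : R) (mu : probability (borel M) R) :=
  exists A : set (borel M), [/\ measurable A, (0 < volume A)%E &
    forall x, A x -> \forall t \ae thetaN e,
      distributed_as (random_orbit t x) mu].

(* The finite intersections of the sets |\int phi dnu - \int phi dmu| < d form
   a basis of weak* neighbourhoods of mu. *)
Definition weak_accumulation (mu : probability (borel M) R) :=
  forall k (phi : 'I_k -> M -> R) (d e1 : R),
    (forall i, continuous (phi i)) -> 0 < d -> 0 < e1 ->
    exists e nu, [/\ 0 < e, e < e1, physical_measure e nu &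
      forall i, `|Rintegral nu setT (phi i) - Rintegral mu setT (phi i)| < d].

End random.

Definition stochastically_stable (R : realType) (n : nat) (f : C2map R n) :=
  forall (T : pmetricType R) (tstar : T) (Phi : T -> C2map R n)
    (theta : R -> probability (borel T) R)
    (thetaN : R -> probability (seqs T) R),
  random_perturbation f tstar Phi theta thetaN ->
  forall mu, weak_accumulation Phi thetaN mu -> convex_combination_SRB f mu.

(* Main.v *)
Require Import Defs.
From HB Require Import structures.
From mathcomp Require Import all_boot all_order all_algebra.
From mathcomp Require Import ring lra zify.
From mathcomp Require Import all_classical all_reals all_analysis.
From mathcomp Require Import measurable_realfun.
Set Implicit Arguments.
Unset Strict Implicit.
Unset Printing Implicit Defensive.
Import Order.TTheory GRing.Theory Num.Theory.
Import numFieldTopology.Exports numFieldNormedType.Exports.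
Local Open Scope classical_set_scope.
Local Open Scope ring_scope.

(** Let U be a small C^2 ball around the doubling map p |-> p + p. A map f in U
    lifts to F x = 2 x + u x with u periodic and C^2-small, so F is a bijection
    of R^n and every translation lifts through f: G = F^-1 (F + v) satisfies
    f o G = f + v, moves points by at most 2/3 |v|, and has a
    (1 + C |v|)-Lipschitz inverse.

    Say that a positive normalized functional nu lies in the cone of K if
    nu (phi (. + v)) <= exp (K |v|) nu phi for all phi >= 0. The lifted
    translations show that f maps the cone of K to that of 2/3 K + n C; and a
    functional in the cone dominates exp (- K / 2) times Lebesgue measure m.
    Splitting off a fixed multiple of m at each step gives exponential
    contraction of the cone under every composition f_k o ... o f_1 of maps of
    U, random or not, hence decay of correlations and an O(k) bound for the
    variance of Birkhoff sums which is uniform over all sequences (f_j).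

    By this bound, Birkhoff averages of phi along a random orbit close to f
    are close, in m-mean, to the m-integral of phi o f^N for N large. So an
    accumulation point mu of physical measures satisfies
    mu phi = lim_N m (phi o f^N); in particular mu is f-invariant. The variance
    bound for the constant sequence f then shows that m-almost every orbit of f
    is distributed as mu, that is, mu is itself an SRB measure. *)

(** * The sup norm on the torus *)

(** In the contraction argument a measure enters only through its integrals of uniformly continuous
    functions. The cone condition is thus a dual form of a Lipschitz bound for the logarithm of a
    density, and densities, Jacobians and transfer operators are never formed: Fubini for
    functionals comes from partitions of unity, and the change of variables from the volume of small
    balls. The price is that translations have to be lifted through f globally; C^2 closeness makes
    the inverse of the lift Lipschitz with constant 1 + O(|v|), not merely Lipschitz.

    The constants fit together as follows. Doubling plus a displacement of Lipschitz constant 1/16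
    expands by at least 3/2, whence the 2/3. For K >= 6 n C one step maps the cone of K into that of
    5/6 K, and the gap between the two pays for removing the multiple exp (- K / 2) / 6 of m.
    Distances use the sup norm: balls are cubes, a shortest lift is found coordinate by coordinate,
    and every point is within 1/2 of 0, which gives the exp (- K / 2). *)

Section torus_norm.
Context {R : realType} {n : nat}.
Local Notation T := (torus R n).
Local Notation V := 'rV[R]_n.
Implicit Types (p q : T) (v w : V).

Lemma rV_norm_coord v j : `|v 0 j| <= `|v|.
Proof.
by rewrite [leRHS]mx_normrE; apply: (le_bigmax _ (fun ij => `|v ij.1 ij.2|) (0, j)).
Qed.

Lemma rV_norm_le v (c : R) : 0 <= c -> (forall j, `|v 0 j| <= c) -> `|v| <= c.
Proof.
by move=> c0 vc; rewrite [leLHS]mx_normrE; apply/bigmax_leP; split=> // -[i j] _; rewrite ord1.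
Qed.

Lemma rV_norm_lt v (c : R) : 0 < c -> (forall j, `|v 0 j| < c) -> `|v| < c.
Proof.
by move=> c0 vc; rewrite [ltLHS]mx_normrE; apply/bigmax_ltP; split=> // -[i j] _; rewrite ord1.
Qed.

Lemma norm_le_enorm v : `|v| <= enorm v.
Proof. by apply: rV_norm_le => [|j]; [exact: enorm_ge0|exact: coord_le_enorm]. Qed.

Lemma tlogK q : tproj (tlog q) = q.
Proof.
rewrite -[RHS]tproj_repr; apply/tproj_eq; apply/mxOverP => i j.
rewrite !mxE ord1 addrAC subrr add0r rpredN.
exact: intr_int.
Qed.

Lemma tlog_itv q j : - 2^-1 <= tlog q 0 j < 2^-1.
Proof.
rewrite mxE; set x := repr q 0 j.
have := floor_le_tmp (x + 2^-1); have := floorD1_gt (x + 2^-1).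
rewrite intrD1 => h1 h2; lra.
Qed.

Lemma tlog_bound q : `|tlog q| <= 2^-1.
Proof.
by apply: rV_norm_le => [|j]; [lra|have := tlog_itv q j; rewrite ler_norml; lra].
Qed.

Lemma tlog_int q v : tproj v = q -> forall j, v 0 j - tlog q 0 j \is a Num.int.
Proof.
rewrite -{1}[q]tlogK => /tproj_eq/mxOverP h j.
by have := h 0 j; rewrite [(v - tlog q) 0 j]mxE [(- tlog q) 0 j]mxE.
Qed.

(** Two lifts differ by an integer in each coordinate, and a number of absolute value at most 1/2 is
    smallest in its class modulo 1. Minimality holds coordinate by coordinate, hence also for the
    sup norm. *)
Lemma tlog_min q v : tproj v = q -> forall j, `|tlog q 0 j| <= `|v 0 j|.
Proof.
move=> vq j; have /norm_intr_ge1 h1 := tlog_int vq j.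
have := tlog_itv q j; move: (tlog q 0 j) (v 0 j) h1 => t x h1 ht.
have [/eqP|/h1] := eqVneq (x - t) 0; first by rewrite subr_eq0 => /eqP ->.
by have := ler_normB x t; have : `|t| <= 2^-1; [rewrite ler_norml|]; lra.
Qed.

(* The sup norm of the shortest lift of q, see tnorm_le. *)
Definition tnorm q : R := `|tlog q|.

Lemma tnorm_le q v : tproj v = q -> tnorm q <= `|v|.
Proof.
move=> vq; apply: rV_norm_le => // j.
by rewrite (le_trans (tlog_min vq j))// rV_norm_coord.
Qed.

Lemma tnorm_ge0 q : 0 <= tnorm q. Proof. exact: normr_ge0. Qed.

Lemma tlog_tproj v : `|v| < 2^-1 -> tlog (tproj v) = v.
Proof.
move=> v2; apply/rowP => j; have /norm_intr_ge1 h1 := tlog_int (erefl (tproj v)) j.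
have := tlog_itv (tproj v) j; have := le_lt_trans (rV_norm_coord v j) v2.
move: (tlog _ 0 j) (v 0 j) h1 => t x h1; rewrite ltr_norml => h2 h3.
apply/eqP; rewrite eq_sym -subr_eq0; apply/negPn/negP => /h1.
by apply/negP; rewrite -ltNge ltr_norml; lra.
Qed.

Lemma tnorm0 : tnorm 0 = 0.
Proof.
by apply/eqP; rewrite eq_le tnorm_ge0 andbT -(normr0 V) tnorm_le// tproj0.
Qed.

Lemma tnormN q : tnorm (- q) = tnorm q.
Proof.
suff h p : tnorm (- p) <= tnorm p.
  by apply/eqP; rewrite eq_le h /= -{1}[q]opprK h.
by rewrite /(tnorm p) -normrN tnorm_le// tprojN tlogK.
Qed.

Lemma tnormB p q : tnorm (p - q) = tnorm (q - p).
Proof. by rewrite -tnormN opprB. Qed.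

Lemma tnormD p q : tnorm (p + q) <= tnorm p + tnorm q.
Proof. by rewrite (le_trans _ (ler_normD _ _))// tnorm_le// tprojD !tlogK. Qed.

Lemma tnorm_tri q p r : tnorm (p - r) <= tnorm (p - q) + tnorm (q - r).
Proof. by rewrite (le_trans _ (tnormD _ _))// addrA subrK. Qed.

Lemma tnorm_tdist p q : tnorm (q - p) <= tdist p q.
Proof.
apply/ler_addgt0Pr => e e0.
have [v vE ve] : exists2 v, tproj v = q - p & enorm v < tdist p q + e.
  by apply: tdist_lt; rewrite ltrDl.
by rewrite (le_trans (tnorm_le vE))// (le_trans (norm_le_enorm v))// ltW.
Qed.

Lemma tdist_tnorm p q : tdist p q <= Num.sqrt n%:R * tnorm (q - p).
Proof. by rewrite (le_trans _ (enorm_le_norm _))// tdist_le// tlogK. Qed.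

Lemma ball_tnorm p e q : ball p e q -> tnorm (q - p) < e.
Proof. by rewrite ballEmdist /= => /(le_lt_trans (tnorm_tdist _ _)). Qed.

Lemma tnorm_ball p e : 0 < e -> exists2 d, 0 < d & forall q, tnorm (q - p) < d -> ball p e q.
Proof.
move=> e0; have s0 : 0 < Num.sqrt n%:R + 1 :> R by rewrite ltr_wpDl ?sqrtr_ge0.
exists (e / (Num.sqrt n%:R + 1)); first exact: divr_gt0.
move=> q; rewrite ltr_pdivlMr// => h; rewrite ballEmdist /=.
apply: le_lt_trans h; rewrite (le_trans (tdist_tnorm _ _))// mulrC.
by rewrite ler_wpM2l ?tnorm_ge0// lerDl.
Qed.

Lemma nbhs_tnormP p (A : set T) :
  nbhs p A <-> exists2 d, 0 < d & forall q, tnorm (q - p) < d -> A q.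
Proof.
split=> [/nbhs_ballP[e /= e0 eA]|[d d0 dA]].
  by have [d d0 h] := tnorm_ball p e0; exists d => // q /h /eA.
by apply/nbhs_ballP; exists d => //= q /ball_tnorm/dA.
Qed.

Lemma torus_compact : compact [set: T].
Proof.
have -> : [set: T] = tproj @` [set v : V | forall i, `[- 2^-1, 2^-1]%classic (v ord0 i)].
  apply/seteqP; split=> // q _; exists (tlog q); last exact: tlogK.
  by move=> j /=; rewrite in_itv/=; have := tlog_itv q j; lra.
apply: continuous_compact; first exact/continuous_subspaceT/tproj_continuous.
by apply: (@rV_compact R n (fun=> `[- 2^-1, 2^-1]%classic)) => i; exact: segment_compact.
Qed.

Definition ucont (phi : T -> R) := forall e : R, 0 < e -> exists2 d : R, 0 < d &
  forall p q, tnorm (p - q) < d -> `|phi p - phi q| < e.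

Lemma ucont_continuous phi : ucont phi -> continuous phi.
Proof.
move=> h p; apply/(@cvgrPdist_lt R R^o T (nbhs p) (nbhs_filter p)) => e /h[d d0 dh].
by apply/nbhs_tnormP; exists d => // q qp; rewrite dh// tnormB.
Qed.

Lemma continuous_ucont phi : continuous phi -> ucont phi.
Proof.
move=> cphi e e0.
have /compact_near_coveringP := torus_compact.
(* Near-covering compactness, with the filter of small d > 0 as parameter, plays the role of a
   Lebesgue number. *)
move=> /(_ _ (0^'+) (fun d p => forall q, tnorm (p - q) < d -> `|phi p - phi q| < e)).
have h1 : forall x, [set: T] x -> \forall x' \near x & d \near 0^'+,
    forall q, tnorm (x' - q) < d -> `|phi x' - phi q| < e.
  move=> x _.
  have /cvgrPdist_lt/(_ (e/2)) := cphi x.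
  rewrite divr_gt0// => /(_ isT)/nbhs_tnormP[d d0 dh].
  exists ([set q | tnorm (q - x) < d/2], [set e | e < d/2]) => /=.
    split; first by apply/nbhs_tnormP; exists (d/2) => //; lra.
    by apply: nbhs_right_lt; lra.
  move=> [y d'] /= [yx d'd] q yq.
  have yx' : tnorm (y - x) < d by lra.
  have qx : tnorm (q - x) < d.
    have := tnorm_tri y q x; rewrite (tnormB q y); lra.
  have := dh _ yx'; have := dh _ qx.
  have := ler_distD (phi x) (phi y) (phi q).
  rewrite (distrC (phi y) (phi x)); lra.
move=> /(_ _ h1) h2.
have h3 : \forall d \near 0^'+, 0 < (d : R) by apply: nbhs_right_gt.
have [d [d0 hd]] := @filter_ex _ _ (at_right_proper_filter (0 : R)) _ (filterI h3 h2).
by exists d => // p q; exact: hd.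
Qed.

Lemma ucont_cst c : ucont (fun=> c).
Proof. by move=> e e0; exists 1 => // p q _; rewrite subrr normr0. Qed.

Lemma ucont_bounded phi : ucont phi -> exists2 M, 0 < M & forall x, `|phi x| <= M.
Proof.
move=> /ucont_continuous cphi.
have /compact_bounded[M [_ hM]] : compact (range phi).
  by apply: continuous_compact; [exact/continuous_subspaceT|exact: torus_compact].
exists (`|M| + 1); first by rewrite ltr_wpDl.
by move=> x; apply: hM; [have := ler_norm M; lra|exists x].
Qed.

Lemma ucontD phi psi : ucont phi -> ucont psi -> ucont (fun x => phi x + psi x).
Proof.
move=> h1 h2 e e0.
have [d1 d10 h1'] := h1 (e/2) ltac:(lra); have [d2 d20 h2'] := h2 (e/2) ltac:(lra).
exists (Num.min d1 d2); first by rewrite lt_min d10.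
move=> p q; rewrite lt_min => /andP[/h1' a /h2' b].
rewrite opprD addrACA; have := ler_normD (phi p - phi q) (psi p - psi q); lra.
Qed.

Lemma ucontM phi psi : ucont phi -> ucont psi -> ucont (fun x => phi x * psi x).
Proof.
move=> h1 h2 e e0.
have [M M0 hM] := ucont_bounded h1; have [N N0 hN] := ucont_bounded h2.
have D0 : 0 < M + N by lra.
have [d1 d10 h1'] := h1 _ (divr_gt0 e0 D0); have [d2 d20 h2'] := h2 _ (divr_gt0 e0 D0).
exists (Num.min d1 d2); first by rewrite lt_min d10.
move=> p q; rewrite lt_min => /andP[/h1' a /h2' b].
have -> : phi p * psi p - phi q * psi q =
  phi p * (psi p - psi q) + (phi p - phi q) * psi q by ring.
rewrite (le_lt_trans (ler_normD _ _))// !normrM.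
have eE : e = M * (e / (M + N)) + e / (M + N) * N by field; lra.
rewrite eE; apply: ler_ltD; last first.
  by rewrite (le_lt_trans (ler_wpM2l (normr_ge0 _) (hN q)))// ltr_pM2r.
by rewrite ler_pM// ltW.
Qed.

Lemma ucontZ c phi : ucont phi -> ucont (fun x => c * phi x).
Proof. by move=> h; apply: ucontM => //; exact: ucont_cst. Qed.

Lemma ucont_sum I (r : seq I) (F : I -> T -> R) :
  (forall i, ucont (F i)) -> ucont (fun x => \sum_(i <- r) F i x).
Proof.
move=> h; elim: r => [|i r ih].
  by under eq_fun do rewrite big_nil; exact: ucont_cst.
by under eq_fun do rewrite big_cons; exact: ucontD.
Qed.

Definition tlip (phi : T -> R) := exists2 L, 0 <= L &
  forall p q, `|phi p - phi q| <= L * tnorm (p - q).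

Lemma tlip_ucont phi : tlip phi -> ucont phi.
Proof.
move=> [L L0 h] e e0; exists (e / (L + 1)); first by rewrite divr_gt0// ltr_wpDl.
move=> p q; rewrite ltr_pdivlMr ?ltr_wpDl// => h1.
by apply: le_lt_trans (h p q) _; have := tnorm_ge0 (p - q); nra.
Qed.

Lemma ucont_translate phi (a : T) : ucont phi -> ucont (fun x => phi (x + a)).
Proof.
move=> h e /h[d d0 dh]; exists d => // p q pq; apply: dh.
by rewrite opprD addrACA subrr addr0.
Qed.

End torus_norm.

(** * Positive functionals on uniformly continuous functions *)

Section states.
Context {R : realType} {n : nat}.
Local Notation T := (torus R n).
Local Notation V := 'rV[R]_n.
Implicit Types (p q x y : T) (v w : V) (phi psi : T -> R) (nu mu : (T -> R) -> R).

Lemma finite_net (d : R) : 0 < d ->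
  exists (I : finType) (g : I -> T), forall x, exists i, tnorm (x - g i) < d.
Proof.
move=> d0; pose N := (Num.truncn d^-1).+1.
have Nd : N%:R^-1 < d.
  by rewrite invf_plt ?posrE// /N truncnS_gt.
exists {ffun 'I_n -> 'I_N}.
exists (fun k : {ffun 'I_n -> 'I_N} => tproj (\row_j ((k j)%:R / N%:R - 2^-1))) => x.
have h (j : 'I_n) : 0 <= tlog x 0 j + 2^-1 < 1 by have := tlog_itv x j; lra.
have kN (j : 'I_n) : (Num.truncn ((tlog x 0%R j + 2^-1) * N%:R)%R < N)%N.
  have /andP[h0 h1] := h j.
  rewrite truncn_lt_nat; first by rewrite gtr_pMl.
  by rewrite mulr_ge0// ltW.
exists [ffun j => Ordinal (kN j)].
apply: le_lt_trans Nd; rewrite -{1}[x]tlogK -tprojN -tprojD.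
apply: (le_trans (tnorm_le (erefl _))); apply: rV_norm_le => [|j]; first by rewrite invr_ge0 ltW.
rewrite [X in `|X|]mxE [X in _ + X]mxE [X in _ - X]mxE ffunE /=.
have /andP[h0 h1] := h j; move: (tlog x 0 j) h0 => t h0.
have /truncn_itv/andP[a b] : 0 <= (t + 2^-1) * N%:R by rewrite mulr_ge0// ltW.
move: a b; rewrite -ler_pdivrMr// -ltr_pdivlMr//; move: (Num.truncn _) => k.
rewrite -[k.+1%:R]natr1 [(k%:R + 1) / _]mulrDl div1r => b a; rewrite ler_norml.
lra.
Qed.

(** Over a net of mesh d/2 the bumps [max 0 (d - tnorm (x - g i))] add up to at least d/2
    everywhere, so dividing by their sum keeps them Lipschitz. These functions serve three purposes:
    exchanging two functionals, reducing to countably many test functions, and approximating open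
    sets. *)
Lemma partition_of_unity (d : R) : 0 < d ->
  exists (I : finType) (g : I -> T) (chi : I -> T -> R),
  [/\ forall i, tlip (chi i), forall i x, 0 <= chi i x,
      forall x, \sum_i chi i x = 1 &
      forall i x, chi i x != 0 -> tnorm (x - g i) < d].
Proof.
move=> d0; have d20 : 0 < d / 2 by lra.
have [I [g hg]] := finite_net d20.
pose b i x : R := Num.max 0 (d - tnorm (x - g i)).
pose B x := \sum_i b i x.
have b0 i x : 0 <= b i x by rewrite /b le_max lexx.
have bB i x : b i x <= B x.
  by rewrite /B (bigD1 i)//= lerDl sumr_ge0.
have Bd x : d / 2 <= B x.
  have [i hi] := hg x; apply: le_trans (bB i x).
  by rewrite /b le_max; apply/orP; right; lra.
have blip i p q : `|b i p - b i q| <= tnorm (p - q).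
  have h1 := tnorm_tri q p (g i); have h2 := tnorm_tri p q (g i).
  rewrite (tnormB q p) in h2; have := tnorm_ge0 (p - q); rewrite /b ler_norml.
  by case: (leP 0 (d - tnorm (p - g i))); case: (leP 0 (d - tnorm (q - g i))) => *; lra.
have Blip p q : `|B p - B q| <= #|I|%:R * tnorm (p - q).
  rewrite /B -sumrB (le_trans (ler_norm_sum _ _ _))//.
  rewrite mulr_natl -sumr_const ler_sum// => i _; exact: blip.
exists I, g, (fun i x => b i x / B x); split=> [i|i x|x|i x].
- exists ((1 + #|I|%:R) * (d / 2)^-1) => [|p q].
    by rewrite mulr_ge0// invr_ge0; lra.
  have Bp := Bd p; have Bq := Bd q.
  have -> : b i p / B p - b i q / B q =
     (b i p - b i q) / B p + (b i q / B q) * (B q - B p) / B p.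
    by field; lra.
  set X := _ * (B q - B p).
  have hX : `|X| <= #|I|%:R * tnorm (p - q).
    rewrite normrM -[leRHS]mul1r ler_pM//; last by rewrite tnormB Blip.
    by rewrite ger0_norm ?divr_ge0 ?ler_pdivrMr ?mul1r ?bB//; lra.
  rewrite -mulrDl normrM normfV (gtr0_norm (_ : 0 < B p)); last lra.
  rewrite ler_pdivrMr; last lra.
  rewrite (le_trans (ler_normD _ _))// (le_trans (lerD (blip i p q) hX))//.
  have -> : (1 + #|I|%:R) / (d / 2) * tnorm (p - q) * B p =
     (tnorm (p - q) + #|I|%:R * tnorm (p - q)) * (B p / (d / 2)) by field; lra.
  rewrite ler_peMr ?addr_ge0 ?mulr_ge0 ?tnorm_ge0//.
  by rewrite ler_pdivlMr ?mul1r.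
- by rewrite divr_ge0//; have := Bd x; lra.
- by rewrite -mulr_suml divff//; apply: lt0r_neq0; apply: lt_le_trans (Bd x).
- move=> h; rewrite ltNge; apply/negP => h2; move/eqP: h; apply.
  by rewrite /b max_l ?mul0r //; lra.
Qed.

(* Nothing is required of nu on functions that are not uniformly continuous. *)
Record state nu : Prop := {
  state_lin : forall (a : R) phi psi, ucont phi -> ucont psi ->
    nu (fun x => a * phi x + psi x) = a * nu phi + nu psi ;
  state_ge0 : forall phi, ucont phi -> (forall x, 0 <= phi x) -> 0 <= nu phi ;
  state_1 : nu (fun=> 1) = 1 }.

Section state_theory.
Context {nu : (T -> R) -> R} (snu : state nu).

Lemma state0 : nu (fun=> 0) = 0.
Proof.
have := state_lin snu (-1) (@ucont_cst R n 1) (@ucont_cst R n 1).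
by rewrite (state_1 snu) !mulN1r addNr.
Qed.

Lemma stateZ a phi : ucont phi -> nu (fun x => a * phi x) = a * nu phi.
Proof.
move=> h; have := state_lin snu a h (@ucont_cst R n 0); rewrite state0 addr0 => <-.
by congr nu; apply/funext => x; rewrite addr0.
Qed.

Lemma stateD phi psi : ucont phi -> ucont psi ->
  nu (fun x => phi x + psi x) = nu phi + nu psi.
Proof.
move=> h k; have := state_lin snu 1 h k; rewrite mul1r => <-.
by congr nu; apply/funext => x; rewrite mul1r.
Qed.

Lemma state_cst c : nu (fun=> c) = c.
Proof.
rewrite -[RHS]mulr1 -(state_1 snu) -(stateZ c (@ucont_cst R n 1)).
by congr nu; apply/funext => x; rewrite mulr1.
Qed.

Lemma stateB phi psi : ucont phi -> ucont psi ->
  nu (fun x => phi x - psi x) = nu phi - nu psi.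
Proof.
move=> h k; have := state_lin snu (-1) k h; rewrite mulN1r addrC => <-.
by congr nu; apply/funext => x; rewrite mulN1r addrC.
Qed.

Lemma state_le phi psi : ucont phi -> ucont psi -> (forall x, phi x <= psi x) ->
  nu phi <= nu psi.
Proof.
move=> h k hk; rewrite -subr_ge0 -stateB//; apply: (state_ge0 snu) => [|x].
  apply: ucontD => //; have := ucontZ (-1) h; congr ucont.
  by apply/funext => x; rewrite mulN1r.
by rewrite subr_ge0.
Qed.

Lemma state_sum I (r : seq I) (F : I -> T -> R) : (forall i, ucont (F i)) ->
  nu (fun x => \sum_(i <- r) F i x) = \sum_(i <- r) nu (F i).
Proof.
move=> h; elim: r => [|i r ih].
  by rewrite big_nil -[RHS]state0; congr nu; apply/funext => x; rewrite big_nil.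
rewrite big_cons -ih -stateD//; last exact: ucont_sum.
by congr nu; apply/funext => x; rewrite big_cons.
Qed.

Lemma state_dist phi psi (e : R) : ucont phi -> ucont psi ->
  (forall x, `|phi x - psi x| <= e) -> `|nu phi - nu psi| <= e.
Proof.
move=> h k hk; rewrite ler_distlC -(state_cst e) -stateB -?stateD//; last 2 first.
- exact: ucont_cst.
- exact: ucont_cst.
apply/andP; split; apply: state_le => //.
- by have := ucontD h (ucont_cst (- e)).
- by move=> x; have := hk x; rewrite ler_norml => /andP[]; lra.
- by have := ucontD h (ucont_cst e).
- by move=> x; have := hk x; rewrite ler_norml => /andP[]; lra.
Qed.

Lemma state_bound phi (M : R) : ucont phi -> (forall x, `|phi x| <= M) -> `|nu phi| <= M.
Proof.
move=> h hM; have := state_dist h (@ucont_cst R n 0) (e := M).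
by rewrite state0 subr0; apply=> x; rewrite subr0.
Qed.

End state_theory.

Definition ucont2 (Psi : T -> T -> R) := forall e : R, 0 < e -> exists2 d : R, 0 < d &
  forall x y x' y', tnorm (x - x') < d -> tnorm (y - y') < d ->
    `|Psi x y - Psi x' y'| < e.

Lemma ucont2_l Psi y : ucont2 Psi -> ucont (fun x => Psi x y).
Proof.
move=> h e /h[d d0 dh]; exists d => // p q pq; apply: dh => //.
by rewrite subrr tnorm0.
Qed.

Lemma ucont2_r Psi x : ucont2 Psi -> ucont (Psi x).
Proof.
move=> h e /h[d d0 dh]; exists d => // p q pq; apply: dh => //.
by rewrite subrr tnorm0.
Qed.

Lemma ucont2_sym Psi : ucont2 Psi -> ucont2 (fun x y => Psi y x).
Proof. by move=> h e /h[d d0 dh]; exists d => // x y x' y' *; exact: dh. Qed.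

Lemma ucont2_state Psi nu : state nu -> ucont2 Psi -> ucont (fun y => nu (Psi ^~ y)).
Proof.
move=> snu h e e0; have [d d0 dh] := h (e / 2) ltac:(lra); exists d => // p q pq.
apply: (@le_lt_trans _ _ (e / 2)); last lra.
apply: state_dist => //; [exact: ucont2_l|exact: ucont2_l|move=> x].
by apply/ltW/dh => //; rewrite subrr tnorm0.
Qed.

(** For finite sums of products the exchange is mere linearity, and a partition of unity in y
    approximates [Psi] uniformly by the sums of [Psi x (g i) * chi i y]. This covers functionals
    such as those of [cone_couple], which are not presented as integrals. *)
Lemma state_fubini Psi nu mu : state nu -> state mu -> ucont2 Psi ->
  nu (fun x => mu (Psi x)) = mu (fun y => nu (Psi ^~ y)).
Proof.
move=> snu smu h; apply/eqP; rewrite -subr_eq0 -normr_le0.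
apply/ler_addgt0Pr => e e0; rewrite add0r.
have [d d0 dh] := h (e / 2) ltac:(lra).
have [I [g [chi [chil chi0 chi1 chid]]]] := partition_of_unity d0.
pose Q := \sum_i nu (Psi ^~ (g i)) * mu (chi i).
have cu i : ucont (chi i) by exact/tlip_ucont.
have approx x y : `|Psi x y - \sum_i Psi x (g i) * chi i y| <= e / 2.
  rewrite -[Psi x y]mulr1 -(chi1 y) mulr_sumr -sumrB.
  rewrite (le_trans (ler_norm_sum _ _ _))//.
  apply: (@le_trans _ _ (\sum_i (e / 2) * chi i y)); last by rewrite -mulr_sumr chi1 mulr1.
  apply: ler_sum => i _; rewrite -mulrBl normrM (ger0_norm (chi0 _ _)).
  have [->|/chid h1] := eqVneq (chi i y) 0; first by rewrite !mulr0.
  by rewrite ler_wpM2r// ltW// dh// subrr tnorm0.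
have smx x : ucont (fun y => \sum_i Psi x (g i) * chi i y).
  by apply: ucont_sum => i; exact: ucontZ.
have smy y : ucont (fun x => \sum_i Psi x (g i) * chi i y).
  apply: ucont_sum => i; have := ucontZ (chi i y) (ucont2_l (g i) h).
  by congr ucont; apply/funext => x; rewrite mulrC.
have muE x : mu (fun y => \sum_i Psi x (g i) * chi i y) = \sum_i Psi x (g i) * mu (chi i).
  rewrite state_sum//; last by move=> i; exact: ucontZ.
  by apply: eq_bigr => i _; rewrite stateZ.
have nuE y : nu (fun x => \sum_i Psi x (g i) * chi i y) = \sum_i nu (Psi ^~ (g i)) * chi i y.
  rewrite state_sum//; last first.
    move=> i; have := ucontZ (chi i y) (ucont2_l (g i) h).
    by congr ucont; apply/funext => x; rewrite mulrC.
  apply: eq_bigr => i _; rewrite mulrC -stateZ//; last exact: ucont2_l.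
  by congr nu; apply/funext => x; rewrite mulrC.
have h1 : `|nu (fun x => mu (Psi x)) - Q| <= e / 2.
  have -> : Q = nu (fun x => mu (fun y => \sum_i Psi x (g i) * chi i y)).
    under eq_fun do rewrite muE.
    rewrite state_sum//; last first.
      move=> i; have := ucontZ (mu (chi i)) (ucont2_l (g i) h).
      by congr ucont; apply/funext => x; rewrite mulrC.
    apply: eq_bigr => i _; rewrite mulrC -stateZ//; last exact: ucont2_l.
    by congr nu; apply/funext => x; rewrite mulrC.
  apply: state_dist => //.
  - exact: (ucont2_state smu (ucont2_sym h)).
  - under eq_fun do rewrite muE.
    apply: ucont_sum => i; have := ucontZ (mu (chi i)) (ucont2_l (g i) h).
    by congr ucont; apply/funext => x; rewrite mulrC.
  - by move=> x; apply: state_dist => //; exact: ucont2_r.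
have h2 : `|mu (fun y => nu (Psi ^~ y)) - Q| <= e / 2.
  have -> : Q = mu (fun y => nu (fun x => \sum_i Psi x (g i) * chi i y)).
    under eq_fun do rewrite nuE.
    rewrite state_sum//; last by move=> i; exact: ucontZ.
    by apply: eq_bigr => i _; rewrite stateZ.
  apply: state_dist => //.
  - exact: ucont2_state.
  - under eq_fun do rewrite nuE.
    by apply: ucont_sum => i; exact: ucontZ.
  - by move=> y; apply: state_dist => //; exact: ucont2_l.
have := ler_distD Q (nu (fun x => mu (Psi x))) (mu (fun y => nu (Psi ^~ y))).
rewrite (distrC Q); lra.
Qed.

End states.

(** * Lebesgue measure on the torus *)

Section borel_states.
Context {R : realType} {n : nat}.
Local Notation T := (torus R n).

Lemma continuous_borel_measurable (phi : T -> R) : continuous phi ->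
  measurable_fun setT (phi : borel T -> R).
Proof.
move=> cphi; apply: (measurability _ (RGenOInfty.measurableE R)) => //.
move=> _ [_ [x ->] <-]; rewrite setTI; apply: sub_sigma_algebra.
by apply: open_comp => // y _; exact: cphi.
Qed.

Lemma ucont_integrable (mu : probability (borel T) R) (phi : T -> R) :
  ucont phi -> mu.-integrable setT (EFin \o phi).
Proof.
move=> h; apply: measurable_bounded_integrable => //.
- exact: le_lt_trans (probability_le1 mu measurableT) (ltry 1).
- by apply: continuous_borel_measurable; exact: ucont_continuous.
- have [M M0 hM] := ucont_bounded h; exists M; split; first exact: num_real.
  by move=> x Mx y _ /=; rewrite (le_trans (hM y))// ltW.
Qed.

Lemma state_Rintegral (mu : probability (borel T) R) : state (Rintegral mu setT).
Proof.
split=> [a phi psi h k|phi h h0|].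
- rewrite RintegralD//; last 2 first.
  + exact: ucont_integrable (ucontZ a h).
  + exact: ucont_integrable k.
  by rewrite RintegralZl//; exact: ucont_integrable.
- exact: Rintegral_ge0.
- by rewrite Rintegral_cst// mul1r; exact: (congr1 fine (probability_setT mu)).
Qed.

End borel_states.

Lemma Rintegral_sum d (X : measurableType d) (R : realType)
    (mu : {measure set X -> \bar R}) I (s : seq I) (F : I -> X -> R) :
  (forall i, mu.-integrable setT (EFin \o F i)) ->
  mu.-integrable setT (EFin \o (fun x => \sum_(i <- s) F i x)) /\
  Rintegral mu setT (fun x => \sum_(i <- s) F i x) = \sum_(i <- s) Rintegral mu setT (F i).
Proof.
move=> iF; elim: s => [|i s [ih1 ih2]].
  under eq_fun do rewrite big_nil; rewrite big_nil; split; last first.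
    by rewrite Rintegral_cst// mul0r.
  exact: (integrable0 _ setT).
under eq_fun do rewrite big_cons; rewrite big_cons -ih2 -RintegralD//; split => //.
by have := integrableD measurableT (iF i) ih1; apply: eq_integrable.
Qed.

(** * Translation invariance of the volume, through rotations of the coordinates of the cube *)

Section rotation.
Context {R : realType}.
Local Notation RR := (measurableTypeR R).
Local Notation leb := (@lebesgue_measure R).
Local Notation U := (uniform_prob (@ltr01 R)).

Lemma uniform_prob01E (A : set RR) : measurable A -> U A = leb (A `&` `[0, 1]).
Proof.
move=> mA; rewrite /uniform_prob integral_uniform_pdf.
rewrite (eq_integral (cst 1%E)); last first.
  move=> x; rewrite inE => -[_ /=]; rewrite in_itv/= /uniform_pdf => ->.
  by rewrite subr0 invr1.
by rewrite integral_cst ?mul1e//; exact: measurableI.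
Qed.

Lemma lebesgue_translate (c : R) (A : set RR) : measurable A ->
  leb [set x | A (x + c)] = leb A.
Proof.
move=> mA; have mf : measurable_fun setT ((fun x => x + c) : RR -> RR).
  exact: measurable_funD.
have := @lebesgue_measure_unique R (pushforward leb ((fun x => x + c) : RR -> RR)).
move=> h; apply/esym/h => // _ [[a b] _ <-] /=.
rewrite /pushforward /=.
rewrite (_ : _ @^-1` _ = `]a - c, b - c]%classic); last first.
  by apply/seteqP; split => x /=; rewrite !in_itv/= ltrBlDr lerBrDr.
by rewrite !lebesgue_measure_itv/= !lte_fin ltrD2r; case: ifPn => // _; congr EFin; ring.
Qed.

Definition rot (al s : R) : R := if s < 1 - al then s + al else s + al - 1.

Lemma measurable_rot al : measurable_fun setT (rot al : RR -> RR).
Proof.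
apply: measurable_fun_ifT => //=.
- exact: measurable_fun_ltr.
- exact: measurable_funD.
- by apply: measurable_funB => //; exact: measurable_funD.
Qed.

Lemma uniform_rot al (A : set RR) : 0 <= al < 1 -> measurable A ->
  U (rot al @^-1` A) = U A.
Proof.
move=> /andP[al0 al1] mA.
have mrA : measurable (rot al @^-1` A : set RR).
  by rewrite -[X in measurable X]setTI; exact: (measurable_rot al).
rewrite !uniform_prob01E//.
(* Without the null endpoint 1, the rotation is a bijection of [0, 1[ that exchanges two
   intervals. *)
have h (B : set RR) : measurable B -> leb (B `&` `[0, 1]) = leb (B `&` `[0, 1[).
  move=> mB; rewrite -(@setUitv1 _ _ (BLeft 0) 1 true) ?bnd_simp// setIUr.
  rewrite measureU//; last 3 first.
  - exact: measurableI.
  - exact: measurableI.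
  - apply/seteqP; split=> // z /= [[_ +] [_ z1]]; rewrite in_itv/= z1 ltxx andbF//.
  rewrite [X in (_ + X)%E](_ : _ = 0%E) ?adde0//.
  apply/eqP; rewrite -measure_le0 -(@lebesgue_measure_set1 R 1).
  by apply: le_measure; rewrite ?inE//; exact: measurableI.
rewrite !h//.
have split (c : R) (B : set RR) : 0 <= c <= 1 -> measurable B ->
    leb (B `&` `[0, 1[) = (leb (B `&` `[0%R, c[) + leb (B `&` `[c, 1%R[))%E.
  move=> c01 mB; rewrite -measureU//; last 3 first.
  - exact: measurableI.
  - exact: measurableI.
  - by apply/seteqP; split=> // z /= [[_ +] [_ +]]; rewrite !in_itv/=; lra.
  congr leb; rewrite -setIUr; congr setI; apply/seteqP; split => z /=; rewrite !in_itv/=.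
    by have [zc|zc] := ltP z c => ?; [left|right]; lra.
  by case; lra.
rewrite (split (1 - al) (rot al @^-1` A)) ?(split al A)//; [|lra|lra].
rewrite addeC; congr (_ + _)%E.
  rewrite -(lebesgue_translate (al - 1) (A := A `&` `[0, al[)); last exact: measurableI.
  congr leb; apply/seteqP; split => z /=; rewrite !in_itv/= /rot.
    move=> [+ zz]; rewrite ltNge; have -> : 1 - al <= z by lra.
    by rewrite /= addrA => ?; split => //; lra.
  move=> [+ zz]; rewrite ltNge; have -> : 1 - al <= z by lra.
  by rewrite /= addrA => ?; split => //; lra.
rewrite -(lebesgue_translate al (A := A `&` `[al, 1[)); last exact: measurableI.
congr leb; apply/seteqP; split => z /=; rewrite !in_itv/= /rot.
  move=> [+ zz]; have -> : z < 1 - al by lra.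
  by move=> ?; split => //; lra.
move=> [+ zz]; have -> : z < 1 - al by lra.
by move=> ?; split => //; lra.
Qed.

Definition trot n (al : nat -> R) (t : n.-tuple RR) : n.-tuple RR :=
  [tuple rot (al i) (tnth t i) | i < n].

Lemma measurable_trot n al : measurable_fun setT (@trot n al).
Proof.
apply/measurable_fun_tnthP => i.
rewrite (_ : _ \o _ = rot (al i) \o (fun t : n.-tuple RR => tnth t i)).
  apply: measurableT_comp; first exact: measurable_rot.
  exact: measurable_tnth.
by apply/funext => t /=; rewrite tnth_mktuple.
Qed.

Lemma trot_cons n (al : nat -> R) (x : RR) (t : n.-tuple RR) :
  trot al (tuple_cons (x, t)) = tuple_cons (rot (al 0%N) x, trot (fun i => al i.+1) t).
Proof.
apply/eq_from_tnth => i; rewrite tnth_mktuple.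
case: (unliftP ord0 i) => [j ->|->]; last by rewrite !tnth0.
by rewrite !tnthS tnth_mktuple.
Qed.

Lemma cube_trot n (al : nat -> R) (A : set (n.-tuple RR)) :
  (forall i, 0 <= al i < 1) -> measurable A ->
  cube_lebesgue n (trot al @^-1` A) = cube_lebesgue n A.
Proof.
elim: n al A => [|n ih] al A hal mA.
  have -> : trot al @^-1` A = A; last by [].
  by apply/seteqP; split=> t /=; rewrite (tuple0 t) (tuple0 (trot _ _)).
have mtc := @measurable_tuple_cons R n.
pose B := @tuple_cons R n @^-1` A : set (RR * n.-tuple RR).
have mB : measurable B by rewrite -[B]setTI; exact: mtc.
pose rt (z : RR * n.-tuple RR) : RR * n.-tuple RR :=
  (rot (al 0%N) z.1, trot (fun i => al i.+1) z.2).
have mrt : measurable_fun setT rt.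
  apply/measurable_fun_pairP; split => /=.
    by apply: (measurableT_comp (measurable_rot _)).
  by apply: (measurableT_comp (measurable_trot _)).
rewrite /= /distribution /pushforward.
transitivity ((U \x cube_lebesgue n)%E (rt @^-1` B)).
  congr ((U \x cube_lebesgue n)%E _).
  by apply/seteqP; split => -[x t] /=; rewrite /B /= trot_cons.
rewrite -[LHS]/(pushforward (U \x cube_lebesgue n)%E rt B).
apply/esym.
pose m' : {measure set (RR * n.-tuple RR) -> \bar R} :=
  [the measure _ _ of pushforward (U \x cube_lebesgue n)%E rt].
apply: (@product_measure_unique _ _ _ _ R U (cube_lebesgue n) (m' mrt)) => //.
move=> X Y mX mY; rewrite /m' /= /pushforward.
rewrite (_ : rt @^-1` _ = (rot (al 0%N) @^-1` X) `*` (trot (fun i => al i.+1) @^-1` Y))//.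
rewrite product_measure1E//; last 2 first.
- by rewrite -[X in measurable X]setTI; exact: measurable_rot.
- by rewrite -[X in measurable X]setTI; exact: measurable_trot.
by congr (_ * _)%E; [exact: uniform_rot|exact: ih].
Qed.

Lemma cube_box n (D : set RR) : measurable D ->
  cube_lebesgue n [set t | forall j, D (tnth t j)] = (U D ^+ n)%E.
Proof.
move=> mD; elim: n => [|n ih].
  by rewrite /= diracE mem_set// => -[].
have mDn k : measurable [set t : k.-tuple RR | forall j, D (tnth t j)].
  rewrite (_ : [set t | _] = \big[setI/setT]_(j < k)
    ((fun t : k.-tuple RR => tnth t j) @^-1` D)).
    apply: bigsetI_measurable => j _; rewrite -[X in measurable X]setTI.
    exact: (measurable_tnth j).
  apply/seteqP; split=> [t tD|t].
    by rewrite -bigcap_seq => j _ /=; exact: tD.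
  by rewrite -bigcap_seq => tD j; apply: tD; rewrite /= mem_index_enum.
transitivity ((U \x cube_lebesgue n)%E (D `*` [set t : n.-tuple RR | forall j, D (tnth t j)])); last first.
  by rewrite expeS -ih; apply: product_measure1E => //; exact: mDn.
rewrite /= /distribution /pushforward; congr ((U \x cube_lebesgue n)%E _).
apply/seteqP; split => -[x t] /=.
  move=> h; split; first by have := h ord0; rewrite tnth0.
  by move=> j; have := h (lift ord0 j); rewrite tnthS.
move=> [h1 h2] j; case: (unliftP ord0 j) => [i ->|->]; last by rewrite tnth0.
by rewrite tnthS; exact: h2.
Qed.

End rotation.

Section volume_facts.
Context {R : realType} {n : nat}.
Local Notation T := (torus R n).
Local Notation RR := (measurableTypeR R).
Local Notation vol := (@volume R n).
Local Notation U := (uniform_prob (@ltr01 R)).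

Lemma continuous_borel_map (f : T -> T) : continuous f ->
  measurable_fun setT (f : borel T -> borel T).
Proof.
move=> cf; apply: (@measurability _ _ (borel T) (borel T) setT f (@open T)) => //.
move=> _ [B oB <-]; rewrite setTI; apply: sub_sigma_algebra.
by apply: open_comp oB => v _; exact: cf.
Qed.

Lemma continuous_translate (a : T) : continuous (fun x : T => x + a).
Proof.
move=> p A /nbhs_tnormP[d d0 dA]; apply/nbhs_tnormP; exists d => // q qp.
by apply: dA; rewrite opprD addrACA subrr addr0.
Qed.

(** Through [cube_proj], translation by [a] becomes rotation of each coordinate by the fractional
    part of the corresponding coordinate of a representative of [a]. *)
Lemma volume_translate_set (a : T) (A : set (borel T)) : measurable A ->
  vol [set x | A (x + a)] = vol A.
Proof.
move=> mA; pose fr (x : R) := x - (Num.floor x)%:~R.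
(* The angles of [trot] form a sequence on nat, so that the induction on the dimension can shift
   them; indices from n on get the angle 0. *)
pose al i := oapp (fun j => fr (repr a 0 j)) 0 (insub i : option 'I_n).
have hfr x : 0 <= fr x < 1.
  by rewrite /fr; have := floor_le_tmp x; have := floorD1_gt x; rewrite intrD1; lra.
have hal i : 0 <= al i < 1.
  by rewrite /al; case: insubP => //= *; lra.
have mcA : measurable (@cube_proj R n @^-1` A).
  by rewrite -[X in measurable X]setTI; exact: measurable_cube_proj.
rewrite /volume /= /distribution /pushforward -[RHS](cube_trot hal)//.
congr (cube_lebesgue n _); apply/seteqP.
suff h t : cube_proj (trot al t) = cube_proj t + a.
  by split=> t /=; rewrite h.
rewrite /cube_proj -{1}[a]tproj_repr -tprojD; apply/tproj_eq; apply/mxOverP => i j.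
rewrite ord1 {i} !mxE !tnth_mktuple /rot /al valK /= /fr.
case: ifPn => _.
  rewrite (_ : _ - _ = - (Num.floor (repr a 0 j))%:~R); last by ring.
  by rewrite rpredN intr_int.
rewrite (_ : _ - _ = - ((Num.floor (repr a 0 j))%:~R + 1)); last by ring.
by rewrite rpredN -intrD1 intr_int.
Qed.

Local Notation mean := (Rintegral vol setT).

Lemma volume_translate (a : T) (phi : T -> R) : ucont phi ->
  mean (fun x => phi (x + a)) = mean phi.
Proof.
move=> h; have mt : measurable_fun setT ((fun x => x + a) : borel T -> borel T).
  exact: (continuous_borel_map (@continuous_translate a)).
rewrite /Rintegral; congr fine.
have := @integral_pushforward _ _ (borel T) (borel T) R (fun x => x + a) mt vol setT
  (EFin \o phi).
rewrite preimage_setT => <- //.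
- apply: eq_measure_integral => A mA _; exact: (volume_translate_set a mA).
- by apply/measurable_EFinP; apply: continuous_borel_measurable; exact: ucont_continuous.
- exact: ucont_integrable (ucont_translate a h).
Qed.

Lemma open_tball (r : R) : open [set q : T | tnorm q < r].
Proof.
rewrite openE => q /= qr; apply/nbhs_tnormP.
exists (r - tnorm q); first by rewrite subr_gt0.
by move=> p pq /=; have := tnorm_tri q p 0; rewrite !subr0; lra.
Qed.

Lemma measurable_tball (r : R) : measurable ([set q : T | tnorm q < r] : set (borel T)).
Proof. by apply: sub_sigma_algebra; exact: open_tball. Qed.

(** A sup norm ball is a product: its preimage in the cube asks each coordinate to be within r of an
    integer. For r <= 1/2 this leaves two disjoint intervals of length r, at the two ends of
    [0, 1]. *)
Lemma volume_tball (r : R) : 0 < r -> r <= 2^-1 ->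
  vol [set q | tnorm q < r] = ((2 * r) ^+ n)%:E.
Proof.
move=> r0 r2.
pose D : set RR := \bigcup_(k : int) [set x | `|x - k%:~R| < r].
have mD : measurable D.
  apply: countable_bigcupT_measurable => [|k]; first exact: countableP.
  rewrite (_ : [set x | _] = ball (k%:~R : R) r); first exact: measurable_ball.
  by apply/seteqP; split => x; rewrite /ball/= distrC.
pose I1 : set RR := [set` `[0%R, r[]; pose I2 : set RR := [set` `]1 - r, 1%R]].
have DI : D `&` `[0, 1] = I1 `|` I2.
  apply/seteqP; split=> [x [[k _ /=]]|x]; rewrite /I1 /I2 /= !in_itv/=.
    rewrite ltr_norml => hk x01; have [k0|k0|k0] := ltgtP k 0.
    - have : k%:~R <= (-1)%:~R :> R by rewrite ler_int; move: k0; lia.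
      by lra.
    - have [k1|k1|k1] := ltgtP k 1; first by move: k0 k1; lia.
      + have : 2%:~R <= k%:~R :> R by rewrite ler_int; move: k1; lia.
        by lra.
      + by right; move: hk; rewrite k1; lra.
    - by left; move: hk; rewrite k0; lra.
  by case=> hx; (split; last lra); [exists 0|exists 1] => //=; rewrite ltr_norml; lra.
have UD : U D = (2 * r)%:E.
  rewrite uniform_prob01E// DI.
  have -> : lebesgue_measure (I1 `|` I2) = (lebesgue_measure I1 + lebesgue_measure I2)%E.
    apply: measureU; [exact: measurable_itv|exact: measurable_itv|].
    apply/seteqP; split=> // x [].
    by rewrite /I1 /I2 /= !in_itv/=; lra.
  rewrite !lebesgue_measure_itv/= !lte_fin r0 ifT; last by rewrite ltrBlDr ltrDl.
  by rewrite -EFinD; congr EFin; ring.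
have tn v : tnorm (tproj v : T) < r <-> forall j, exists k : int, `|v 0 j - k%:~R| < r.
  split=> [h j|h].
    have /intrP[k hk] := tlog_int (erefl (tproj v)) j.
    exists k; rewrite -hk opprB addrCA subrr addr0.
    exact: le_lt_trans (rV_norm_coord _ _) h.
  have [k hk] := choice h.
  have e : tproj (v - \row_j (k j)%:~R) = tproj v :> T.
    apply/tproj_eq/mxOverP => i j; rewrite ord1 !mxE addrAC subrr add0r rpredN.
    exact: intr_int.
  apply: (le_lt_trans (tnorm_le e)); apply: rV_norm_lt => // j.
  by rewrite !mxE.
rewrite EFin_expe -UD -(cube_box n mD).
rewrite /volume /= /distribution /pushforward; congr (cube_lebesgue n _).
apply/seteqP; split=> t /=; rewrite /cube_proj tn => h j; have := h j; rewrite mxE.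
  by move=> [k hk]; exists k.
by move=> [k _ hk]; exists k.
Qed.

Lemma mean_tball (r : R) : 0 < r -> r <= 2^-1 ->
  mean \1_([set q | tnorm q < r] : set (borel T)) = (2 * r) ^+ n.
Proof.
move=> r0 r2; rewrite /Rintegral integral_indic//; last exact: measurable_tball.
by rewrite setIT; exact: (congr1 fine (volume_tball r0 r2)).
Qed.

Definition tent (r : R) (q : T) : R := Num.max 0 (1 - tnorm q / r).

Lemma tent_ge0 r q : 0 <= tent r q. Proof. by rewrite /tent le_max lexx. Qed.

Lemma tent_supp r q : 0 < r -> tent r q != 0 -> tnorm q < r.
Proof.
move=> r0 h; rewrite ltNge; apply/negP => h2; move/eqP: h; apply.
by rewrite /tent max_l// subr_le0 ler_pdivlMr// mul1r.
Qed.

Lemma tent_mono r r' q q' : 0 < r -> 0 < r' -> tnorm q' / r' <= tnorm q / r ->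
  tent r q <= tent r' q'.
Proof.
by move=> r0 r'0 h; rewrite /tent ge_max !le_max lexx/= lerD2l lerN2 h orbT.
Qed.

Lemma tent_lip r p q : 0 < r -> `|tent r p - tent r q| <= tnorm (p - q) / r.
Proof.
move=> r0.
have h : `|tnorm p - tnorm q| <= tnorm (p - q).
  rewrite ler_norml; have := tnorm_tri q p 0; have := tnorm_tri p q 0.
  by rewrite !subr0 (tnormB q p); lra.
have h2 : `|tnorm p / r - tnorm q / r| <= tnorm (p - q) / r.
  rewrite -mulrBl normrM [X in _ * X]ger0_norm ?invr_ge0 ?ler_pM2r ?invr_gt0//.
  exact: ltW.
have : 0 <= tnorm (p - q) / r by rewrite divr_ge0 ?tnorm_ge0// ltW.
move: h2; rewrite /tent; move: (tnorm p / r) (tnorm q / r) (tnorm (p - q) / r) => a b c.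
rewrite !ler_norml.
by case: (leP 0 (1 - a)); case: (leP 0 (1 - b)) => *; lra.
Qed.

Lemma ucont_tent r : 0 < r -> ucont (tent r).
Proof.
move=> r0; apply: tlip_ucont; exists r^-1; first by rewrite invr_ge0 ltW.
by move=> p q; rewrite mulrC tent_lip.
Qed.

(** A Riemann sum for the integral of (1 - s)^n over [0, 1], the ratio between the mean of a tent
    and the volume of its ball. Its value never matters: it does not depend on the radius, so it
    cancels when two radii are compared. *)
Definition ctent (N : nat) : R := N%:R^-1 * \sum_(i < N) (1 - i%:R / N%:R) ^+ n.

Lemma count_lt_bounds (N : nat) (y : R) :
  Num.min N%:R y <= \sum_(i < N) (i%:R < y)%R%:R <= Num.max 0 (y + 1).
Proof.
elim: N => [|N /andP[ih1 ih2]].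
  by rewrite big_ord0 ge_min le_max !lexx.
rewrite big_ord_recr /= -[N.+1%:R]natr1; apply/andP; split.
  case: (ltP N%:R y) => Ny; rewrite ?addr0.
    rewrite ge_min lerD2r; apply/orP; left; apply: le_trans ih1.
    by rewrite le_min lexx ltW.
  by apply: le_trans ih1; rewrite (min_r Ny) ge_min lexx orbT.
case: (ltP N%:R y) => Ny; rewrite ?addr0//.
rewrite le_max; apply/orP; right; rewrite lerD2r.
apply: le_trans (ltW Ny); rewrite -[N in leRHS]card_ord -sumr_const.
by apply: ler_sum => i _; case: (_ < _).
Qed.

(* Layer cake: tent r is within 1/N of the average over i < N of the
   indicators of the balls of radius (1 - i/N) r. *)
Lemma mean_tent_approx (r : R) N : 0 < r -> r <= 2^-1 -> (0 < N)%N ->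
  `|mean (tent r) - (2 * r) ^+ n * ctent N| <= N%:R^-1.
Proof.
move=> r0 r2 N0; have N0' : 0 < N%:R :> R by rewrite ltr0n.
pose B (i : 'I_N) : set (borel T) := [set q | tnorm q < (1 - i%:R / N%:R) * r].
have iN (i : 'I_N) : 0 < (1 - i%:R / N%:R : R) <= 1.
  by rewrite subr_gt0 ltr_pdivrMr// mul1r ltr_nat ltn_ord lerBlDr lerDl divr_ge0.
have mB i : measurable (B i).
  exact: measurable_tball.
pose s q : R := N%:R^-1 * \sum_(i < N) \1_(B i) q.
have s_tent q : tent r q <= s q <= tent r q + N%:R^-1.
  have -> : s q = N%:R^-1 * \sum_(i < N) (i%:R < N%:R * (1 - tnorm q / r))%R%:R.
    congr (_ * _); apply: eq_bigr => i _; rewrite indicE; congr (_%:R); congr nat_of_bool.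
    rewrite (_ : (q \in B i) = (tnorm q < (1 - i%:R / N%:R) * r)); last first.
      by apply/idP/idP; rewrite inE.
    rewrite -[LHS]ltr_pdivrMr// [in RHS]mulrC -[RHS]ltr_pdivrMr//.
    by rewrite ltrBrDr addrC -ltrBrDr.
  have /andP[h1 h2] := count_lt_bounds N (N%:R * (1 - tnorm q / r)).
  have x0 : 0 <= tnorm q / r by rewrite divr_ge0 ?tnorm_ge0// ltW.
  have e : tent r q = N%:R^-1 * Num.max 0 (N%:R * (1 - tnorm q / r)).
    rewrite /tent maxr_pMr ?invr_ge0 ?ltW// mulr0 mulKf// gt_eqF//.
  apply/andP; split.
    rewrite e ler_pM2l ?invr_gt0//.
    move: h1; rewrite min_r => [h1|]; last by rewrite ger_pMr// lerBlDr lerDl.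
    by rewrite ge_max h1 sumr_ge0.
  rewrite e -[X in _ <= _ + X]mulr1 -mulrDr ler_pM2l ?invr_gt0//.
  by apply: (le_trans h2); rewrite ge_max lerD2r !le_max lexx orbT addr_ge0 ?le_max ?lexx.
have is1 i : vol.-integrable setT (EFin \o (\1_(B i) : borel T -> R)).
  exact: (integrable_indic _ (mB i)).
have [is2 is3] := Rintegral_sum (index_enum 'I_N) is1.
have is4 : vol.-integrable setT (EFin \o (s : borel T -> R)).
  by have := integrableZl measurableT N%:R^-1 is2; apply: eq_integrable.
have sE : mean s = (2 * r) ^+ n * ctent N.
  rewrite /s RintegralZl// is3 /ctent mulrCA; congr (_ * _); rewrite mulr_sumr.
  apply: eq_bigr => i _; have /andP[i0 i1] := iN i.
  rewrite mean_tball -?exprMn.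
  - by congr (_ ^+ _); ring.
  - exact: mulr_gt0.
  - by apply: le_trans r2; rewrite ger_pMl.
have it := ucont_integrable vol (ucont_tent r0).
have iN1 : vol.-integrable setT (EFin \o (fun q : borel T => tent r q + N%:R^-1)).
  exact: ucont_integrable (ucontD (ucont_tent r0) (ucont_cst _)).
rewrite -sE distrC ger0_norm; last first.
  by rewrite subr_ge0; apply: le_Rintegral => // q _; have /andP[] := s_tent q.
rewrite lerBlDl; apply: (@le_trans _ _ (mean (fun q => tent r q + N%:R^-1))).
  by apply: le_Rintegral => // q _; have /andP[] := s_tent q.
rewrite (stateD (state_Rintegral _) (ucont_tent r0) (ucont_cst _)).
by rewrite (state_cst (state_Rintegral _)).
Qed.

(** The layer-cake approximations with the same N scale exactly by t^n; the two errors of order 1/N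
    are then made smaller than e. *)
Lemma mean_tent_scale (r t : R) : 0 < r -> 1 <= t -> t * r <= 2^-1 ->
  mean (tent (t * r)) <= t ^+ n * mean (tent r).
Proof.
move=> r0 t1 tr2; have t0 : 0 < t by lra.
have r2 : r <= 2^-1 by nra.
apply/ler_addgt0Pr => e e0.
pose N := (Num.truncn ((1 + t ^+ n) / e)).+1.
have hN : (1 + t ^+ n) * N%:R^-1 <= e.
  by rewrite ler_pdivrMr// -ler_pdivrMl// mulrC ltW// truncnS_gt.
have h1 := mean_tent_approx (mulr_gt0 t0 r0) tr2 (ltn0Sn _ : (0 < N)%N).
have h2 := mean_tent_approx r0 r2 (ltn0Sn _ : (0 < N)%N).
have e1 : (2 * (t * r)) ^+ n * ctent N = t ^+ n * ((2 * r) ^+ n * ctent N).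
  by rewrite [RHS]mulrA -exprMn; congr (_ ^+ _ * _); ring.
rewrite e1 in h1; move: h1 h2; rewrite !ler_norml => /andP[_ h1] /andP[h2 _].
have tn0 : 0 <= t ^+ n by rewrite exprn_ge0// ltW.
have : t ^+ n * ((2 * r) ^+ n * ctent N) <= t ^+ n * (mean (tent r) + N%:R^-1).
  by rewrite ler_wpM2l//; lra.
rewrite mulrDr; rewrite mulrDl mul1r in hN; lra.
Qed.

Lemma mean_tent_gt0 (r : R) : 0 < r -> r <= 2^-1 -> 0 < mean (tent r).
Proof.
move=> r0 r2; have r20 : 0 < r / 2 by lra.
pose B : set (borel T) := [set q | tnorm q < r / 2].
have mB : measurable B.
  exact: measurable_tball.
have iB : vol.-integrable setT (EFin \o (fun q : borel T => 2^-1 * \1_B q)).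
  have := integrableZl measurableT 2^-1 (integrable_indic vol mB).
  by apply: eq_integrable.
apply: (@lt_le_trans _ _ (mean (fun q => 2^-1 * \1_B q))).
  rewrite RintegralZl//; last exact: (integrable_indic vol mB).
  rewrite mean_tball//; last lra.
  by rewrite mulr_gt0// exprn_gt0//; lra.
apply: le_Rintegral => //; first exact: ucont_integrable (ucont_tent r0).
move=> q _; rewrite indicE; have [|_] := boolP (q \in B); last by rewrite mulr0 tent_ge0.
rewrite inE /B /= => h; rewrite mulr1 /tent le_max; apply/orP; right.
by rewrite lerBrDr addrC -lerBrDr ler_pdivrMr//; lra.
Qed.

End volume_facts.

(** * Cones of functionals and their contraction *)

Section cones.
Context {R : realType} {n : nat}.
Local Notation T := (torus R n).
Local Notation V := 'rV[R]_n.
Local Notation mean := (Rintegral (@volume R n) setT).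
Implicit Types (p q x y : T) (v w : V) (phi psi : T -> R) (nu mu : (T -> R) -> R).
Implicit Types (f g G H : T -> T) (K L M a b c r e d : R).

Let smean : state mean := state_Rintegral _.

Definition tuc G := forall e : R, 0 < e -> exists2 d : R, 0 < d &
  forall p q, tnorm (p - q) < d -> tnorm (G p - G q) < e.

Lemma tuc_id : tuc idfun. Proof. by move=> e e0; exists e. Qed.

Lemma tuc_opp : tuc (fun x : T => - x).
Proof. by move=> e e0; exists e => // p q; rewrite -[- p - - q]opprD tnormN. Qed.

Lemma tuc_comp G H : tuc G -> tuc H -> tuc (G \o H).
Proof.
move=> hG hH e /hG[d d0 hd]; have [d' d'0 hd'] := hH _ d0.
by exists d' => // p q /hd' /hd.
Qed.

Lemma ucont_comp phi G : ucont phi -> tuc G -> ucont (fun x => phi (G x)).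
Proof.
move=> h hG e /h[d /hG[d' d'0 hd'] hd].
by exists d' => // p q /hd' /hd.
Qed.

Lemma ucont2_sub phi G : ucont phi -> tuc G -> ucont2 (fun x y => phi (y - G x)).
Proof.
move=> h hG e /h[d d0 hd]; have [d' d'0 hd'] := hG (d / 2) ltac:(lra).
exists (Num.min d' (d / 2)); first by rewrite lt_min d'0; lra.
move=> x y x' y'; rewrite !lt_min => /andP[/hd' h1 _] /andP[_ h2]; apply: hd.
rewrite (_ : _ - _ = (y - y') + (G x' - G x)); last first.
  by rewrite opprB [X in _ + X = _]addrC addrACA [X in _ + X = _]addrC.
have := tnormD (y - y') (G x' - G x); rewrite (tnormB (G x')); lra.
Qed.

Lemma ucont2M (P Q : T -> T -> R) M N : ucont2 P -> ucont2 Q ->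
  (forall x y, `|P x y| <= M) -> (forall x y, `|Q x y| <= N) -> 0 < M -> 0 < N ->
  ucont2 (fun x y => P x y * Q x y).
Proof.
move=> hP hQ PM QN M0 N0 e e0.
have [d d0 hd] := hP (e / (2 * N)) ltac:(by rewrite divr_gt0// mulr_gt0).
have [d' d'0 hd'] := hQ (e / (2 * M)) ltac:(by rewrite divr_gt0// mulr_gt0).
exists (Num.min d d'); first by rewrite lt_min d0.
move=> x y x' y'; rewrite !lt_min => /andP[h1 h1'] /andP[h2 h2'].
have -> : P x y * Q x y - P x' y' * Q x' y' =
  P x y * (Q x y - Q x' y') + (P x y - P x' y') * Q x' y' by ring.
rewrite (le_lt_trans (ler_normD _ _))// !normrM.
have eE : e = M * (e / (2 * M)) + e / (2 * N) * N by field; lra.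
rewrite eE; apply: ler_ltD; last first.
  rewrite (le_lt_trans (ler_wpM2l (normr_ge0 _) (QN x' y')))// ltr_pM2r//.
  exact: hd.
by rewrite ler_pM// ltW// hd'.
Qed.

Lemma ucont2_snd phi : ucont phi -> ucont2 (fun _ y => phi y).
Proof. by move=> h e /h[d d0 hd]; exists d => // x y x' y' _ /hd. Qed.

Definition kern r q : R := tent r q / mean (tent r).

Lemma ucont_kern r : 0 < r -> ucont (@kern r).
Proof.
move=> r0; have := ucontZ (mean (tent r))^-1 (ucont_tent (n := n) r0).
by congr ucont; apply/funext => q; rewrite mulrC.
Qed.

Lemma kern_ge0 r q : 0 < r -> r <= 2^-1 -> 0 <= kern r q.
Proof. by move=> r0 r2; rewrite divr_ge0 ?tent_ge0// ltW// mean_tent_gt0. Qed.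

Lemma mean_kern r : 0 < r -> r <= 2^-1 -> mean (kern r) = 1.
Proof.
move=> r0 r2; rewrite -(@mulVf _ (mean (tent r))); last by rewrite gt_eqF// mean_tent_gt0.
rewrite -(stateZ smean _ (ucont_tent r0)); congr Rintegral; apply/funext => q.
by rewrite mulrC.
Qed.

Lemma kern_supp r q : 0 < r -> kern r q != 0 -> tnorm q < r.
Proof. by move=> r0; rewrite mulf_eq0 negb_or => /andP[/(tent_supp r0)]. Qed.

Lemma ucont2_kern r G psi : 0 < r -> tuc G -> ucont psi ->
  ucont2 (fun x y => kern r (y - G x) * psi y).
Proof.
move=> r0 hG h; have [M M0 hM] := ucont_bounded h.
have [N N0 hN] := ucont_bounded (ucont_kern r0).
apply: (ucont2M (M := N) (N := M)) => //; [|exact: ucont2_snd].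
exact: ucont2_sub (ucont_kern r0) hG.
Qed.

Lemma mean_kern_shift r z psi : 0 < r -> ucont psi ->
  mean (fun y => kern r (y - z) * psi y) = mean (fun y => kern r y * psi (y + z)).
Proof.
move=> r0 h; rewrite -[LHS](volume_translate z).
  by congr Rintegral; apply/funext => y; rewrite addrK.
by apply: ucontM => //; exact: (ucont_translate (- z) (ucont_kern r0)).
Qed.

(* Averaging chi against tents of small radius r reduces the claim to
   m (tent ((1 + b) r)) <= (1 + b)^n m (tent r). *)
Lemma change_of_variables G H b chi : 0 <= b ->
  cancel G H -> tuc G -> (forall x y, tnorm (H x - H y) <= (1 + b) * tnorm (x - y)) ->
  ucont chi -> (forall x, 0 <= chi x) ->
  mean (fun x => chi (G x)) <= (1 + b) ^+ n * mean chi.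
Proof.
move=> b0 GH hG Hlip hchi chi0; apply/ler_addgt0Pr => e e0.
have [d d0 hd] := hchi e e0.
pose t := 1 + b; have t1 : 1 <= t by rewrite /t lerDl.
have t0 : 0 < t by lra.
(* Below d, [chi] varies by less than e on the support of the kernel; the other bound keeps the
   widened radius t r at most 1/2, where the volume formula for balls is valid. *)
pose r := Num.min d (2 * t)^-1.
have r0 : 0 < r by rewrite lt_min d0 invr_gt0 mulr_gt0.
have trh : t * r <= 2^-1.
  rewrite -ler_pdivlMl// -invfM mulrC; by rewrite ge_min mulrC lexx orbT.
have r2 : r <= 2^-1 by nra.
have c0 := mean_tent_gt0 (n := n) r0 r2.
have uk := ucont_kern r0.
have k2 := ucont2_kern r0 hG hchi.
have h1 z : `|chi z - mean (fun y => kern r (y - z) * chi y)| <= e.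
  rewrite -[chi z]mulr1 -(mean_kern r0 r2) -(stateZ smean _ uk) mean_kern_shift//.
  rewrite -stateB//; [|exact: ucontZ|by apply: ucontM => //; exact: ucont_translate].
  rewrite -[leRHS]mulr1 -(mean_kern r0 r2) -(stateZ smean _ uk).
  rewrite ler_norml -mulN1r -(stateZ smean)//; last exact: ucontZ.
  have u1 : ucont (fun x => chi z * kern r x - kern r x * chi (x + z)).
    have := ucontD (ucontZ (chi z) uk) (ucontZ (-1) (ucontM uk (ucont_translate z hchi))).
    by congr ucont; apply/funext => x; rewrite mulN1r.
  have h x : `|chi z * kern r x - kern r x * chi (x + z)| <= e * kern r x.
    rewrite [chi z * _]mulrC -mulrBr normrM ger0_norm ?kern_ge0// mulrC.
    have [->|/(kern_supp r0) h] := eqVneq (kern r x) 0; first by rewrite !mulr0.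
    rewrite ler_wpM2r ?kern_ge0// ltW// hd// opprD addrCA subrr addr0 tnormN.
    by apply: (lt_le_trans h); rewrite ge_min lexx.
  apply/andP; split; apply: state_le => //; do ?by do 2? [apply: ucontZ].
  - by move=> x; have := h x; rewrite ler_norml mulN1r => /andP[].
  - by move=> x; have := h x; rewrite ler_norml => /andP[].
apply: (@le_trans _ _ (mean (fun x => mean (fun y => kern r (y - G x) * chi y)) + e)).
  rewrite -[X in _ + X](state_cst smean) -stateD//; last 2 first.
  - exact: (ucont2_state smean (ucont2_sym k2)).
  - exact: ucont_cst.
  apply: state_le => //; first exact: ucont_comp.
    apply: ucontD; last exact: ucont_cst.
    exact: (ucont2_state smean (ucont2_sym k2)).
  by move=> x; have := h1 (G x); rewrite ler_norml; lra.
rewrite lerD2r (state_fubini smean smean k2) -(stateZ smean)//.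
apply: state_le => //; [exact: (ucont2_state smean k2)|exact: ucontZ|move=> y].
have tr0 : 0 < t * r by exact: mulr_gt0.
have uG : ucont (fun x => tent r (y - G x)).
  exact: (ucont2_l y (ucont2_sub (ucont_tent r0) hG)).
have uH : ucont (fun x => tent (t * r) (x - H y)).
  exact: (ucont_translate (- H y) (ucont_tent tr0)).
have -> : mean (fun x => kern r (y - G x) * chi y) =
    mean (fun x => tent r (y - G x)) * (chi y / mean (tent r)).
  rewrite mulrC -(stateZ smean)//; congr Rintegral; apply/funext => x.
  by rewrite /kern; ring.
(* Since x = H (G x), the distance from x to H y is at most t times that from G x to y: a tent of
   radius r in y - G x lies below a tent of radius t r in x - H y. *)
have h3 : mean (fun x => tent r (y - G x)) <= t ^+ n * mean (tent r).
  apply: le_trans (mean_tent_scale r0 t1 trh).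
  rewrite -(volume_translate (- H y) (ucont_tent tr0)).
  apply: state_le => // x; apply: tent_mono => //.
  rewrite ler_pdivrMr// (_ : _ / r * _ = t * tnorm (y - G x)); last by field; lra.
  by rewrite -{1}[x]GH (tnormB y).
apply: le_trans (ler_wpM2r _ h3) _; first by rewrite divr_ge0// ltW.
by rewrite (_ : _ * _ * _ = t ^+ n * chi y)//; field; exact: lt0r_neq0.
Qed.

(* For an absolutely continuous nu: the logarithm of the density is
   K-Lipschitz. *)
Definition cone K nu := state nu /\ forall v phi, ucont phi -> (forall x, 0 <= phi x) ->
  nu (fun x => phi (x + tproj v)) <= expR (K * `|v|) * nu phi.

Lemma cone_mean K : 0 <= K -> cone K mean.
Proof.
move=> K0; split=> // v phi h h0; rewrite volume_translate//.
by rewrite ler_peMl ?(state_ge0 smean)// -expR0 ler_expR mulr_ge0.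
Qed.

Lemma cone_tnorm K nu q phi : cone K nu -> ucont phi -> (forall x, 0 <= phi x) ->
  nu (fun x => phi (x + q)) <= expR (K * tnorm q) * nu phi.
Proof. by move=> [_ h] hp p0; rewrite -{1}[q]tlogK; exact: h. Qed.

Section mollify.
Variables (nu : (T -> R) -> R) (K : R).
Hypotheses (K0 : 0 <= K) (cnu : cone K nu).
Let snu : state nu := cnu.1.

Lemma mollifyE r psi : 0 < r -> ucont psi ->
  nu (fun x => mean (fun y => kern r (y - x) * psi y)) =
  mean (fun y => kern r y * nu (fun x => psi (x + y))).
Proof.
move=> r0 h.
have -> : (fun x => mean (fun y => kern r (y - x) * psi y)) =
          (fun x => mean (fun y => kern r y * psi (y + x))).
  by apply/funext => x; exact: mean_kern_shift.
have u2 : ucont2 (fun x y : T => kern r y * psi (y + x)).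
  have [M M0 hM] := ucont_bounded h; have [N N0 hN] := ucont_bounded (ucont_kern r0).
  apply: (ucont2M (M := N) (N := M)) => //; first exact: ucont2_snd (ucont_kern r0).
  have tN := tuc_opp.
  have := ucont2_sub h tN; congr ucont2; apply/funext => x; apply/funext => y.
  by rewrite opprK.
rewrite (state_fubini snu smean u2); congr Rintegral; apply/funext => y.
rewrite -(stateZ snu); last exact: ucont_translate.
by congr nu; apply/funext => x; rewrite addrC.
Qed.

Lemma ucont_translates psi : ucont psi -> ucont (fun y => nu (fun x => psi (x + y))).
Proof.
move=> h; apply: (ucont2_state snu (Psi := fun x y => psi (x + y))).
have tN := tuc_opp.
have := ucont2_sub h tN; congr ucont2; apply/funext => x; apply/funext => y.
by rewrite opprK addrC.
Qed.

(** The kernel only moves points by less than r, so the cone inequality bounds the effect of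
    convolution by the factor exp (K r). Unlike [nu], the mollified functional visibly has a density
    with respect to m, to which [change_of_variables] applies. *)
Lemma mollify_ge r psi : 0 < r -> r <= 2^-1 -> ucont psi -> (forall x, 0 <= psi x) ->
  nu psi <= expR (K * r) * nu (fun x => mean (fun y => kern r (y - x) * psi y)).
Proof.
move=> r0 r2 h h0; rewrite mollifyE//.
rewrite -[leLHS]mulr1 -(mean_kern r0 r2) -!(stateZ smean)//; last 2 first.
- by apply: ucontM; [exact: ucont_kern|exact: ucont_translates].
- exact: ucont_kern.
apply: state_le => //.
- by apply: ucontZ; exact: ucont_kern.
- by apply: ucontZ; apply: ucontM; [exact: ucont_kern|exact: ucont_translates].
move=> y; rewrite [leRHS]mulrCA [leLHS]mulrC.
have [->|/(kern_supp r0) hy] := eqVneq (kern r y) 0; first by rewrite !mul0r.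
rewrite ler_wpM2l ?kern_ge0//.
have := cone_tnorm (- y) cnu (ucont_translate y h) (fun x => h0 _).
under eq_fun do rewrite subrK.
move=> /le_trans; apply; rewrite ler_wpM2r//.
  by apply: (state_ge0 snu) => //; exact: ucont_translate.
by rewrite ler_expR tnormN ler_wpM2l// ltW.
Qed.

Lemma mollify_le r psi : 0 < r -> r <= 2^-1 -> ucont psi -> (forall x, 0 <= psi x) ->
  nu (fun x => mean (fun y => kern r (y - x) * psi y)) <= expR (K * r) * nu psi.
Proof.
move=> r0 r2 h h0; rewrite mollifyE//.
rewrite -[leRHS]mulr1 -(mean_kern r0 r2) -!(stateZ smean)//; last exact: ucont_kern.
apply: state_le => //.
- by apply: ucontM; [exact: ucont_kern|exact: ucont_translates].
- by apply: ucontZ; exact: ucont_kern.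
move=> y; rewrite [leRHS]mulrC.
have [->|/(kern_supp r0) hy] := eqVneq (kern r y) 0; first by rewrite !mul0r.
rewrite ler_wpM2l ?kern_ge0//.
apply: le_trans (cone_tnorm y cnu h h0) _; rewrite ler_wpM2r//.
  exact: (state_ge0 snu).
by rewrite ler_expR ler_wpM2l// ltW.
Qed.

(** Formally, with h the density of [nu]: h y <= exp (K a) h (G y) because G moves y by at most a,
    and substituting G in the integral of (h psi) o G costs (1 + b)^n. Mollification makes this
    rigorous with an extra factor exp (2 K r), and r tends to 0. *)
Lemma cone_change G H a b psi : 0 <= a -> 0 <= b ->
  cancel G H -> tuc G -> (forall x, exists2 w, G x = x + tproj w & `|w| <= a) ->
  (forall x y, tnorm (H x - H y) <= (1 + b) * tnorm (x - y)) ->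
  ucont psi -> (forall x, 0 <= psi x) ->
  nu (fun x => psi (G x)) <= expR (K * a) * (1 + b) ^+ n * nu psi.
Proof.
move=> a0 b0 GH hG Glift Hlip h h0; set B := expR (K * a) * _ * _.
have uG := ucont_comp h hG; have pG0 : forall x, 0 <= psi (G x) by move=> x.
have n0 : 0 <= nu (fun x => psi (G x)) by exact: (state_ge0 snu).
have key r : 0 < r -> r <= 2^-1 ->
    nu (fun x => psi (G x)) <= expR (K * r) * (expR (K * r) * B).
  move=> r0 r2; apply: le_trans (mollify_ge r0 r2 uG pG0) _.
  rewrite ler_pM2l ?expR_gt0//.
  (* The density of the mollified functional. *)
  pose hh y := nu (fun x => kern r (y - x)).
  have k2 := ucont2_sub (ucont_kern r0) tuc_id.
  have uhh : ucont hh := ucont2_state snu k2.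
  have hh0 y : 0 <= hh y.
    by apply: (state_ge0 snu) => [|x]; [exact: (ucont2_l y k2)|exact: kern_ge0].
  have fub chi : ucont chi ->
      nu (fun x => mean (fun y => kern r (y - x) * chi y)) = mean (fun y => hh y * chi y).
    move=> hc; rewrite (state_fubini snu smean (ucont2_kern r0 tuc_id hc)).
    congr Rintegral; apply/funext => y.
    rewrite mulrC -(stateZ snu); last exact: (ucont2_l y k2).
    by congr nu; apply/funext => x; rewrite mulrC.
  rewrite fub//.
  have hhG y : hh y <= expR (K * a) * hh (G y).
    have [w Gw wa] := Glift y.
    have := cnu.2 w _ (ucont2_l (G y) k2) (fun x => kern_ge0 _ r0 r2).
    rewrite /hh (_ : (fun x => kern r (G y - (x + tproj w))) = (fun x => kern r (y - x))).
      move=> /le_trans; apply; rewrite ler_wpM2r//; first exact: hh0.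
      by rewrite ler_expR ler_wpM2l.
    apply/funext => x; congr kern; rewrite Gw.
    by rewrite opprD addrACA subrr addr0.
  apply: (@le_trans _ _ (mean (fun y => expR (K * a) * (hh (G y) * psi (G y))))).
    apply: state_le => //.
    - exact: ucontM.
    - apply: ucontZ; exact: (ucontM (ucont_comp uhh hG) uG).
    - by move=> y; rewrite mulrA ler_wpM2r.
  rewrite stateZ//; last exact: (ucontM (ucont_comp uhh hG) uG).
  apply: (@le_trans _ _ (expR (K * a) * ((1 + b) ^+ n * mean (fun y => hh y * psi y)))).
    rewrite ler_pM2l ?expR_gt0//.
    apply: (change_of_variables (chi := fun y => hh y * psi y) b0 GH) => //.
      exact: ucontM.
    by move=> y; rewrite mulr_ge0.
  rewrite -fub// /B -[X in _ <= _ * X]mulrA [leRHS]mulrCA ler_pM2l ?expR_gt0// [leRHS]mulrCA.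
  by rewrite ler_wpM2l ?exprn_ge0 ?addr_ge0//; exact: mollify_le.
apply/ler_addgt0Pr => e e0.
set A := nu _ in n0 key *.
(* From A exp (- 2 K r) <= B and exp (- 2 K r) >= 1 - 2 K r, the loss is at most 2 K r A, which this
   choice of r keeps below e. *)
pose r := Num.min 2^-1 (e / (2 * K * A + 1)).
have D0 : 0 < 2 * K * A + 1 by rewrite ltr_wpDl// !mulr_ge0.
have r0 : 0 < r by rewrite lt_min invr_gt0 ltr0n/= divr_gt0.
have := key r r0; rewrite {1}/r ge_min lexx => /(_ isT).
rewrite mulrA -expRD => h1.
have h2 : A * expR (- (K * r + K * r)) <= B.
  by rewrite expRN ler_pdivrMr ?expR_gt0// mulrC.
have h3 := expR_ge1Dx (- (K * r + K * r)).
have h4 : A * (1 - (K * r + K * r)) <= B by apply: le_trans h2; rewrite ler_wpM2l.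
have h5 : r * (2 * K * A + 1) <= e by rewrite -ler_pdivlMr// /r ge_min lexx orbT.
rewrite mulrDr mulr1 in h5; lra.
Qed.

End mollify.

(* Every translation by tproj v lifts through f to a map G with inverse H;
   the factor 2/3 < 1 expresses that f is expanding. *)
Record good (C : R) (f : T -> T) := {
  good_tuc : tuc f ;
  good_lift : forall v, exists G H, [/\ cancel G H, tuc G,
    forall x, exists2 w, G x = x + tproj w & `|w| <= 2 / 3 * `|v|,
    forall x y, tnorm (H x - H y) <= (1 + C * `|v|) * tnorm (x - y) &
    forall x, f (G x) = f x + tproj v] }.

Lemma state_push nu f : state nu -> tuc f -> state (fun phi => nu (fun x => phi (f x))).
Proof.
move=> snu hf; split=> [a phi psi h k|phi h h0|].
- by rewrite (state_lin snu)//; exact: ucont_comp.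
- by apply: (state_ge0 snu) => //; exact: ucont_comp.
- exact: (state_1 snu).
Qed.

(** Translating after f amounts to applying G before f, and [cone_change] bounds the effect of G.
    The term 2/3 K comes from the displacement of G, the term n C from the volume factor (1 + C
    |v|)^n <= exp (n C |v|). *)
Lemma cone_push C f K nu : 0 <= C -> 0 <= K -> good C f -> cone K nu ->
  cone (2 / 3 * K + n%:R * C) (fun phi => nu (fun x => phi (f x))).
Proof.
move=> C0 K0 gf cnu; split; first exact: state_push cnu.1 (good_tuc gf).
move=> v phi h h0; have [G [H [GH hG Glift Hlip fG]]] := good_lift gf v.
under eq_fun do rewrite -fG.
have hf := ucont_comp h (good_tuc gf).
have Cv : 0 <= C * `|v| by rewrite mulr_ge0.
have a0 : 0 <= 2 / 3 * `|v| by rewrite mulr_ge0.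
apply: le_trans (cone_change K0 cnu a0 Cv GH hG Glift Hlip hf (fun x => h0 _)) _.
rewrite ler_wpM2r ?(state_ge0 cnu.1)// (mulrDl (2 / 3 * K)) expRD.
rewrite (_ : K * (2 / 3 * `|v|) = 2 / 3 * K * `|v|); last by ring.
rewrite ler_pM2l ?expR_gt0// -(mulrA n%:R) expRM_natl.
by rewrite lerXn2r ?nnegrE ?addr_ge0 ?expR_ge0// expR_ge1Dx.
Qed.

Lemma cone_weaken K K' nu : K <= K' -> cone K nu -> cone K' nu.
Proof.
move=> KK' [snu h]; split=> // v phi hp p0; apply: (le_trans (h v phi hp p0)).
by rewrite ler_wpM2r ?(state_ge0 snu)// ler_expR ler_wpM2r.
Qed.

(** By translation invariance, m phi is the m-average over y of [nu] applied to the translate of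
    [phi] by y, and every y has a lift of sup norm at most 1/2. *)
Lemma cone_ge_mean K nu phi : 0 <= K -> cone K nu -> ucont phi -> (forall x, 0 <= phi x) ->
  mean phi <= expR (K / 2) * nu phi.
Proof.
move=> K0 cnu h h0; have snu := cnu.1.
have u2 : ucont2 (fun x y => phi (x + y)).
  have := ucont2_sub h tuc_opp; congr ucont2; apply/funext => x; apply/funext => y.
  by rewrite opprK addrC.
have -> : mean phi = nu (fun x => mean (fun y => phi (x + y))).
  rewrite -[LHS](state_cst snu); congr nu; apply/funext => x.
  rewrite -(volume_translate x h); congr Rintegral; apply/funext => y.
  by rewrite addrC.
rewrite (state_fubini snu smean u2) -[leRHS](state_cst smean).
apply: state_le => //; [exact: (ucont2_state snu u2)|exact: ucont_cst|move=> y].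
apply: le_trans (cone_tnorm y cnu h h0) _; rewrite ler_wpM2r ?(state_ge0 snu)//.
by rewrite ler_expR ler_wpM2l// tlog_bound.
Qed.

(** The multiple of m split off at each step. By [cone_ge_mean], exp (- K / 2) m is dominated by the
    functional; keeping only a sixth of it leaves a remainder that still lies in the cone. *)
Definition crate K := expR (- (K / 2)) / 6.

Lemma crate_bounds K : 0 <= K -> 0 < crate K < 1.
Proof.
move=> K0; rewrite /crate divr_gt0 ?expR_gt0//= ltr_pdivrMr// mul1r.
have : expR (- (K / 2)) <= 1 by rewrite -expR0 ler_expR oppr_le0 divr_ge0.
lra.
Qed.

(* AM-GM for five copies of [expR x] and one of [1]. *)
Lemma expR_convex6 (x : R) : 6 * expR (5 / 6 * x) <= 5 * expR x + 1.
Proof.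
set y := expR (x / 6).
have -> : expR (5 / 6 * x) = y ^+ 5.
  by rewrite -expRM_natl; congr expR; lra.
have -> : expR x = y ^+ 6.
  by rewrite -expRM_natl; congr expR; lra.
have y0 : 0 < y by exact: expR_gt0.
rewrite -subr_ge0.
have -> : 5 * y ^+ 6 + 1 - 6 * y ^+ 5 =
  (y - 1) ^+ 2 * (5 * y ^+ 4 + 4 * y ^+ 3 + 3 * y ^+ 2 + 2 * y + 1) by ring.
by rewrite mulr_ge0 ?sqr_ge0// !addr_ge0// mulr_ge0// ?exprn_ge0// ltW.
Qed.

(* f_* nu = c m + (1 - c) nu' with c := crate K and nu' again in the cone. *)
Lemma cone_couple C f K nu : 0 <= C -> 6 * n%:R * C <= K -> good C f -> cone K nu ->
  cone K (fun phi => (nu (fun x => phi (f x)) - crate K * mean phi) / (1 - crate K)).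
Proof.
move=> C0 hK gf cnu; have K0 : 0 <= K by apply: le_trans hK; rewrite !mulr_ge0.
set c := crate K; have /andP[c0 c1] := crate_bounds K0; rewrite -/c in c0 c1.
pose nu' phi := nu (fun x => phi (f x)).
have cnu' : cone (5 / 6 * K) nu'.
  (* 6 n C <= K gives n C <= K / 6, and 2/3 + 1/6 = 5/6. *)
  apply: cone_weaken (cone_push C0 K0 gf cnu); lra.
have snu' := cnu'.1.
have lower phi : ucont phi -> (forall x, 0 <= phi x) -> c * mean phi <= nu' phi / 6.
  move=> h h0; have := cone_ge_mean K0 (cone_weaken _ cnu') h h0.
  have -> : 5 / 6 * K <= K by lra.
  move=> /(_ isT) h1; rewrite /c /crate mulrAC ler_pM2r ?invr_gt0//.
  by rewrite -ler_pdivlMl ?expR_gt0// -expRN opprK.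
have p0 phi : ucont phi -> (forall x, 0 <= phi x) -> 0 <= nu' phi.
  by move=> *; exact: (state_ge0 snu').
split.
  split=> [a phi psi h k|phi h h0|].
  - rewrite -[nu (fun x => a * phi (f x) + psi (f x))]/(nu' (fun x => a * phi x + psi x)).
    rewrite (state_lin snu')// (state_lin smean)// /nu'.
    by field; rewrite subr_eq0 gt_eqF.
  - rewrite divr_ge0//; last lra.
    by rewrite subr_ge0 (le_trans (lower _ h h0))//; have := p0 _ h h0; rewrite /nu'; lra.
  - rewrite (state_1 smean) (state_1 cnu.1) mulr1 divff//; lra.
move=> v phi h h0; rewrite volume_translate// mulrA ler_pM2r ?invr_gt0; last lra.
have := cnu'.2 v phi h h0; rewrite /= -/(nu' phi) => h1.
have h2 := lower _ h h0.
have h3 := expR_convex6 (K * `|v|).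
have h4 := p0 _ h h0.
have h5 : 1 <= expR (K * `|v|) by rewrite -expR0 ler_expR mulr_ge0.
rewrite -(mulrA (5 / 6)) in h1.
move: h1; rewrite -/(nu' (fun x => phi (x + tproj v))).
move: (nu' (fun x => _)) (nu' phi) (mean phi) h2 h4 => A B D h2 h4 h1.
move: (expR (5 / 6 * (K * `|v|))) (expR (K * `|v|)) h1 h3 h5 => X Y h1 h3 h5.
(* The goal is X B - c D <= Y (B - c D), that is (Y - 1) c D <= (Y - X) B. As c D <= B / 6, it is
   enough that 6 X <= 5 Y + 1, which is [expR_convex6]. *)
have h6 : (Y - 1) * (c * D) <= (Y - 1) * (B / 6) by rewrite ler_wpM2l//; lra.
have h7 : X * B <= (5 * Y + 1) / 6 * B by rewrite ler_wpM2r//; lra.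
have -> : Y * (B - c * D) = Y * B - (Y - 1) * (c * D) - c * D by ring.
lra.
Qed.

Fixpoint fcomp (F : nat -> T -> T) k x : T :=
  if k is j.+1 then F j (fcomp F j x) else x.

Definition fshift i (F : nat -> T -> T) j := F (i + j)%N.

Lemma fcompD F i j x : fcomp F (i + j) x = fcomp (fshift i F) j (fcomp F i x).
Proof.
by elim: j => [|j ih]; [rewrite addn0|rewrite addnS /= ih].
Qed.

Lemma fcomp_tuc F k : (forall i, tuc (F i)) -> tuc (fcomp F k).
Proof.
by move=> h; elim: k => [|k ih]; [exact: tuc_id|exact: (tuc_comp (h k) ih)].
Qed.

Lemma cone_fcomp C F K nu k : 0 <= C -> 6 * n%:R * C <= K ->
  (forall i, good C (F i)) -> cone K nu ->
  cone K (fun phi => nu (fun x => phi (fcomp F k x))).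
Proof.
move=> C0 hK gF; have K0 : 0 <= K by apply: le_trans hK; rewrite !mulr_ge0.
elim: k nu => [//|k ih] nu cnu /=.
apply: (cone_weaken (K := 2 / 3 * K + n%:R * C)); first lra.
exact: (cone_push C0 K0 (gF k) (ih _ cnu)).
Qed.

(** The functionals pushed by the first map share the component [crate K] times m, which cancels in
    the difference. What remains is 1 - [crate K] times a difference of two functionals of the same
    cone, to which the induction applies along the shifted sequence. *)
Lemma cone_contraction C F K nu mu phi M k : 0 <= C -> 6 * n%:R * C <= K ->
  (forall i, good C (F i)) -> cone K nu -> cone K mu ->
  ucont phi -> (forall x, `|phi x| <= M) ->
  `|nu (fun x => phi (fcomp F k x)) - mu (fun x => phi (fcomp F k x))|
    <= (1 - crate K) ^+ k * (2 * M).
Proof.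
move=> C0 hK gF cnu cmu h hM.
have K0 : 0 <= K by apply: le_trans hK; rewrite !mulr_ge0.
have /andP[c0 c1] := crate_bounds K0.
elim: k F nu mu gF cnu cmu => [|k ih] F nu mu gF cnu cmu.
  rewrite expr0 mul1r (le_trans (ler_normB _ _))// mulr2n mulrDl mul1r lerD//.
    exact: (state_bound cnu.1).
  exact: (state_bound cmu.1).
have := ih (fshift 1 F) _ _ (fun i => gF _) (cone_couple C0 hK (gF 0%N) cnu)
  (cone_couple C0 hK (gF 0%N) cmu).
have e nu0 : nu0 (fun x => phi (fcomp F k.+1 x)) =
    nu0 (fun x => phi (fcomp (fshift 1 F) k (F 0%N x))).
  by congr nu0; apply/funext => x; rewrite -add1n fcompD.
have c10 : 0 < 1 - crate K by rewrite subr_gt0.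
rewrite -mulrBl normrM normfV (gtr0_norm c10) ler_pdivrMr//.
rewrite opprB addrA subrK !e.
by move=> /le_trans; apply; rewrite mulrC mulrA exprS.
Qed.

End cones.

(** * Decay of correlations and variance of Birkhoff sums *)

Section averages.
Context {R : realType}.

(* Between consecutive squares the average of a bounded sequence varies little. *)
Lemma average_from_squares (a : nat -> R) (B : R) : (forall j, `|a j| <= B) ->
  (fun l => (l.+1 ^ 2)%:R^-1 * \sum_(j < l.+1 ^ 2) a j) @ \oo --> (0 : R) ->
  (fun k => k%:R^-1 * \sum_(j < k) a j) @ \oo --> (0 : R).
Proof.
move=> aB /cvgrPdist_le h; apply/cvgrPdist_le => e e0.
have B0 : 0 <= B := le_trans (normr_ge0 _) (aB 0%N).
have [L _ hL] := h (e / 2) ltac:(lra).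
(* The second bound gives 4 B / e <= l + 1, so the at most 2 (l + 1) terms beyond the square (l +
   1)^2, each at most B, contribute at most e / 2 to the average. *)
pose L' := maxn L (Num.truncn (4 * B / e)).+1.
exists (L'.+1 ^ 2)%N => // k /= hk.
have k0 : (0 < k)%N by apply: leq_trans hk; rewrite expn_gt0.
have [l /andP[lk kl]] : exists l, (l.+1 ^ 2 <= k < l.+2 ^ 2)%N.
  have hex : exists l, (l.+1 ^ 2 <= k)%N by exists L'.
  have hb l : (l.+1 ^ 2 <= k)%N -> (l <= k)%N.
    by move=> hl; apply: leq_trans hl; rewrite expnS expn1; nia.
  case: (ex_maxnP hex hb) => l lk lmax; exists l; rewrite lk ltnNge.
  by apply/negP => /lmax; rewrite ltnn.
have L'l : (L' <= l)%N.
  rewrite leqNgt; apply/negP => lL'.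
  have : (l.+2 ^ 2 <= L'.+1 ^ 2)%N by rewrite leq_exp2r.
  by move: hk kl; lia.
have := hL l; rewrite /= (leq_trans _ L'l) ?leq_maxl// => /(_ isT).
rewrite !sub0r !normrN !normrM !normfV !(ger0_norm (ler0n _ _)).
have k0' : 0 < k%:R :> R by rewrite ltr0n.
rewrite ler_pdivrMl ?ltr0n ?expn_gt0// => h1.
rewrite ler_pdivrMl//.
have -> : \sum_(j < k) a j = \sum_(j < l.+1 ^ 2) a j + \sum_(l.+1 ^ 2 <= j < k) a j.
  by rewrite -!(big_mkord xpredT a) (big_cat_nat _ lk).
rewrite (le_trans (ler_normD _ _))//.
have h2 : `|\sum_(l.+1 ^ 2 <= j < k) a j| <= B * (k - l.+1 ^ 2)%:R.
  rewrite (le_trans (ler_norm_sum _ _ _))// mulr_natr -sumr_const_nat.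
  exact: ler_sum.
have h3 : (k - l.+1 ^ 2 <= 2 * l.+1)%N.
  by move: kl; rewrite !expnS !expn0; nia.
have h4 : B * (k - l.+1 ^ 2)%:R <= B * (2 * l.+1)%:R.
  by rewrite ler_wpM2l// ler_nat.
have h5 : B * (2 * l.+1)%:R <= e / 2 * (l.+1 ^ 2)%:R.
  rewrite natrM natrX expr2 mulrA [leRHS]mulrA ler_wpM2r//.
  have : 4 * B / e <= l.+1%:R.
    rewrite (le_trans (ltW (truncnS_gt _)))// ler_nat ltnS.
    by apply: ltnW; apply: leq_trans L'l; rewrite leq_maxr.
  by rewrite ler_pdivrMr//; lra.
have h6 : e / 2 * (l.+1 ^ 2)%:R <= e / 2 * k%:R.
  by rewrite ler_wpM2l ?ler_nat//; lra.
lra.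
Qed.

Lemma summable_cvg0 (u : nat -> R) : (forall l, 0 <= u l) ->
  (\sum_(l <oo) (u l)%:E < +oo)%E -> u @ \oo --> (0 : R).
Proof.
move=> u0 hu; apply: cvg_series_cvg_0; apply: nondecreasing_is_cvgn.
  apply/nondecreasing_seqP => k; rewrite /series /= big_nat_recr//= lerDl; exact: u0.
have hf : (\sum_(l <oo) (u l)%:E)%E \is a fin_num.
  by rewrite ge0_fin_numE// nneseries_ge0// => l _ _; rewrite lee_fin.
exists (fine (\sum_(l <oo) (u l)%:E)%E) => _ [k _ <-].
rewrite -lee_fin fineK// /series /= -sumEFin.
by apply: nneseries_lim_ge => l _; rewrite lee_fin.
Qed.

Lemma sum_inv_squares (m : nat) : \sum_(l < m) (l.+1 ^ 2)%:R^-1 <= 2 :> R.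
Proof.
suff h k : \sum_(l < k.+1) (l.+1 ^ 2)%:R^-1 <= 2 - k.+1%:R^-1 :> R.
  case: m => [|m]; first by rewrite big_ord0.
  by rewrite (le_trans (h m))// lerBlDr lerDl.
elim: k => [|k ih]; first by rewrite big_ord_recr big_ord0 /= add0r invr1; lra.
rewrite big_ord_recr /=; apply: le_trans (lerD ih (lexx _)) _.
have m1 : 0 < k.+1%:R :> R by []. have m2 : 0 < k.+2%:R :> R by [].
have e : k.+1%:R^-1 - k.+2%:R^-1 = (k.+1%:R * k.+2%:R)^-1 :> R.
  by rewrite -[k.+2%:R]natr1 in m2 *; field; rewrite !gt_eqF.
have : (k.+2 ^ 2)%:R^-1 <= (k.+1%:R * k.+2%:R)^-1 :> R.
  by rewrite lef_pV2 ?posrE ?mulr_gt0// -natrM ler_nat expnS expn1; nia.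
by rewrite -e; move: _^-1 _^-1 _^-1 => *; lra.
Qed.

Context d (X : measurableType d) (P : probability X R).

Lemma bounded_integrable (g : X -> R) (B : R) : measurable_fun setT g ->
  (forall x, `|g x| <= B) -> P.-integrable setT (EFin \o g).
Proof.
move=> mg gB; apply: measurable_bounded_integrable => //.
  exact: le_lt_trans (probability_le1 P measurableT) (ltry 1).
exists B; split; first exact: num_real.
by move=> x Bx y _ /=; rewrite (le_trans (gB y))// ltW.
Qed.

(** Along the squares k = l^2 the second moments of the averages are at most C / l^2, hence
    summable; so the sum of the squared averages is integrable and almost everywhere finite.
    Boundedness then fills the gaps between squares. *)
Lemma ae_average (g : nat -> X -> R) (B C : R) :
  (forall j, measurable_fun setT (g j)) -> (forall j x, `|g j x| <= B) ->
  (forall k, Rintegral P setT (fun x => (\sum_(j < k) g j x) ^+ 2) <= C * k%:R) ->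
  \forall x \ae P, (fun k => k%:R^-1 * \sum_(j < k) g j x) @ \oo --> (0 : R).
Proof.
move=> mg gB hC.
pose s k x := \sum_(j < k) g j x.
have ms k : measurable_fun setT (s k) by apply: measurable_sum.
have sB k x : `|s k x| <= B * k%:R.
  rewrite (le_trans (ler_norm_sum _ _ _))// mulr_natr -[k in leRHS]card_ord -sumr_const.
  exact: ler_sum.
have B0 x : 0 <= B := le_trans (normr_ge0 _) (gB 0%N x).
pose h l x := ((l.+1 ^ 2)%:R^-1 * s (l.+1 ^ 2)%N x) ^+ 2.
have mh l : measurable_fun setT (h l).
  by apply: measurable_funX; apply: measurable_funM.
have h0 l x : 0 <= h l x by exact: sqr_ge0.
have C0 : 0 <= C by have := hC 1%N; rewrite mulr1; apply: le_trans; apply: Rintegral_ge0 => x _; exact: sqr_ge0.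
have ih l : (\int[P]_x (h l x)%:E <= (C * (l.+1 ^ 2)%:R^-1)%:E)%E.
  have is2 : P.-integrable setT (EFin \o (fun x => s (l.+1 ^ 2)%N x ^+ 2)).
    apply: (bounded_integrable (B := (B * (l.+1 ^ 2)%:R) ^+ 2)).
      exact: measurable_funX.
    move=> x; rewrite normrX lerXn2r ?nnegrE ?mulr_ge0//; exact: B0.
  have -> : (\int[P]_x (h l x)%:E)%E = (Rintegral P setT (h l))%:E.
    rewrite /Rintegral fineK//; apply: integrable_fin_num => //.
    have := integrableZl measurableT ((l.+1 ^ 2)%:R^-1 ^+ 2) is2.
    by apply: eq_integrable => // x _; rewrite /h exprMn.
  rewrite lee_fin /h; under eq_Rintegral do rewrite exprMn.
  rewrite RintegralZl//; apply: (le_trans (ler_wpM2l (sqr_ge0 _) (hC _))).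
  by rewrite expr2 mulrCA -[_ * _ * _%:R]mulrA mulVf ?mulr1// gt_eqF.
have sumfin : (\int[P]_x (\sum_(l <oo) (h l x)%:E) < +oo)%E.
  rewrite integral_nneseries//; last 2 first.
  - by move=> l; exact/measurable_EFinP.
  - by move=> l x _; rewrite lee_fin.
  apply: (@le_lt_trans _ _ (C * 2)%:E); last exact: ltry.
  apply: lime_le.
    by apply: is_cvg_nneseries => l _ _; apply: integral_ge0 => x _; rewrite lee_fin.
  apply: nearW => m; rewrite big_mkord.
  apply: (@le_trans _ _ (\sum_(l < m) (C * (l.+1 ^ 2)%:R^-1)%:E)%E).
    by apply: lee_sum => l _.
  by rewrite sumEFin lee_fin -mulr_sumr ler_wpM2l// sum_inv_squares.
have isum : P.-integrable setT (fun x => (\sum_(l <oo) (h l x)%:E)%E).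
  apply/integrableP; split.
    by apply: ge0_emeasurable_sum => // [l x _ _|l _]; [rewrite lee_fin|exact/measurable_EFinP].
  under eq_integral => x _.
    rewrite gee0_abs; last by apply: nneseries_ge0 => l _ _; rewrite lee_fin.
    over.
  exact: sumfin.
apply: filterS (integrable_ae measurableT isum) => x /(_ I) hx.
apply: (average_from_squares (a := g ^~ x) (B := B)) => //.
have /(summable_cvg0 (h0 ^~ x)) : (\sum_(l <oo) (h l x)%:E < +oo)%E.
  by rewrite -ge0_fin_numE// nneseries_ge0// => l _ _; rewrite lee_fin.
move=> /cvgrPdist_lt hc; apply/cvgrPdist_lt => e e0.
have := hc (e ^+ 2); rewrite exprn_gt0// => /(_ isT); apply: filterS => l.
rewrite !sub0r !normrN /h normrX ltr_pXn2r// ?nnegrE//; exact: ltW.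
Qed.

End averages.

Section statistics.
Context {R : realType} {n : nat}.
Local Notation T := (torus R n).
Local Notation V := 'rV[R]_n.
Local Notation vol := (@volume R n).
Local Notation mean := (Rintegral vol setT).
Implicit Types (phi psi : T -> R) (nu mu : (T -> R) -> R) (F : nat -> T -> T).

Let smean : state mean := state_Rintegral _.

(** In terms of densities: the logarithm of an L-Lipschitz function bounded below by 1 is
    L-Lipschitz, so multiplying by it adds L to the constant of the cone. This turns a correlation
    into a difference of two functionals of one cone. *)
Lemma cone_weight (K L M : R) nu phi : 0 <= L -> cone K nu ->
  (forall x, 1 <= phi x <= M) -> (forall p q, `|phi p - phi q| <= L * tnorm (p - q)) ->
  cone (K + L) (fun psi => nu (fun x => phi x * psi x) / nu phi).
Proof.
move=> L0 cnu phiM phiL; have snu := cnu.1.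
have uphi : ucont phi by apply: tlip_ucont; exists L.
have phi0 x : 0 <= phi x by have /andP[] := phiM x; lra.
have nphi : 0 < nu phi.
  apply: (@lt_le_trans _ _ 1) => //; rewrite -[leLHS](state_cst snu).
  by apply: state_le => // [|x]; [exact: ucont_cst|have /andP[] := phiM x].
split.
  split=> [a psi chi h k|psi h h0|].
  - rewrite [a * _]mulrA -mulrDl -(state_lin snu) //; [|exact: ucontM|exact: ucontM].
    by congr (nu _ / _); apply/funext => x; ring.
  - rewrite divr_ge0//; last exact: ltW.
    by apply: (state_ge0 snu) => [|x]; [exact: ucontM|rewrite mulr_ge0].
  - under eq_fun do rewrite mulr1.
    by rewrite divff// gt_eqF.
move=> v psi h h0; rewrite mulrA ler_pM2r ?invr_gt0//.
rewrite mulrDl expRD [expR (K * _) * _]mulrC -mulrA.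
apply: (@le_trans _ _ (nu (fun x => expR (L * `|v|) *
    (phi (x + tproj v) * psi (x + tproj v))))).
  apply: state_le => //.
  - by apply: ucontM => //; exact: ucont_translate.
  - by apply: ucontZ; apply: ucontM; exact: ucont_translate.
  move=> x; rewrite mulrA ler_wpM2r//.
  have := phiL x (x + tproj v); rewrite opprD addNKr tnormN => h1.
  have h2 : L * tnorm (tproj v : T) <= L * `|v| by rewrite ler_wpM2l// tnorm_le.
  have h3 := expR_ge1Dx (L * `|v|).
  have /andP[h4 _] := phiM (x + tproj v).
  have h5 : 0 <= L * `|v| by rewrite mulr_ge0.
  move: h1; rewrite ler_norml => /andP[_ h1].
  have : (1 + L * `|v|) * phi (x + tproj v) <= expR (L * `|v|) * phi (x + tproj v).
    by rewrite ler_wpM2r.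
  have : L * `|v| * 1 <= L * `|v| * phi (x + tproj v) by rewrite ler_wpM2l.
  by rewrite mulrDl; lra.
rewrite stateZ//; last by apply: ucontM; exact: ucont_translate.
rewrite ler_pM2l ?expR_gt0//.
by apply: (cnu.2 v (fun x => phi x * psi x)) => [|x]; [exact: ucontM|rewrite mulr_ge0].
Qed.

Section variance.
Variables (C : R) (C0 : 0 <= C).
Let K := 6 * n%:R * C.

Let K0 : 0 <= K. Proof. by rewrite !mulr_ge0. Qed.

Let ucont_orbit F k phi : (forall i, good C (F i)) -> ucont phi ->
  ucont (fun x => phi (fcomp F k x)).
Proof. by move=> gF h; apply: ucont_comp => //; apply: fcomp_tuc => i; exact: good_tuc (gF i). Qed.

(** Let [nu] be the image of m under the first i maps. Up to the factor nu phi, the correlation is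
    the difference between [nu] weighted by [phi] and [nu], both tested on [phi] after k further
    maps, and [cone_contraction] applies in the cone of K + L. *)
Lemma correlation F phi (L M : R) i k : (forall j, good C (F j)) -> 0 <= L ->
  (forall x, 1 <= phi x <= M) -> (forall p q, `|phi p - phi q| <= L * tnorm (p - q)) ->
  `|mean (fun x => phi (fcomp F i x) * phi (fcomp F (i + k) x)) -
    mean (fun x => phi (fcomp F i x)) * mean (fun x => phi (fcomp F (i + k) x))|
  <= 2 * M ^+ 2 * (1 - crate (K + L)) ^+ k.
Proof.
move=> gF L0 phiM phiL.
have uphi : ucont phi by apply: tlip_ucont; exists L.
have KL : 6 * n%:R * C <= K + L by rewrite lerDl.
have phiM' x : `|phi x| <= M by have /andP[h1 h2] := phiM x; rewrite ger0_norm//; lra.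
pose nu psi := mean (fun x => psi (fcomp F i x)).
have cnu : cone K nu := cone_fcomp i C0 (lexx _) gF (cone_mean K0).
have snu := cnu.1.
have nphi : 1 <= nu phi.
  rewrite -[leLHS](state_cst snu).
  by apply: state_le => // [|x]; [exact: ucont_cst|have /andP[] := phiM x].
have nphiM : nu phi <= M.
  by have := state_bound snu uphi phiM'; rewrite ler_norml => /andP[].
pose psi := fun x => phi (fcomp (fshift i F) k x).
have := cone_contraction (F := fshift i F) k C0 KL (fun j => gF _)
  (cone_weight L0 cnu phiM phiL) (cone_weaken (K' := K + L) _ cnu) uphi phiM'.
rewrite lerDl => /(_ L0) h.
have -> : mean (fun x => phi (fcomp F i x) * phi (fcomp F (i + k) x)) =
    nu (fun x => phi x * psi x).
  by congr Rintegral; apply/funext => x; rewrite /psi fcompD.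
have -> : mean (fun x => phi (fcomp F (i + k) x)) = nu psi.
  by congr Rintegral; apply/funext => x; rewrite /psi fcompD.
rewrite -/(nu phi).
have -> : nu (fun x => phi x * psi x) - nu phi * nu psi =
    nu phi * (nu (fun x => phi x * psi x) / nu phi - nu psi).
  by field; rewrite gt_eqF//; lra.
rewrite normrM gtr0_norm; last lra.
have -> : 2 * M ^+ 2 * (1 - crate (K + L)) ^+ k = M * ((1 - crate (K + L)) ^+ k * (2 * M)).
  by ring.
by apply: ler_pM => //; lra.
Qed.

Lemma geometric_sum_le (r : R) k : 0 <= r < 1 ->
  \sum_(i < k.+1) r ^+ (k - i) <= (1 - r)^-1.
Proof.
move=> /andP[r0 r1]; elim: k => [|k ih].
  by rewrite big_ord_recr big_ord0 /= add0r expr0 invf_ge1 ?subr_gt0//; lra.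
rewrite big_ord_recr /= subnn expr0.
have -> : \sum_(i < k.+1) r ^+ (k.+1 - i) = r * \sum_(i < k.+1) r ^+ (k - i).
  by rewrite mulr_sumr; apply: eq_bigr => i _; rewrite subSn ?exprS// -ltnS.
have : r * \sum_(i < k.+1) r ^+ (k - i) <= r * (1 - r)^-1 by rewrite ler_wpM2l.
have -> : r * (1 - r)^-1 = (1 - r)^-1 - 1 by field; rewrite subr_eq0 gt_eqF.
lra.
Qed.

(** Adding the k-th term to the Birkhoff sum raises the second moment by one diagonal term and twice
    the correlations with all earlier terms; these form a geometric series. The constant involves
    [C] and [phi] but not the sequence F, which is what random orbits require. *)
Lemma variance_bound_pos phi (L M : R) : 0 <= L ->
  (forall x, 1 <= phi x <= M) -> (forall p q, `|phi p - phi q| <= L * tnorm (p - q)) ->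
  exists2 D : R, 0 <= D & forall F, (forall i, good C (F i)) -> forall k,
    mean (fun x => (\sum_(j < k) (phi (fcomp F j x) - mean (fun y => phi (fcomp F j y)))) ^+ 2)
    <= D * k%:R.
Proof.
move=> L0 phiM phiL.
have uphi : ucont phi by apply: tlip_ucont; exists L.
have KL0 : 0 <= K + L by rewrite addr_ge0.
have /andP[c0 c1] := crate_bounds KL0.
exists (4 * M ^+ 2 * (crate (K + L))^-1).
  by apply: divr_ge0; [apply: mulr_ge0 => //; exact: sqr_ge0|exact: ltW].
move=> F gF.
pose g j x := phi (fcomp F j x) - mean (fun y => phi (fcomp F j y)).
pose X j := fun x => phi (fcomp F j x).
have uX j : ucont (X j) by exact: ucont_orbit.
have ug j : ucont (g j).
  by have := ucontD (uX j) (ucont_cst (- mean (X j))).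
have us k : ucont (fun x => \sum_(j < k) g j x) by apply: ucont_sum.
have gg i j : mean (fun x => g i x * g j x) = mean (fun x => X i x * X j x) - mean (X i) * mean (X j).
  have -> : (fun x => g i x * g j x) = (fun x => (X i x * X j x + (- mean (X i)) * X j x)
     + ((- mean (X j)) * X i x + mean (X i) * mean (X j))).
    by apply/funext => x; rewrite /g /X; ring.
  have u1 := ucontM (uX i) (uX j).
  have u2 := ucontZ (- mean (X i)) (uX j).
  have u3 := ucontZ (- mean (X j)) (uX i).
  have u4 : ucont (fun _ : T => mean (X i) * mean (X j)) := ucont_cst _.
  rewrite (stateD smean (ucontD u1 u2) (ucontD u3 u4)) (stateD smean u1 u2) (stateD smean u3 u4).
  rewrite (stateZ smean _ (uX i)) (stateZ smean _ (uX j)) (state_cst smean).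
  by ring.
pose rho := 1 - crate (K + L).
have corr i j : (i <= j)%N -> mean (fun x => g i x * g j x) <= 2 * M ^+ 2 * rho ^+ (j - i).
  move=> ij; have := correlation i (j - i) gF L0 phiM phiL.
  rewrite subnKC// gg; exact/le_trans/ler_norm.
elim=> [|k ih].
  rewrite mulr0; under [X in mean X]eq_fun do rewrite big_ord0 expr0n /=.
  by rewrite (state_cst smean).
have e : (fun x => (\sum_(j < k.+1) g j x) ^+ 2) = (fun x =>
   ((\sum_(j < k) g j x) ^+ 2 + 2 * \sum_(j < k) g j x * g k x) + g k x * g k x).
  by apply/funext => x; rewrite big_ord_recr /= -mulr_suml; ring.
rewrite -/(g) e.
have u1 : ucont (fun x => (\sum_(j < k) g j x) ^+ 2).
  by have := ucontM (us k) (us k).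
have ugg i j : ucont (fun x => g i x * g j x) by exact: ucontM.
have u2 : ucont (fun x => \sum_(j < k) g j x * g k x) by apply: ucont_sum.
rewrite (stateD smean (ucontD u1 (ucontZ 2 u2)) (ugg k k)) (stateD smean u1 (ucontZ 2 u2)).
rewrite (stateZ smean _ u2) (state_sum smean)//.
have h1 : \sum_(j < k) mean (fun x => g j x * g k x) <= \sum_(j < k) 2 * M ^+ 2 * rho ^+ (k - j).
  by apply: ler_sum => j _; apply: corr; exact: ltnW.
have h2 := corr k k (leqnn k); rewrite subnn expr0 mulr1 in h2.
have h3 : \sum_(j < k.+1) rho ^+ (k - j) <= (1 - rho)^-1.
  by apply: geometric_sum_le; rewrite /rho; lra.
rewrite big_ord_recr /= subnn expr0 in h3.
rewrite -mulr_sumr in h1.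
have M20 : 0 <= 2 * M ^+ 2 by rewrite mulr_ge0 ?sqr_ge0.
have := ler_wpM2l M20 h3.
rewrite /rho subKr -[k.+1%:R]natr1 mulrDr mulr1 mulrDr mulr1.
have -> : 4 * M ^+ 2 / crate (K + L) = 2 * (2 * M ^+ 2 / crate (K + L)) by ring.
move: h1 h2 ih; rewrite -/g -/rho.
have -> : 4 * M ^+ 2 / crate (K + L) = 2 * (2 * M ^+ 2 / crate (K + L)) by ring.
lra.
Qed.

(** Adding 1 + M makes the observable at least 1, as weights must be, and leaves the centred sums
    unchanged. *)
Lemma variance_bound phi : tlip phi ->
  exists2 D : R, 0 <= D & forall F, (forall i, good C (F i)) -> forall k,
    mean (fun x => (\sum_(j < k) (phi (fcomp F j x) - mean (fun y => phi (fcomp F j y)))) ^+ 2)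
    <= D * k%:R.
Proof.
move=> [L L0 phiL].
have uphi : ucont phi by apply: tlip_ucont; exists L.
have [M M0 hM] := ucont_bounded uphi.
have [|p q|D D0 hD] := @variance_bound_pos (fun x => phi x + (1 + M)) L (1 + M + M) L0.
- by move=> x; have := hM x; rewrite ler_norml; lra.
- by rewrite opprD addrACA subrr addr0.
exists D; first exact: D0.
move=> F gF k.
suff -> : (fun x => (\sum_(j < k) (phi (fcomp F j x) - mean (fun y => phi (fcomp F j y)))) ^+ 2) =
    (fun x => (\sum_(j < k) (phi (fcomp F j x) + (1 + M) -
      mean (fun y => phi (fcomp F j y) + (1 + M)))) ^+ 2) by exact: hD F gF k.
apply/funext => x; congr (_ ^+ 2); apply: eq_bigr => j _.
rewrite (stateD smean); [|exact: ucont_orbit|exact: ucont_cst].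
by rewrite (state_cst smean) opprD addrACA subrr addr0.
Qed.

End variance.
End statistics.

(** * SRB measures *)

Section srb.
Context {R : realType} {n : nat}.
Local Notation T := (torus R n).
Local Notation vol := (@volume R n).
Local Notation mean := (Rintegral vol setT).
Implicit Types (phi psi : T -> R) (mu : probability (borel T) R).

Lemma cvg_approx (a : nat -> R) (l : R) :
  (forall e : R, 0 < e -> exists b l', [/\ b @ \oo --> (l' : R),
     forall k, (0 < k)%N -> `|a k - b k| <= e & `|l - l'| <= e]) -> a @ \oo --> l.
Proof.
move=> h; apply/cvgrPdist_le => e e0.
have [b [l' [hb ab ll']]] := h (e / 3) ltac:(lra).
have /cvgrPdist_le/(_ (e / 3)) := hb; rewrite divr_gt0// => /(_ isT).
apply: filterS2 (nbhs_infty_gt 0) => k k0 h1.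
have := ab k k0; have := ler_distD l' l (a k); have := ler_distD (b k) l' (a k).
rewrite (distrC (b k)); lra.
Qed.

(* A continuous function is uniformly approximated by combinations of the
   functions of a partition of unity subordinate to small balls. *)
Lemma unity_approx phi (e d : R) (I : finType) (g : I -> T) (chi : I -> T -> R) :
  (forall p q, tnorm (p - q) < d -> `|phi p - phi q| < e) ->
  (forall i x, 0 <= chi i x) -> (forall x, \sum_i chi i x = 1) ->
  (forall i x, chi i x != 0 -> tnorm (x - g i) < d) ->
  forall x, `|phi x - \sum_i phi (g i) * chi i x| <= e.
Proof.
move=> hd chi0 chi1 chid x.
rewrite -[phi x]mulr1 -(chi1 x) mulr_sumr -sumrB.
rewrite (le_trans (ler_norm_sum _ _ _))//.
apply: (@le_trans _ _ (\sum_i e * chi i x)); last by rewrite -mulr_sumr chi1 mulr1.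
apply: ler_sum => i _; rewrite -mulrBl normrM (ger0_norm (chi0 _ _)).
have [->|/chid h1] := eqVneq (chi i x) 0; first by rewrite !mulr0.
by rewrite ler_wpM2r// ltW// hd.
Qed.

Lemma average_dist (a b : nat -> R) (e : R) k : (0 < k)%N ->
  (forall j, `|a j - b j| <= e) ->
  `|k%:R^-1 * \sum_(j < k) a j - k%:R^-1 * \sum_(j < k) b j| <= e.
Proof.
move=> k0 h; rewrite -mulrBr -sumrB normrM normfV (ger0_norm (ler0n _ _)).
rewrite ler_pdivrMl ?ltr0n// mulr_natl -[k in leRHS]card_ord -sumr_const.
by rewrite (le_trans (ler_norm_sum _ _ _))// ler_sum.
Qed.

(** The exceptional null set must not depend on [phi]. Partitions of unity of mesh 1/(N + 1) provide
    countably many Lipschitz functions whose combinations approximate every continuous one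
    uniformly. *)
Lemma ae_distributed mu (orbit : T -> nat -> T) :
  (forall phi, tlip phi -> \forall x \ae vol,
     (fun k => k%:R^-1 * \sum_(j < k) phi (orbit x j)) @ \oo --> Rintegral mu setT phi) ->
  \forall x \ae vol, distributed_as (orbit x) mu.
Proof.
move=> h; have smu := state_Rintegral mu.
have dN (N : nat) : 0 < N.+1%:R^-1 :> R by rewrite invr_gt0.
pose good_at (N : nat) x := exists (I : finType) (g : I -> T) (chi : I -> T -> R),
  [/\ forall i, tlip (chi i), forall i x, 0 <= chi i x, forall x, \sum_i chi i x = 1,
      forall i x, chi i x != 0 -> tnorm (x - g i) < N.+1%:R^-1 &
      forall i, (fun k => k%:R^-1 * \sum_(j < k) chi i (orbit x j)) @ \oo -->
        Rintegral mu setT (chi i)].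
have : \forall x \ae vol, forall N, good_at N x.
  apply: ae_foralln => N.
  have [I [g [chi [chil chi0 chi1 chid]]]] := partition_of_unity (n := n) (dN N).
  have := @filter_forall _ _ (fun i x => (fun k => k%:R^-1 * \sum_(j < k) chi i (orbit x j)) @ \oo -->
        Rintegral mu setT (chi i)) (almost_everywhere vol)
        (ae_filter_ringOfSetsType vol) (fun i => h _ (chil i)).
  by apply: (@filterS _ _ (ae_filter_ringOfSetsType vol)) => x hx; exists I, g, chi.
apply: (@filterS _ _ (ae_filter_ringOfSetsType vol)) => x hx phi /continuous_ucont uphi.
apply: cvg_approx => e e0; have [d d0 hd] := uphi e e0.
have [N _ hN] := near_infty_natSinv_lt (PosNum d0).
have [I [g [chi [chil chi0 chi1 chid chic]]]] := hx N.
have app := unity_approx hd chi0 chi1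
  (fun i x h => lt_trans (chid i x h) (hN N (leqnn N))).
have uchi i : ucont (chi i) by exact: tlip_ucont.
exists (fun k => k%:R^-1 * \sum_(j < k) \sum_i phi (g i) * chi i (orbit x j)).
exists (\sum_i phi (g i) * Rintegral mu setT (chi i)); split.
- have -> : (fun k => k%:R^-1 * \sum_(j < k) \sum_i phi (g i) * chi i (orbit x j)) =
      (fun k => \sum_i phi (g i) * (k%:R^-1 * \sum_(j < k) chi i (orbit x j))).
    apply/funext => k; rewrite exchange_big mulr_sumr; apply: eq_bigr => i _.
    by rewrite -mulr_sumr mulrCA.
  apply: cvg_big => [|i _]; [exact: add_continuous|]; apply: cvgM; [exact: cvg_cst|exact: chic].
- move=> k k0; apply: (@average_dist (fun j => phi (orbit x j))
    (fun j => \sum_i phi (g i) * chi i (orbit x j))) => // j; exact: app.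
- have -> : \sum_i phi (g i) * Rintegral mu setT (chi i) =
      Rintegral mu setT (fun x => \sum_i phi (g i) * chi i x).
    rewrite (state_sum smu); last by move=> i; exact: ucontZ.
    by apply: eq_bigr => i _; rewrite (stateZ smu).
  by apply: (state_dist smu) => //; apply: ucont_sum => i; exact: ucontZ.
Qed.

(** The indicator of an open set is a pointwise limit of uniformly continuous functions with values
    in [0, 1], so dominated convergence gives equality on open sets; these are stable under
    intersection and generate the Borel sets. *)
Lemma mean_eq_measure_eq (P Q : probability (borel T) R) :
  (forall phi, ucont phi -> Rintegral P setT phi = Rintegral Q setT phi) ->
  forall A : set (borel T), measurable A -> P A = Q A.
Proof.
move=> PQ A mA.
have key (O : set T) : open O -> P (O : set (borel T)) = Q (O : set (borel T)).
  move=> oO; have dN (N : nat) : 0 < N.+1%:R^-1 :> R by rewrite invr_gt0.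
  have /choice[f hf] : forall N : nat, exists f : T -> R,
    [/\ ucont f, forall x, 0 <= f x <= 1, forall x, f x != 0 -> O x &
      forall x, (forall y, tnorm (y - x) < 3 * N.+1%:R^-1 -> O y) -> f x = 1].
    move=> N; have [I [g [chi [chil chi0 chi1 chid]]]] := partition_of_unity (n := n) (dN N).
    (* Only bumps centred well inside O are kept. As their supports have radius 1/(N + 1), their sum
       vanishes off O, and it is 1 at points whose ball of radius 3/(N + 1) lies in O. *)
    pose S := [pred i : I | `[< forall y, tnorm (y - g i) < 2 * N.+1%:R^-1 -> O y >]].
    have fle x : \sum_(i | S i) chi i x <= 1.
      rewrite -(chi1 x) [leRHS](bigID S)/= lerDl; exact: sumr_ge0.
    exists (fun x => \sum_(i | S i) chi i x); split=> [|x|x|x hx].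
    - under eq_fun do rewrite -big_filter.
      by apply: ucont_sum => i; exact: tlip_ucont.
    - by rewrite fle sumr_ge0.
    - move=> h; have [i /andP[/asboolP Si hi]] : exists i, S i && (chi i x != 0).
        apply/existsP; apply: contraNT h; rewrite negb_exists => /forallP h.
        by rewrite big1// => i Si; have := h i; rewrite Si /= negbK => /eqP.
      by apply: Si; apply: (lt_trans (chid _ _ hi)); have := dN N; move: (N.+1%:R^-1) => z; lra.
    - rewrite -(chi1 x) [RHS](bigID S)/= [X in _ + X]big1 ?addr0// => i Si.
      apply/eqP/negPn/negP => /chid h; move/negP: Si; apply; apply/asboolP => y yg.
      apply: hx; have := tnorm_tri (g i) y x; rewrite (tnormB (g i)).
      by move: h yg; move: (N.+1%:R^-1) => z; lra.
  have fO x : (fun N => (f N x)%:E) @ \oo --> (\1_O x)%:E.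
    rewrite indicE; have [|] := boolP (x \in O).
      rewrite inE => Ox.
      have [d d0 hd] := (nbhs_tnormP _ _).1 (open_nbhs_nbhs (conj oO Ox)).
      apply: cvg_near_cst.
      have [k _ hk] := near_infty_natSinv_lt (PosNum (divr_gt0 d0 (ltr0Sn R 2))).
      exists k => // N /= kN; have [_ _ _ h] := hf N; congr EFin; rewrite h// => y hy.
      by apply: hd; have := hk N kN; rewrite /=; move: hy; move: (N.+1%:R^-1) => z; lra.
    rewrite notin_setE => nO; apply: cvg_near_cst; apply: nearW => N; congr EFin.
    by apply/eqP/negPn/negP => h; have [_ _ /(_ _ h)] := hf N.
  have lim (mu : probability (borel T) R) :
      (Rintegral mu setT (f N))%:E @[N --> \oo] --> mu (O : set (borel T)).
    have mO : measurable (O : set (borel T)) by exact: sub_sigma_algebra.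
    have [|||||_ _] := @dominated_convergence _ (borel T) R mu setT measurableT
      (fun N x => (f N x)%:E) (fun x => (\1_O x)%:E) (fun=> 1%E).
    - move=> N; apply/measurable_EFinP; apply: continuous_borel_measurable.
      by apply: ucont_continuous; have [] := hf N.
    - by apply/measurable_EFinP; exact: measurable_indic.
    - exact: aeW.
    - exact: ucont_integrable (ucont_cst 1).
    - apply: aeW => x N _; have [_ /(_ x)/andP[f0 f1] _ _] := hf N.
      by rewrite abse_EFin lee_fin ger0_norm.
    rewrite integral_indic// setIT => h.
    rewrite (_ : (fun N => _) = (fun N => \int[mu]_x (f N x)%:E)%E)//.
    apply/funext => N; rewrite /Rintegral fineK//.
    by apply: integrable_fin_num => //; apply: ucont_integrable; have [] := hf N.
  have := lim P; have -> : (fun N => (Rintegral P setT (f N))%:E) =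
      (fun N => (Rintegral Q setT (f N))%:E).
    by apply/funext => N; rewrite PQ//; have [] := hf N.
  by move=> /cvg_unique; apply => //; exact: lim.
apply: (@measure_unique _ R (borel T) (@open T) (fun=> setT)) => //.
- exact: openI.
- by move=> _; exact: openT.
- by apply/seteqP; split => // x _; exists 0%N.
- move=> _; exact: le_lt_trans (probability_le1 P measurableT) (ltry 1).
Qed.

Section acim.
Variables (C : R) (C0 : 0 <= C) (f : T -> T) (gf : good C f).
Variable mu : probability (borel T) R.
Hypothesis mu_lim : forall phi, tlip phi ->
  (fun N => mean (fun x => phi (iter N f x))) @ \oo --> Rintegral mu setT phi.

Let smu : state (Rintegral mu setT) := state_Rintegral _.
Let smean : state mean := state_Rintegral _.

Lemma iter_tuc N : tuc (iter N f).
Proof. by elim: N => [|N ih]; [exact: tuc_id|exact: (tuc_comp (good_tuc gf) ih)]. Qed.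

Lemma fcomp_iter k x : fcomp (fun=> f) k x = iter k f x.
Proof. by elim: k => //= k ->. Qed.

Lemma mu_lim_ucont phi : ucont phi ->
  (fun N => mean (fun x => phi (iter N f x))) @ \oo --> Rintegral mu setT phi.
Proof.
move=> uphi; apply: cvg_approx => e e0; have [d d0 hd] := uphi e e0.
have [I [g [chi [chil chi0 chi1 chid]]]] := partition_of_unity (n := n) d0.
have app := unity_approx hd chi0 chi1 chid.
have uchi i : ucont (chi i) by exact: tlip_ucont.
pose psi x := \sum_i phi (g i) * chi i x.
have upsi : ucont psi by apply: ucont_sum => i; exact: ucontZ.
exists (fun N => mean (fun x => psi (iter N f x))), (Rintegral mu setT psi); split.
- have -> : (fun N => mean (fun x => psi (iter N f x))) =
      (fun N => \sum_i phi (g i) * mean (fun x => chi i (iter N f x))).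
    apply/funext => N; rewrite (state_sum smean); last first.
      by move=> i; apply: ucontZ; exact: ucont_comp (uchi i) (iter_tuc N).
    by apply: eq_bigr => i _; rewrite (stateZ smean)//; exact: ucont_comp (uchi i) (iter_tuc N).
  rewrite (state_sum smu); last by move=> i; exact: ucontZ.
  apply: cvg_big => [|i _]; [exact: add_continuous|]; rewrite (stateZ smu)//.
  by apply: cvgM; [exact: cvg_cst|exact: mu_lim].
- move=> N _; apply: (state_dist smean) => //; exact: ucont_comp (iter_tuc N).
- exact: (state_dist smu).
Qed.

(** The means of phi o f along f^N are those of phi along f^(N+1), a shift of the same convergent
    sequence. *)
Lemma mu_invariant : Defs.invariant f mu.
Proof.
have mf : measurable_fun setT (f : borel T -> borel T).
  apply: continuous_borel_map => p A /nbhs_tnormP[d d0 dA].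
  have [d' d'0 hd'] := good_tuc gf d0; apply/nbhs_tnormP; exists d' => // q /hd'.
  exact: dA.
pose X : {RV mu >-> borel T} :=
  HB.pack_for {RV mu >-> borel T} (f : borel T -> borel T) (isMeasurableFun.Build _ _ _ _ _ mf).
move=> A mA; apply: (@mean_eq_measure_eq (distribution mu X) mu) mA => phi uphi.
have upf : ucont (fun x => phi (f x)) := ucont_comp uphi (good_tuc gf).
have -> : Rintegral (distribution mu X) setT phi = Rintegral mu setT (fun x => phi (f x)).
  rewrite /Rintegral integral_distribution//.
    by apply/measurable_EFinP; apply: continuous_borel_measurable; exact: ucont_continuous.
  exact: (ucont_integrable _ upf).
have h1 := mu_lim_ucont upf; have h2 := mu_lim_ucont uphi.
have h3 := h2; rewrite -cvg_shiftS in h3.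
exact: (cvg_unique (@norm_hausdorff R R^o) h1 h3).
Qed.

(** Write the Birkhoff average as a centred part, which tends to 0 almost everywhere by the variance
    bound, plus the average of the means of phi o f^j, which converges by Cesaro. The basin so
    obtained has full measure. *)
Lemma mu_SRB : SRB f mu.
Proof.
split; first exact: mu_invariant.
have : \forall x \ae vol, distributed_as (fun j => iter j f x) mu.
  apply: ae_distributed => phi lphi.
  have uphi := tlip_ucont lphi; have [M M0 hM] := ucont_bounded uphi.
  have [D D0 hD] := variance_bound C0 lphi.
  have uj j : ucont (fun x => phi (iter j f x)) := ucont_comp uphi (iter_tuc j).
  pose a j := mean (fun x => phi (iter j f x)).
  have ca : (fun k => k%:R^-1 * \sum_(j < k) a j) @ \oo --> Rintegral mu setT phi.
    rewrite -cvg_shiftS; apply: cvg_trans (cesaro (mu_lim lphi)).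
    by apply: near_eq_cvg; apply: nearW => k; rewrite /arithmetic_mean /series /= big_mkord.
  have := @ae_average R _ (borel T) vol (fun j x => phi (iter j f x) - a j) (M + M) D.
  have h1 j : measurable_fun setT ((fun x => phi (iter j f x) - a j) : borel T -> R).
    apply: continuous_borel_measurable; apply: ucont_continuous.
    by have := ucontD (uj j) (ucont_cst (- a j)).
  have h2 j x : `|phi (iter j f x) - a j| <= M + M.
    rewrite (le_trans (ler_normB _ _))// lerD//.
    exact: (state_bound smean (uj j)).
  have h3 k : Rintegral vol setT (fun x => (\sum_(j < k) (phi (iter j f x) - a j)) ^+ 2) <= D * k%:R.
    have := hD (fun=> f) (fun=> gf) k.
    have -> : (fun x => (\sum_(j < k) (phi (fcomp (fun=> f) j x) -
        mean (fun y => phi (fcomp (fun=> f) j y)))) ^+ 2) =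
        (fun x => (\sum_(j < k) (phi (iter j f x) - a j)) ^+ 2).
      apply/funext => x; congr (_ ^+ 2); apply: eq_bigr => j _; rewrite fcomp_iter.
      by congr (_ - mean _); apply/funext => y; rewrite fcomp_iter.
    exact.
  move=> /(_ h1 h2 h3); apply: filterS => x hx.
  rewrite -[Rintegral mu setT phi]add0r.
  have -> : (fun k => k%:R^-1 * \sum_(j < k) phi (iter j f x)) =
     (fun k => k%:R^-1 * \sum_(j < k) (phi (iter j f x) - a j) + k%:R^-1 * \sum_(j < k) a j).
    apply/funext => k; rewrite -mulrDr -big_split; congr (_ * _).
    by apply: eq_bigr => j _; rewrite /= subrK.
  exact: (cvgD hx ca).
move=> [B [mB B0 hB]]; exists (~` B); split.
- exact: measurableC.
- rewrite probability_setC// B0 sube0; exact: lte01.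
- by move=> x Bx; apply: contrapT => h; apply: Bx; exact: hB.
Qed.

End acim.
End srb.

(** * Random orbits *)

Section nonautonomous.
Context {R : realType} {n : nat}.
Local Notation T := (torus R n).
Local Notation vol := (@volume R n).
Local Notation mean := (Rintegral vol setT).
Implicit Types (phi psi : T -> R) (F : nat -> T -> T).

Let smean : state mean := state_Rintegral _.

Lemma fcomp_close (f : T -> T) N (e : R) : tuc f -> 0 < e ->
  exists2 d : R, 0 < d & forall F, (forall j x, tnorm (F j x - f x) < d) ->
    forall x, tnorm (fcomp F N x - iter N f x) < e.
Proof.
move=> hf; elim: N e => [|N ih] e e0.
  by exists 1 => // F _ x /=; rewrite subrr tnorm0.
have [d d0 hd] := hf (e / 2) ltac:(lra); have [d' d'0 hd'] := ih d d0.
exists (Num.min d' (e / 2)); first by rewrite lt_min d'0; lra.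
move=> F hF x /=; have h1 : tnorm (fcomp F N x - iter N f x) < d.
  by apply: hd' => j y; apply: (lt_le_trans (hF j y)); rewrite ge_min lexx.
have h2 := hd _ _ h1; have := hF N (fcomp F N x); rewrite lt_min => /andP[_ h3].
have := tnorm_tri (f (fcomp F N x)) (F N (fcomp F N x)) (f (iter N f x)); lra.
Qed.

Section fixed_observable.
Variables (C : R) (C0 : 0 <= C) (f : T -> T) (gf : good C f).
Variables (phi : T -> R) (M : R).
Hypotheses (lphi : tlip phi) (M0 : 0 < M) (hM : forall x, `|phi x| <= M).
Let uphi : ucont phi := tlip_ucont lphi.
Let rho := 1 - crate (6 * n%:R * C).

(** The first i maps only move m within the cone, which the last N maps forget up to rho^N, and
    these last maps stay close to f^N. The threshold depends on N but neither on i nor on F. *)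
Lemma mean_fcomp_close N (e : R) : 0 < e ->
  exists2 d : R, 0 < d & forall F, (forall j, good C (F j)) ->
    (forall j x, tnorm (F j x - f x) < d) -> forall i,
    `|mean (fun x => phi (fcomp F (i + N) x)) - mean (fun x => phi (iter N f x))|
      <= rho ^+ N * (2 * M) + e.
Proof.
move=> e0; have [d d0 hd] := uphi e0.
have [d' d'0 hd'] := fcomp_close N (good_tuc gf) d0.
exists d' => // F gF hF i.
have K0 : 0 <= 6 * n%:R * C by rewrite !mulr_ge0.
have gF' j : good C (fshift i F j) by exact: gF.
have h1 := cone_contraction N C0 (lexx _) gF' (cone_fcomp i C0 (lexx _) gF (cone_mean K0))
  (cone_mean K0) uphi hM.
have h2 : `|mean (fun x => phi (fcomp (fshift i F) N x)) - mean (fun x => phi (iter N f x))| <= e.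
  apply: (state_dist smean).
  - by apply: ucont_comp => //; apply: fcomp_tuc => j; exact: good_tuc (gF' j).
  - by apply: ucont_comp => //; exact: iter_tuc gf N.
  - by move=> x; apply/ltW/hd/hd' => j y; exact: hF.
have e1 : (fun x => phi (fcomp F (i + N) x)) =
    (fun x => phi (fcomp (fshift i F) N (fcomp F i x))).
  by apply/funext => x; rewrite fcompD.
rewrite e1; apply: (le_trans (ler_distD (mean (fun x => phi (fcomp (fshift i F) N x))) _ _)).
exact: lerD.
Qed.

Lemma average_mean_close N (s : R) F k : (0 < k)%N -> (forall j, good C (F j)) -> 0 <= s ->
  (forall i, `|mean (fun x => phi (fcomp F (i + N) x)) - mean (fun x => phi (iter N f x))| <= s) ->
  `|k%:R^-1 * \sum_(j < k) mean (fun x => phi (fcomp F j x)) - mean (fun x => phi (iter N f x))|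
    <= s + N%:R * (2 * M) / k%:R.
Proof.
move=> k0 gF s0 hs; set al := mean _ in hs *.
have k0' : 0 < k%:R :> R by rewrite ltr0n.
have alM : `|al| <= M.
  by apply: (state_bound smean) => //; apply: ucont_comp => //; exact: iter_tuc gf N.
have hj j : `|mean (fun x => phi (fcomp F j x)) - al| <= s + (j < N)%N%:R * (2 * M).
  case: (ltnP j N) => jN; last by rewrite mul0r addr0 -(subnK jN); exact: hs.
  rewrite mul1r; apply: ler_wpDl => //; rewrite (le_trans (ler_normB _ _))// mulr2n mulrDl mul1r.
  rewrite lerD//; apply: (state_bound smean) => //.
  by apply: ucont_comp => //; apply: fcomp_tuc => i; exact: good_tuc (gF i).
have -> : k%:R^-1 * \sum_(j < k) mean (fun x => phi (fcomp F j x)) - al =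
   k%:R^-1 * \sum_(j < k) (mean (fun x => phi (fcomp F j x)) - al).
  rewrite sumrB sumr_const card_ord -mulr_natl; field; exact: lt0r_neq0.
rewrite normrM normfV (gtr0_norm k0') mulrC ler_pdivrMr// mulrDl divfK ?gt_eqF//.
apply: (le_trans (ler_norm_sum _ _ _)).
apply: (@le_trans _ _ (\sum_(j < k) (s + (j < N)%N%:R * (2 * M)))); first exact: ler_sum.
rewrite big_split/= sumr_const card_ord -[s *+ k]mulr_natr lerD2l -mulr_suml ler_wpM2r//.
  by rewrite mulr_ge0// ltW.
rewrite -natr_sum ler_nat.
elim: (k) => [|l ih]; first by rewrite big_ord0.
rewrite big_ord_recr /=; case: (ltnP l N) => lN; last by rewrite addn0.
rewrite addn1 (leq_ltn_trans _ lN)// -[l in leqRHS]card_ord -sum1_card.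
by apply: leq_sum => i _; case: (_ < _)%N.
Qed.

End fixed_observable.
End nonautonomous.

(** * Joint measurability in noise and initial point, and exchange of their almost-everywhere
    statements *)

Section joint_measurability.
Context {R : realType} {n : nat}.
Local Notation M := (torus R n).

Lemma countable_basis : exists B : nat -> set M, (forall i, open (B i)) /\
  forall (x : M) (O : set M), open O -> O x -> exists i, B i x /\ B i `<=` O.
Proof.
have dN (N : nat) : 0 < N.+1%:R^-1 :> R by rewrite invr_gt0.
have /choice[s hs] : forall N : nat, exists s : seq M,
    forall x, exists2 p, p \in s & tnorm (x - p) < N.+1%:R^-1.
  move=> N; have [I [g hg]] := finite_net (n := n) (dN N).
  exists [seq g i | i <- enum I] => x; have [i hi] := hg x.
  by exists (g i) => //; apply: map_f; rewrite mem_enum.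
pose B i : set M := if unpickle i is Some (N, k) then
  [set x | tnorm (x - nth 0 (s N) k) < N.+1%:R^-1] else set0.
exists B; split.
  move=> i; rewrite /B; case: unpickle => [[N k]|]; last exact: open0.
  have -> : [set x : M | tnorm (x - nth 0 (s N) k) < N.+1%:R^-1] =
      (fun x => x + (- nth 0 (s N) k)) @^-1` [set q | tnorm q < N.+1%:R^-1] by [].
  apply: open_comp => [x _|]; [exact: continuous_translate|exact: open_tball].
move=> x O oO Ox; have [d d0 hd] := (nbhs_tnormP _ _).1 (open_nbhs_nbhs (conj oO Ox)).
have [N _ hN] := near_infty_natSinv_lt (PosNum (divr_gt0 d0 (ltr0Sn R 1))).
have [p ps xp] := hs N x.
exists (pickle (N, index p (s N))); rewrite /B pickleK nth_index//; split => // y /= yp.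
apply: hd; have := tnorm_tri p y x; rewrite (tnormB p); have /= := hN N (leqnn N).
by move: xp yp; move: (N.+1%:R^-1) => z; lra.
Qed.

(** [X] may fail to be second countable, so an open set of the product need not be a countable union
    of open rectangles. For the preimage of W it is: each set [B i] of a countable basis of M is
    paired with the union of all open V for which V x [B i] is mapped into W. *)
Lemma measurable_eval (X : ptopologicalType) (ev : X -> M -> M) :
  (forall s y (O : set M), open O -> O (ev s y) ->
     exists (U : set X) (W : set M), [/\ open U, open W, U s, W y &
       forall s' y', U s' -> W y' -> O (ev s' y')]) ->
  measurable_fun setT ((fun z => ev z.1 z.2) : borel X * borel M -> borel M).
Proof.
move=> hev; have [B [oB hB]] := countable_basis.
apply: (@measurability _ _ _ (borel M) setT _ (@open M)) => // _ [W oW <-]; rewrite setTI.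
pose U i : set X := \bigcup_(V in [set V : set X | open V /\
   forall s y, V s -> B i y -> W (ev s y)]) V.
have oU i : open (U i) by apply: bigcup_open => V [].
rewrite (_ : _ @^-1` _ = \bigcup_i ((U i : set (borel X)) `*` (B i : set (borel M)))).
  apply: bigcup_measurable => i _; apply: measurableX; exact: sub_sigma_algebra.
apply/seteqP; split=> [[s y] /= Wsy|[s y] [i _ [/= [V [oV hV] Vs] By]]]; last exact: hV.
have [V [Y [oV oY Vs Yy hVY]]] := hev s y W oW Wsy.
have [i [Biy BiY]] := hB y Y oY Yy.
exists i => //; split => //=; exists V => //; split => // s' y' Vs' By'.
by apply: hVY => //; exact: BiY.
Qed.

End joint_measurability.

Section fubini_limit.
Context d1 d2 (X : measurableType d1) (Om : measurableType d2) (R : realType).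
Variables (m : probability X R) (P : probability Om R).

(** The two hypotheses quantify in opposite orders: convergence holds at each x of A for almost
    every w, the bound holds for almost every w after integration over x. Tonelli exchanges the
    integrals, and dominated convergence, first in w and then in x, passes to the limit. *)
Lemma fubini_limit (Z : nat -> X * Om -> R) (B z beta : R) (A : set X) (b : nat -> R) :
  measurable A -> (forall k, measurable_fun setT (Z k)) ->
  (forall k w, 0 <= Z k w <= B) ->
  (forall x, A x -> \forall w \ae P, Z k (x, w) @[k --> \oo] --> z) ->
  (\forall w \ae P, forall k, (0 < k)%N ->
     Rintegral m setT (fun x => \1_A x * Z k (x, w)) <= b k) ->
  b @ \oo --> beta -> z * fine (m A) <= beta.
Proof.
move=> mA mZ ZB Zz hb bbeta.
pose g k (w : X * Om) := \1_A w.1 * Z k w.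
have mg k : measurable_fun setT (g k).
  apply: measurable_funM => //.
  exact: (measurableT_comp (measurable_indic mA) measurable_fst).
have gB k w : 0 <= g k w <= B.
  have /andP[h1 h2] := ZB k w; rewrite /g indicE; case: (w.1 \in A).
    by rewrite mul1r h1.
  by rewrite mul0r lexx /=; exact: le_trans h2.
have icst (c : R) : (\int[P]_w c%:E = c%:E)%E.
  rewrite integral_cst//.
  exact: (etrans (congr1 (fun u => c%:E * u)%E (probability_setT P)) (mule1 _)).
pose J k x := (\int[P]_w (g k (x, w))%:E)%E.
have mgE k : measurable_fun setT (EFin \o g k) by exact/measurable_EFinP.
have g0 k w : (0 <= (EFin \o g k) w)%E by rewrite lee_fin; have /andP[] := gB k w.
have mJ k : measurable_fun setT (J k).
  exact: (measurable_fun_fubini_tonelli_F (m2 := P) (EFin \o g k) (mgE k) (g0 k)).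
have mgx k x : measurable_fun setT (fun w => (g k (x, w))%:E).
  exact: (measurableT_comp (mgE k) (measurable_pair1 x)).
have intB (d : measure_display) (Y : measurableType d) (Q : probability Y R) :
    Q.-integrable setT (fun=> B%:E).
  apply: (@bounded_integrable R _ Y Q (fun=> B) `|B|) => //.
have J_cvg x : J k x @[k --> \oo] --> (\1_A x * z)%:E.
  have [|||||_ _] := @dominated_convergence _ Om R P setT measurableT
    (fun k w => (g k (x, w))%:E) (fun=> (\1_A x * z)%:E) (fun=> B%:E).
  - by move=> k; exact: mgx.
  - exact: measurable_cst.
  - rewrite /g /= indicE; have [|_] := boolP (x \in A).
      rewrite inE => Ax; apply: (@filterS _ _ (ae_filter_ringOfSetsType P)) (Zz x Ax) => w hw _.
      rewrite mul1r (_ : (fun k => _) = (fun k => (Z k (x, w))%:E)).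
        by apply: cvg_EFin => //; exact: nearW.
      by apply/funext => k; rewrite mul1r.
    apply: aeW => w _; rewrite mul0r (_ : (fun k => _) = (fun=> 0%:E)); first exact: cvg_cst.
    by apply/funext => k; rewrite mul0r.
  - exact: intB.
  - apply: aeW => w k _; rewrite abse_EFin lee_fin; have /andP[h1 h2] := gB k (x, w).
    by rewrite ger0_norm.
  by rewrite icst.
have [|||||_ _ J_int] := @dominated_convergence _ X R m setT measurableT
    J (fun x => (\1_A x * z)%:E) (fun=> B%:E).
- exact: mJ.
- apply/measurable_EFinP; apply: measurable_funM => //; exact: measurable_indic.
- by apply: aeW => x _; exact: J_cvg.
- exact: intB.
- apply: aeW => x k _; rewrite gee0_abs; last by apply: integral_ge0 => w _; exact: g0.
  apply: (@le_trans _ _ (\int[P]_w (B%:E))%E).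
    apply: ge0_le_integral => //.
    + by move=> w _; exact: g0.
    + by move=> w _; rewrite lee_fin; have /andP[] := gB k (x, w).
  by rewrite icst.
have J_le k : (0 < k)%N -> (\int[m]_x J k x <= (b k)%:E)%E.
  move=> k0; rewrite /J (fubini_tonelli (m1 := m) (m2 := P) (EFin \o g k) (mgE k) (g0 k)).
  have hbk : \forall w \ae P, (\int[m]_x (EFin \o g k) (x, w) <= (b k)%:E)%E.
    apply: (@filterS _ _ (ae_filter_ringOfSetsType P)) hb => w /(_ k k0).
    rewrite -lee_fin => /(le_trans _); apply; rewrite /Rintegral fineK//.
    apply: integrable_fin_num => //.
    apply: (@bounded_integrable R _ X m (fun x => g k (x, w)) B).
      exact: (measurableT_comp (mg k) (measurable_pair2 w)).
    by move=> x; have /andP[h1 h2] := gB k (x, w); rewrite ger0_norm.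
  have bk0 : (0 <= (b k)%:E)%E.
    have PT : P setT = 1%E := probability_setT P.
    have P0 : (0 < P setT)%E by rewrite PT lte01.
    have [w hw] := @filter_ex _ _ (ae_properfilter_algebraOfSetsType P0) _ hbk.
    by apply: le_trans hw; apply: integral_ge0 => x _; exact: g0.
  apply: (@le_trans _ _ (\int[P]_w (b k)%:E)%E); last first.
    by rewrite icst.
  apply: ae_ge0_le_integral => //.
  - by move=> w _; apply: integral_ge0 => x _; exact: g0.
  - exact: (measurable_fun_fubini_tonelli_G (m1 := m) (EFin \o g k) (mgE k) (g0 k)).
  - by apply: (@filterS _ _ (ae_filter_ringOfSetsType P)) hbk => w h _.
have intz : (\int[m]_x (\1_A x * z)%:E = (z * fine (m A))%:E)%E.
  under eq_integral do rewrite mulrC EFinM.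
  rewrite integralZl//; last exact: integrable_indic.
  by rewrite integral_indic// setIT EFinM fineK// fin_num_measure.
rewrite -lee_fin -intz.
have cb : (fun k => (b k)%:E) @ \oo --> beta%:E by apply: cvg_EFin => //; exact: nearW.
apply: (lee_cvg_to J_int cb).
by exists 1%N => // k /= k0; exact: J_le.
Qed.

End fubini_limit.

Section random_orbits.
Context {R : realType} {n : nat} {T : pmetricType R}.
Local Notation M := (torus R n).
Local Notation vol := (@volume R n).
Local Notation mean := (Rintegral vol setT).
Variables (f : C2map R n) (tstar : T) (Phi : T -> C2map R n).
Variables (theta : R -> probability (borel T) R).
Variables (thetaN : R -> probability (seqs T) R).
Hypothesis rp : random_perturbation f tstar Phi theta thetaN.

Let smean : state mean := state_Rintegral _.

Lemma measurable_coordinate k : measurable_fun setT ((fun t => t k) : seqs T -> borel T).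
Proof.
move=> _ A mA; rewrite setTI; apply: sub_sigma_algebra.
by exists k, A; split.
Qed.

Lemma Phi_joint s (y : M) (O : set M) : open O -> O (Phi s y) ->
  exists (U : set T) (W : set M), [/\ open U, open W, U s, W y &
    forall s' y', U s' -> W y' -> O (Phi s' y')].
Proof.
move=> oO Os; have [d d0 hd] := (nbhs_tnormP _ _).1 (open_nbhs_nbhs (conj oO Os)).
have d20 : 0 < d / 2 by lra.
have nW : nbhs y [set y' | tnorm (Phi s y' - Phi s y) < d / 2].
  have /= cy := C2_on_cont (C2mapP (Phi s)) (p := y) I.
  by apply: (cy [set q | tnorm (q - Phi s y) < d / 2]); apply/nbhs_tnormP; exists (d / 2).
have nU : nbhs s (Phi @^-1` ball (Phi s) (d / 2)).
  have hb := nbhsx_ballx (Phi s) _ d20.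
  by have := rp_cont rp hb; rewrite nbhs_filterE fmapE.
exists (interior (Phi @^-1` ball (Phi s) (d / 2))).
exists (interior [set y' | tnorm (Phi s y' - Phi s y) < d / 2]); split => //.
- exact: open_interior.
- exact: open_interior.
move=> s' y' /interior_subset /= Us' /interior_subset /= Wy'.
have [h1 _ _] := Us' y'; have h2 := ball_tnorm h1.
by apply: hd; have := tnorm_tri (Phi s y') (Phi s' y') (Phi s y); lra.
Qed.

Lemma measurable_random_orbit k : measurable_fun setT
  ((fun z => random_orbit Phi z.2 z.1 k) : borel M * seqs T -> borel M).
Proof.
elim: k => [|k ih]; first exact: measurable_fst.
have mev := measurable_eval Phi_joint.
have mp : measurable_fun setT ((fun z => (z.2 k, random_orbit Phi z.2 z.1 k)) :
    borel M * seqs T -> borel T * borel M).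
  apply/measurable_fun_pairP; split => //=.
  exact: (measurableT_comp (measurable_coordinate k) measurable_snd).
exact: (measurableT_comp mev mp).
Qed.

Lemma measurable_support e : measurable (Defs.support (theta e) : set (borel T)).
Proof.
rewrite -(setCK (Defs.support (theta e))); apply: measurableC; apply: sub_sigma_algebra => /=.
rewrite openE => x /= /existsNP[U /not_implyP[oU /not_implyP[Ux hU]]].
rewrite /interior; apply: filterS (open_nbhs_nbhs (conj oU Ux)) => y Uy /= hy.
exact: hU (hy U oU Uy).
Qed.

Lemma ae_support e : 0 < e -> \forall t \ae thetaN e, forall i, Defs.support (theta e) (t i).
Proof.
move=> e0; apply: ae_foralln => i.
have mS : measurable [set t : seqs T | Defs.support (theta e) (t i)].
  have := measurable_coordinate i measurableT (measurable_support e).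
  by rewrite setTI.
exists (~` [set t : seqs T | Defs.support (theta e) (t i)]); split => //.
  exact: measurableC.
suff e1 : thetaN e [set t : seqs T | Defs.support (theta e) (t i)] = 1%E.
  by apply: (etrans (probability_setC (thetaN e) mS)); rewrite e1 subee.
apply/eqP; rewrite eq_le probability_le1//=.
(* The product formula concerns initial blocks of coordinates, hence i + 1 factors all equal to the
   support. *)
have := rp_prod rp e0; move=> /(_ i.+1 (fun=> Defs.support (theta e)) (fun _ => measurable_support e)).
rewrite big1 => [<-|j _]; last exact: (rp_supp rp e0).
apply: le_measure; rewrite ?inE//.
  rewrite (_ : mkset _ = \bigcap_(j in [set j | (j < i.+1)%N]) [set t : seqs T | Defs.support (theta e) (t j)]).
    apply: bigcap_measurable => [|j _]; first by exists i => /=; rewrite ltnSn.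
    have := measurable_coordinate j measurableT (measurable_support e).
    by rewrite setTI.
  by apply/seteqP; split.
by move=> t /= /(_ i (ltnSn i)).
Qed.

Variables (C : R) (C0 : 0 <= C) (r : R) (r0 : 0 < r).
Hypothesis ball_good : forall g : C2map R n, ball f r g -> good C g.

Lemma near_star (d : R) : 0 < d -> exists2 e1 : R, 0 < e1 &
  forall e t, 0 < e -> e < e1 -> Defs.support (theta e) t -> ball f d (Phi t).
Proof.
move=> d0.
have : nbhs tstar (Phi @^-1` ball f d).
  rewrite -(rp_star rp); have hb := nbhsx_ballx (Phi tstar) _ d0.
  by have := rp_cont rp hb; rewrite nbhs_filterE fmapE.
move=> /nbhs_ballP[d' /= d'0 hd'].
have [e1 /= e10 he1] := rp_shrink rp d'0; exists e1 => // e t e0 ee1 st.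
apply: hd'; apply: (he1 e) => //=.
by rewrite sub0r normrN gtr0_norm.
Qed.

Lemma f_good : good C f. Proof. by apply: ball_good; exact: ballxx. Qed.

Lemma random_orbit_fcomp t x k : random_orbit Phi t x k = fcomp (fun j => Phi (t j) : M -> M) k x.
Proof. by elim: k => //= k ->. Qed.

(** The distance from the random Birkhoff average to m (phi o f^N) is integrated over the basin A.
    For x in A it tends to |nu phi - m (phi o f^N)| almost surely; for almost every noise sequence,
    its integral over x is controlled by the variance bound and the closeness of the means. *)
Lemma physical_close phi (B : R) N (s : R) : tlip phi -> 0 < B -> (forall x, `|phi x| <= B) ->
  0 < s ->
  exists2 e1 : R, 0 < e1 & forall e nu, 0 < e -> e < e1 ->
    physical_measure Phi thetaN e nu ->
    `|Rintegral nu setT phi - mean (fun x => phi (iter N f x))| <=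
      (1 - crate (6 * n%:R * C)) ^+ N * (2 * B) + s.
Proof.
move=> lphi B0 hB s0; have uphi := tlip_ucont lphi.
have [d d0 hd] := mean_fcomp_close C0 f_good lphi hB N s0.
have [e1 e10 he1] := near_star (d := Num.min d r) ltac:(by rewrite lt_min d0).
exists e1 => // e nu e0 ee1 [A [mA A0 hA]].
set al := mean _; set S := _ + s.
have S0 : 0 <= S.
  have K0 : 0 <= 6 * n%:R * C by rewrite !mulr_ge0.
  have r0' : 0 <= 1 - crate (6 * n%:R * C).
    by rewrite subr_ge0 ltW//; have /andP[] := crate_bounds K0.
  by rewrite /S addr_ge0 ?mulr_ge0 ?exprn_ge0// ltW.
have alB : `|al| <= B.
  by apply: (state_bound smean) => //; exact: ucont_comp uphi (iter_tuc f_good N).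
have [D D0 hD] := variance_bound C0 lphi.
pose avg k x t := k%:R^-1 * \sum_(j < k) phi (random_orbit Phi t x j).
pose Z k (w : borel M * seqs T) := `|avg k w.1 w.2 - al|.
have avgB k x t : `|avg k x t| <= B.
  have [->|k0] := posnP k; first by rewrite /avg big_ord0 mulr0 normr0 ltW.
  rewrite /avg normrM normfV (ger0_norm (ler0n _ _)) ler_pdivrMl ?ltr0n//.
  rewrite (le_trans (ler_norm_sum _ _ _))// mulr_natl -[k in leRHS]card_ord -sumr_const.
  exact: ler_sum.
have ZB k w : 0 <= Z k w <= 2 * B.
  rewrite normr_ge0 /= (le_trans (ler_normB _ _))// mulr2n mulrDl mul1r.
  exact: lerD (avgB _ _ _) alB.
have mphi : measurable_fun setT (phi : borel M -> R).
  by apply: continuous_borel_measurable; exact: ucont_continuous.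
have mZ k : measurable_fun setT (Z k).
  apply: measurableT_comp => //; apply: measurable_funB => //.
  apply: measurable_funM => //; apply: measurable_sum => j.
  exact: (measurableT_comp mphi (measurable_random_orbit j)).
have volA : fine (vol A) = Rintegral vol setT \1_A.
  by rewrite /Rintegral integral_indic// setIT.
have volA0 : 0 < fine (vol A) by rewrite fine_gt0// A0 /= (le_lt_trans (probability_le1 vol mA))// ltry.
set z := `|_ - al|.
(* The measure of A depends on [nu]. The error S is integrated over A only, so division by that
   measure leaves it unchanged; the errors integrated over the whole torus disappear as k tends to
   infinity and then tau to 0. *)
suff key tau : 0 < tau -> z * fine (vol A) <= S * fine (vol A) + tau.
  rewrite -(ler_pM2r volA0); apply/ler_addgt0Pr => tau tau0; exact: key.
move=> tau0.
pose c := N%:R * (2 * B) + D / tau.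
apply: (@fubini_limit _ _ (borel M) (seqs T) R vol (thetaN e) Z (2 * B) z _ A
  (fun k => S * fine (vol A) + tau + c / k%:R)) => //.
- move=> x Ax; apply: (@filterS _ _ (ae_filter_ringOfSetsType (thetaN e))) (hA x Ax) => t ht.
  apply: cvg_norm; apply: cvgB; last exact: cvg_cst.
  exact: (ht phi (ucont_continuous uphi)).
- apply: (@filterS _ _ (ae_filter_ringOfSetsType (thetaN e))) (ae_support e0) => t ht k k0.
  pose F j : M -> M := Phi (t j).
  have k0' : 0 < k%:R :> R by rewrite ltr0n.
  have bF j : ball f (Num.min d r) (Phi (t j)) by exact: he1 ee1 (ht j).
  have gF j : good C (F j).
    by apply: ball_good; apply: le_ball (bF j); rewrite ge_min lexx orbT.
  have cF j x : tnorm (F j x - f x) < d.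
    have [h1 _ _] := bF j x; have := ball_tnorm h1; rewrite lt_min => /andP[+ _].
    by [].
  have hdF : `|k%:R^-1 * \sum_(j < k) mean (fun x => phi (fcomp F j x)) - al| <=
      S + N%:R * (2 * B) / k%:R.
    by apply: (average_mean_close f_good lphi B0 hB k0 gF S0); exact: hd.
  pose a j := mean (fun x => phi (fcomp F j x)).
  have uF j : ucont (fun x => phi (fcomp F j x)).
    by apply: ucont_comp => //; apply: fcomp_tuc => i; exact: good_tuc (gF i).
  pose V x := (\sum_(j < k) (phi (fcomp F j x) - a j)) ^+ 2.
  have uV : ucont V.
    have us : ucont (fun x => \sum_(j < k) (phi (fcomp F j x) - a j)).
      by apply: ucont_sum => j; have := ucontD (uF j) (ucont_cst (- a j)).
    by have := ucontM us us.
  pose W x := N%:R * (2 * B) / k%:R + tau + (tau * k%:R ^+ 2)^-1 * V x.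
  have uW : ucont W by apply: ucontD; [exact: ucont_cst|exact: ucontZ].
  have point x : \1_A x * Z k (x, t) <= S * \1_A x + W x.
    have t0 : 0 <= N%:R * (2 * B) / k%:R by rewrite !mulr_ge0 ?invr_ge0// ltW.
    have V0 : 0 <= (tau * k%:R ^+ 2)^-1 * V x.
      by rewrite mulr_ge0 ?sqr_ge0// invr_ge0 mulr_ge0 ?sqr_ge0// ltW.
    rewrite indicE; case: (x \in A); last by rewrite mul0r mulr0 add0r /W; lra.
    rewrite mul1r mulr1 /Z /=.
    have e1' : avg k x t = k%:R^-1 * \sum_(j < k) phi (fcomp F j x).
      by congr (_ * _); apply: eq_bigr => j _; rewrite random_orbit_fcomp.
    pose y := k%:R^-1 * \sum_(j < k) (phi (fcomp F j x) - a j).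
    have e2 : avg k x t - al = y + (k%:R^-1 * \sum_(j < k) a j - al).
      by rewrite e1' /y sumrB; ring.
    have yV : y ^+ 2 / tau = (tau * k%:R ^+ 2)^-1 * V x.
      rewrite /y /V exprMn; field; rewrite !gt_eqF//.
    (* AM-GM instead of Cauchy-Schwarz: after integration the right side is tau plus the variance
       over tau, with no square root to handle. *)
    have hy : `|y| <= tau + y ^+ 2 / tau.
      rewrite -(ler_pM2r tau0) mulrDl divfK ?gt_eqF//.
      have := sqr_ge0 (`|y| - tau); rewrite sqrrB real_normK ?num_real//.
      by move: (`|y|) (y ^+ 2) (normr_ge0 y) => u u2 u0; have := mulr_ge0 (ltW tau0) u0; lra.
    rewrite e2 (le_trans (ler_normD _ _))// /W -yV.
    by move: hdF hy; rewrite -/al; lra.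
  have iA : vol.-integrable setT (EFin \o (fun x : borel M => S * \1_A x)).
    by have := integrableZl measurableT S (integrable_indic vol mA); apply: eq_integrable.
  have iW := ucont_integrable vol uW.
  apply: (@le_trans _ _ (Rintegral vol setT (fun x => S * \1_A x + W x))).
    apply: le_Rintegral => //.
    + apply: (@bounded_integrable R _ (borel M) vol (fun x => \1_A x * Z k (x, t)) (2 * B)).
        apply: measurable_funM; first exact: measurable_indic.
        exact: (measurableT_comp (mZ k) (measurable_pair2 t)).
      move=> x; have /andP[h1 h2] := ZB k (x, t).
      by rewrite normrM (ger0_norm h1) indicE; case: (x \in A);
        rewrite ?normr1 ?mul1r// normr0 mul0r; lra.
    + by have := integrableD measurableT iA iW; apply: eq_integrable.
  rewrite RintegralD// RintegralZl//; last exact: integrable_indic.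
  rewrite -volA -addrA lerD2l /W.
  rewrite (stateD smean (ucont_cst _) (ucontZ _ uV)) (stateZ smean _ uV) (state_cst smean).
  have -> : tau + c / k%:R = N%:R * (2 * B) / k%:R + tau + D / tau / k%:R by rewrite /c; ring.
  rewrite lerD2l.
  have := hD F gF k; rewrite -/a => hV.
  apply: (le_trans (ler_wpM2l _ hV)); first by rewrite invr_ge0 mulr_ge0 ?sqr_ge0// ltW.
  by rewrite le_eqVlt; apply/orP; left; apply/eqP; field; rewrite !gt_eqF.
- have h0 : (fun k => c / k%:R : R) @ \oo --> c * 0.
    apply: cvgM; first exact: cvg_cst.
    rewrite -cvg_shiftS; exact: cvg_harmonic.
  have h1 := cvgD (cvg_cst (S * fine (vol A) + tau) : (fun=> S * fine (vol A) + tau) @ \oo --> _) h0.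
  rewrite mulr0 addr0 in h1; exact: h1.
Qed.

End random_orbits.

Section stability.
Context {R : realType} {n : nat}.
Local Notation M := (torus R n).
Local Notation vol := (@volume R n).
Local Notation mean := (Rintegral vol setT).

(** For each N, [physical_close] holds below some level e1, and weak accumulation supplies physical
    measures below any level. So mu phi is within rho^N times a constant of m (phi o f^N), and the
    convex combination has the single term mu. *)
Lemma good_ball_stable (f : C2map R n) (C r : R) : 0 <= C -> 0 < r ->
  (forall g : C2map R n, ball f r g -> good C g) -> stochastically_stable f.
Proof.
move=> C0 r0 hr T tstar Phi theta thetaN rp mu hmu.
have gf : good C f by apply: hr; exact: ballxx.
pose rho := 1 - crate (6 * n%:R * C).
have K0 : 0 <= 6 * n%:R * C by rewrite !mulr_ge0.
have /andP[c0 c1] := crate_bounds K0.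
have mu_lim phi : tlip phi ->
    (fun N => mean (fun x => phi (iter N f x))) @ \oo --> Rintegral mu setT phi.
  move=> lphi; have uphi := tlip_ucont lphi; have [B B0 hB] := ucont_bounded uphi.
  have bound N : `|Rintegral mu setT phi - mean (fun x => phi (iter N f x))| <= rho ^+ N * (2 * B).
    apply/ler_addgt0Pr => e e0; have e20 : 0 < e / 2 by lra.
    have [e1 e10 he1] := physical_close rp C0 r0 hr N lphi B0 hB e20.
    have [e' [nu [e'0 e'e1 pnu hnu]]] := hmu 1%N (fun=> phi) (e / 2) e1
      (fun=> ucont_continuous uphi) e20 e10.
    have h1 := he1 e' nu e'0 e'e1 pnu; have h2 := hnu ord0.
    clear hnu he1.
    have := ler_distD (Rintegral nu setT phi) (Rintegral mu setT phi) (mean (fun x => phi (iter N f x))).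
    rewrite (distrC (Rintegral mu setT phi) (Rintegral nu setT phi)) /rho; lra.
  apply/cvgrPdist_le => e e0.
  have : (fun N => rho ^+ N * (2 * B)) @ \oo --> 0 * (2 * B).
    by apply: cvgM; [apply: cvg_expr; rewrite /rho ger0_norm; lra|exact: cvg_cst].
  rewrite mul0r => /cvgrPdist_le /(_ e e0); apply: filterS => N.
  rewrite sub0r normrN => h; apply: (le_trans (bound N)); exact: le_trans (ler_norm _) h.
have srb := mu_SRB C0 gf mu_lim.
exists 1%N, (fun=> mu), (fun=> 1); split => //.
- by rewrite big_ord_recl big_ord0 addr0.
- by move=> A mA; rewrite big_ord_recl big_ord0 adde0 mul1e.
Qed.

End stability.

(** * Maps close to the doubling map *)

HB.instance Definition _ (R : realType) m n := NormedModule.on 'M[R]_(m, n).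

(** * First-order expansions and mean value estimates *)

Section expansions.
Context {R : realType}.

(* First-order expansion at 0: a derivative of g without division. *)
Definition expand (V : normedModType R) (g : R -> V) (l : V) := forall e : R, 0 < e ->
  exists2 d : R, 0 < d & forall t, `|t| < d -> `|g t - g 0 - t *: l| <= e * `|t|.

Lemma expandP (V W : normedModType R) (phi : V -> W) (a v : V) (l : W) :
  is_derive a v phi l <-> expand (fun t => phi (a + t *: v)) l.
Proof.
split=> [[dphi phil] e e0|hl].
  have /cvgrPdist_le/(_ e e0) : (fun h : R => h^-1 *: ((phi \o shift a) (h *: v) - phi a)) @ 0^' --> l.
    by rewrite -phil; exact: dphi.
  case=> d /= d0 hd; exists d => // t td.
  have [->|t0] := eqVneq t 0; first by rewrite !scale0r addr0 subrr subr0 !normr0 mulr0.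
  have := hd t; rewrite /= sub0r normrN => /(_ td t0).
  rewrite scale0r addr0 [t *: v + a]addrC => h.
  rewrite -[phi _ - phi a](scalerKV t0) -scalerBr normrZ mulrC ler_wpM2r// distrC.
  exact: h.
have hc : (fun h : R => h^-1 *: ((phi \o shift a) (h *: v) - phi a)) @ 0^' --> l.
  apply/cvgrPdist_le => e e0; have [d d0 hd] := hl e e0.
  exists d => //= t; rewrite /= sub0r normrN => td t0.
  have := hd t td; rewrite scale0r addr0 [a + _]addrC => h.
  rewrite distrC -[l](scalerK t0) -scalerBr normrZ normfV mulrC.
  by rewrite ler_pdivrMr ?normr_gt0.
split; first by apply/cvg_ex; exists l.
exact: cvg_lim hc.
Qed.

Lemma expandD (V : normedModType R) (g h : R -> V) l m :
  expand g l -> expand h m -> expand (fun t => g t + h t) (l + m).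
Proof.
move=> hg hh e e0; have e2 : 0 < e / 2 by lra.
have [d d0 hd] := hg _ e2; have [d' d'0 hd'] := hh _ e2.
exists (Num.min d d') => [|t]; first by rewrite lt_min d0.
rewrite lt_min => /andP[/hd h1 /hd' h2].
have -> : g t + h t - (g 0 + h 0) - t *: (l + m) = (g t - g 0 - t *: l) + (h t - h 0 - t *: m).
  by rewrite scalerDr !opprD !addrA [LHS](ACl (1*3*5*2*4*6)).
by rewrite (le_trans (ler_normD _ _))//; lra.
Qed.

Lemma expandN (V : normedModType R) (g : R -> V) l : expand g l -> expand (fun t => - g t) (- l).
Proof.
move=> hg e e0; have [d d0 hd] := hg _ e0; exists d => // t /hd.
by rewrite scalerN -!opprD normrN.
Qed.

Lemma expand_linear (V : normedModType R) (v w : V) : expand (fun t => v + t *: w) w.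
Proof.
move=> e e0; exists 1 => // t _; rewrite scale0r addr0 [v + _]addrC addrK subrr normr0.
by rewrite mulr_ge0// ltW.
Qed.

Lemma expand_local (V : normedModType R) (g h : R -> V) l (r : R) : 0 < r ->
  (forall t, `|t| < r -> g t = h t) -> expand g l -> expand h l.
Proof.
move=> r0 gh hg e e0; have [d d0 hd] := hg _ e0.
exists (Num.min d r) => [|t]; first by rewrite lt_min d0.
rewrite lt_min => /andP[td tr]; rewrite -!gh ?normr0//; exact: hd.
Qed.

Lemma mx_norm_entry m n (A : 'M[R]_(m, n)) i j : `|A i j| <= `|A|.
Proof.
by rewrite [leRHS]mx_normrE; apply: (le_bigmax _ (fun ij => `|A ij.1 ij.2|) (i, j)).
Qed.

Lemma expand_entry m n (g : R -> 'M[R]_(m, n)) l i j :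
  expand g l -> expand (fun t => g t i j : R) (l i j).
Proof.
move=> hg e e0; have [d d0 hd] := hg _ e0; exists d => // t /hd; apply: le_trans.
have -> : g t i j - g 0 i j - t *: l i j = (g t - g 0 - t *: l) i j by rewrite !mxE.
exact: mx_norm_entry.
Qed.

Lemma mean_value_le (g D : R -> R) (B a : R) : 0 <= B ->
  (forall t, `|t| <= `|a| -> expand (fun s => g (t + s)) (D t) /\ `|D t| <= B) ->
  `|g a - g 0| <= B * `|a|.
Proof.
move=> B0 hg.
have dg t : `|t| <= `|a| -> is_derive t (1 : R) g (D t).
  move=> /hg[h _]; apply/expandP; apply: expand_local ltr01 _ h => s _.
  by rewrite scaler1.
pose x := Num.min 0 a; pose y := Num.max 0 a.
have xy : x <= y by rewrite /x /y ge_min le_max lexx.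
have xya z : x <= z <= y -> `|z| <= `|a|.
  rewrite /x /y; have [a0|a0] := leP 0 a.
    by rewrite (ger0_norm a0) ler_norml => /andP[h1 h2]; lra.
  by rewrite (ltr0_norm a0) ler_norml => /andP[h1 h2]; lra.
have [||c cxy hc] := MVT_segment xy (f := g) (df := D).
- by move=> z; rewrite in_itv/= => /andP[z1 z2]; apply/dg/xya; rewrite !ltW.
- apply: derivable_within_continuous => z; rewrite in_itv/= => zxy.
  by have [] := dg z (xya z zxy).
have hc' : `|g y - g x| <= B * `|y - x|.
  rewrite hc normrM ler_wpM2r//; apply: (hg c _).2; apply: xya.
  by move: cxy; rewrite in_itv.
move: hc'; rewrite /x /y; have [a0|a0] := leP 0 a.
  by rewrite subr0.
by rewrite distrC sub0r normrN.
Qed.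

End expansions.

Section partials.
Context {R : realType} {n : nat}.
Implicit Types (x y z h v w : 'rV[R]_n) (phi : 'rV[R]_n -> R).

(** Coordinates are changed one at a time, and the path stays in the cube of radius |h| about x.
    With c = 0 this yields Lipschitz bounds, with c the partials at x a Taylor remainder. *)
Lemma partials_expand phi (l : 'I_n -> 'rV[R]_n -> R) (c : 'I_n -> R) (B : R) x h : 0 <= B ->
  (forall z i, `|z - x| <= `|h| ->
    expand (fun t => phi (z + t *: delta_mx 0 i)) (l i z) /\ `|l i z - c i| <= B) ->
  `|phi (x + h) - phi x - \sum_i h 0 i * c i| <= n%:R * B * `|h|.
Proof.
move=> B0 hl.
pose w k : 'rV[R]_n := \row_j (if (j < k)%N then h 0 j else 0).
have w0 : w 0%N = 0 by apply/rowP => j; rewrite !mxE.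
have wn : w n = h by apply/rowP => j; rewrite !mxE ltn_ord.
have wS (i : 'I_n) : w i.+1 = w i + h 0 i *: delta_mx 0 i.
  apply/rowP => j; rewrite !mxE ltnS leq_eqVlt eqxx andTb.
  have [->|ji] := eqVneq j i; first by rewrite eqxx ltnn mulr1 add0r.
  by rewrite -val_eqE /= in ji; rewrite (negbTE ji) mulr0 addr0.
have -> : phi (x + h) - phi x = \sum_(i < n) (phi (x + w i.+1) - phi (x + w i)).
  rewrite -(big_mkord xpredT (fun i => phi (x + w i.+1) - phi (x + w i))).
  by rewrite telescope_sumr// wn w0 addr0.
rewrite -sumrB (le_trans (ler_norm_sum _ _ _))//.
have -> : n%:R * B * `|h| = \sum_(i < n) B * `|h| by rewrite sumr_const card_ord -[RHS]mulr_natl mulrA.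
apply: ler_sum => i _.
pose g t := phi (x + w i + t *: delta_mx 0 i) - t * c i.
have -> : phi (x + w i.+1) - phi (x + w i) - h 0 i * c i = g (h 0 i) - g 0.
  by rewrite /g wS scale0r !addr0 mul0r subr0 addrA; ring.
apply: (@le_trans _ _ (B * `|h 0 i|)); last by rewrite ler_wpM2l// rV_norm_coord.
apply: (@mean_value_le R g (fun t => l i (x + w i + t *: delta_mx 0 i) - c i)) => // t ti.
have [|h1 h2] := hl (x + w i + t *: delta_mx 0 i) i.
  rewrite -(addrA x) [x + (_ + _)]addrC addrK; apply: rV_norm_le => // j; rewrite !mxE eqxx /=.
  have [->|ji] := eqVneq j i; first by rewrite ltnn add0r mulr1 (le_trans ti)// rV_norm_coord.
  by rewrite mulr0 addr0; case: ifP => _; rewrite ?normr0// rV_norm_coord.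
split=> //; rewrite /g.
have := expandD h1 (expand_linear (- (t * c i)) (- c i : R^o)).
apply: expand_local ltr01 _ => s _; rewrite scalerDl [in RHS]addrA; congr (_ + _).
by rewrite /GRing.scale/=; ring.
Qed.

End partials.

Section matrices.
Context {R : realType}.

Lemma mx_norm_le m n (A : 'M[R]_(m, n)) (c : R) : 0 <= c -> (forall i j, `|A i j| <= c) -> `|A| <= c.
Proof. by move=> c0 hA; rewrite [leLHS]mx_normrE; apply/bigmax_leP; split=> // -[i j] _. Qed.

Lemma mulmx_norm_le m n p (A : 'M[R]_(m, n)) (B : 'M[R]_(n, p)) : `|A *m B| <= n%:R * (`|A| * `|B|).
Proof.
apply: mx_norm_le => [|i j]; first by rewrite mulr_ge0// mulr_ge0.
rewrite mxE (le_trans (ler_norm_sum _ _ _))//.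
have -> : n%:R * (`|A| * `|B|) = \sum_(k < n) `|A| * `|B| by rewrite sumr_const card_ord mulr_natl.
by apply: ler_sum => k _; rewrite normrM ler_pM// mx_norm_entry.
Qed.

Lemma mx_cvg {I : Type} (F : set_system I) {FF : Filter F} m n (A : I -> 'M[R]_(m, n)) (L : 'M[R]_(m, n)) :
  (forall i j, (fun x => A x i j) @ F --> L i j) -> A @ F --> L.
Proof.
move=> hA; apply/cvgrPdist_le => e e0.
have h i j : \forall x \near F, `|L i j - A x i j| <= e.
  by have /cvgrPdist_le/(_ e e0) := hA i j.
have /filter_forall : forall i, \forall x \near F, forall j, `|L i j - A x i j| <= e.
  by move=> i; apply: filter_forall.
apply: filterS => x hx; apply: mx_norm_le => [|i j]; first exact: ltW.
by rewrite !mxE.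
Qed.

Lemma cvg_sum {V : normedModType R} {I J : Type} (F : set_system I) {FF : Filter F} (r : seq J)
    (g : J -> I -> V) (l : J -> V) :
  (forall j, g j @ F --> l j) -> (fun x => \sum_(j <- r) g j x) @ F --> \sum_(j <- r) l j.
Proof.
move=> hg; elim: r => [|j r ih].
  by rewrite big_nil; under eq_cvg do rewrite big_nil; exact: cvg_cst.
by rewrite big_cons; under eq_cvg do rewrite big_cons; exact: cvgD.
Qed.

Lemma cvg_mulmx {I : Type} (F : set_system I) {FF : Filter F} m n p
    (A : I -> 'M[R]_(m, n)) (B : I -> 'M[R]_(n, p)) (L : 'M[R]_(m, n)) (M : 'M[R]_(n, p)) :
  A @ F --> L -> B @ F --> M -> (fun x => A x *m B x) @ F --> L *m M.
Proof.
move=> hA hB; apply: mx_cvg => i j; rewrite mxE.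
under eq_cvg do rewrite mxE.
apply: (@cvg_sum R _ _ F _ _ (fun k x => A x i k * B x k j) (fun k => L i k * M k j)) => k.
apply: cvgM.
- exact: cvg_comp hA (@coord_continuous _ _ _ _ _ _).
- exact: cvg_comp hB (@coord_continuous _ _ _ _ _ _).
Qed.

Lemma expand_mx m n (g : R -> 'M[R]_(m, n)) (L : 'M[R]_(m, n)) :
  (forall i j, expand (fun t => g t i j : R) (L i j : R)) -> expand g L.
Proof.
move=> hg e e0.
have h i j : \forall t \near (0 : R), `|g t i j - g 0 i j - t *: L i j| <= e * `|t|.
  have [d d0 hd] := hg i j e e0; exists d => // t /=.
  by rewrite sub0r normrN; exact: hd.
have /filter_forall : forall i, \forall t \near (0 : R), forall j,
    `|g t i j - g 0 i j - t *: L i j| <= e * `|t|.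
  by move=> i; exact: filter_forall (h i).
case=> d /= d0 hd; exists d => // t td.
apply: mx_norm_le => [|i j]; first by rewrite mulr_ge0// ltW.
by have := hd t; rewrite /= sub0r normrN !mxE; exact.
Qed.

(** Writing N and N0 for the inverses at t and 0, N - N0 = - N (A t - A 0) N0. One error is that of
    the expansion of A, the other is t (N - N0) L N0, made quadratic in t by the Lipschitz
    hypothesis. *)
Lemma expand_invmx n (A : R -> 'M[R]_n) (L : 'M[R]_n) (c : R) : 0 < c ->
  (forall t, A t \in unitmx) -> (forall t, `|invmx (A t)| <= c) ->
  (forall t, `|invmx (A t) - invmx (A 0)| <= c * `|t|) ->
  expand A L -> expand (fun t => invmx (A t)) (- (invmx (A 0) *m L *m invmx (A 0))).
Proof.
move=> c0 uA hc hl hA e e0.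
pose K : R := n%:R * n%:R * c * c + 1.
pose K' : R := n%:R * n%:R * c * c * `|L| + 1.
have K0 : 0 < K by rewrite ltr_pwDr// !mulr_ge0// ltW.
have K'0 : 0 < K' by rewrite ltr_pwDr// !mulr_ge0// ltW.
have [d d0 hd] := hA (e / 2 / K) ltac:(by rewrite !divr_gt0).
exists (Num.min d (e / 2 / K')) => [|t]; first by rewrite lt_min d0 !divr_gt0.
rewrite lt_min => /andP[/hd h1]; rewrite ltr_pdivlMr// => h2.
set N := invmx (A t); set N0 := invmx (A 0).
have -> : N - N0 - t *: - (N0 *m L *m N0) =
    - (N *m (A t - A 0 - t *: L) *m N0) - t *: ((N - N0) *m L *m N0).
  rewrite !mulmxBr !mulmxBl mulVmx// mul1mx -(mulmxA N (A 0)) mulmxV// mulmx1.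
  rewrite -!scalemxAr -!scalemxAl scalerBr scalerN.
  by move: (t *: _) (t *: _) => X Y; apply/matrixP => i j; rewrite !mxE; ring.
have b1 : `|N *m (A t - A 0 - t *: L) *m N0| <= (K - 1) * (e / 2 / K * `|t|).
  rewrite (le_trans (mulmx_norm_le _ _))//.
  have -> : (K - 1) * (e / 2 / K * `|t|) = n%:R * ((n%:R * (c * (e / 2 / K * `|t|))) * c).
    by rewrite /K; ring.
  rewrite ler_wpM2l// ler_pM//; last exact: hc.
  by rewrite (le_trans (mulmx_norm_le _ _))// ler_wpM2l// ler_pM//; exact: hc.
have b2 : `|(N - N0) *m L *m N0| <= (K' - 1) * `|t|.
  rewrite (le_trans (mulmx_norm_le _ _))//.
  have -> : (K' - 1) * `|t| = n%:R * ((n%:R * (c * `|t| * `|L|)) * c) by rewrite /K'; ring.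
  rewrite ler_wpM2l// ler_pM//; last exact: hc.
  by rewrite (le_trans (mulmx_norm_le _ _))// ler_wpM2l// ler_pM//; exact: hl.
rewrite (le_trans (ler_normB _ _))// normrN normrZ.
have b1' : (K - 1) * (e / 2 / K * `|t|) <= e / 2 * `|t|.
  have -> : e / 2 * `|t| = K * (e / 2 / K * `|t|) by field; rewrite gt_eqF.
  by rewrite ler_wpM2r ?gerBl// mulr_ge0// ltW// !divr_gt0.
have b2' : `|t| * `|(N - N0) *m L *m N0| <= e / 2 * `|t|.
  rewrite mulrC ler_wpM2r// (le_trans b2)//.
  apply: le_trans (ltW h2); rewrite mulrC ler_wpM2l// gerBl//.
by rewrite (splitr e) mulrDl lerD// (le_trans b1).
Qed.

End matrices.

Record near_doubling (R : realType) (n : nat) (d : R) (f : torus R n -> torus R n) : Prop := {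
  nd_C2 : C2_on setT f ;
  nd_map : forall p, tnorm (f p - (p + p)) <= d ;
  nd_tderiv : forall p i j, `|tderiv f p i j - (2%:M : 'M[R]_n) i j| <= d ;
  nd_tderiv2 : forall p i k l, `|tderiv2 f i p k l| <= d
}.

(** * The lift to R^n of a map close to doubling, and its inverse *)

Section lift.
Context {R : realType} {n : nat}.
Local Notation T := (torus R n).
Implicit Types (x y z h v w : 'rV[R]_n) (p q : T).
Variables (d : R) (f : T -> T).
Hypotheses (d0 : 0 < d) (nd : n%:R * (n%:R * d) <= 16^-1) (hf : near_doubling d f).
Hypothesis n0 : (0 < n)%N.

Let c16 : 16^-1 <= 1 :> R. Proof. by lra. Qed.

Let n1 : 1 <= n%:R :> R. Proof. by rewrite ler1n. Qed.

Let nd1 : n%:R * d <= 16^-1.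
Proof. by apply: le_trans nd; rewrite ler_peMl// mulr_ge0// ltW. Qed.

Let d1 : d <= 16^-1.
Proof. by apply: le_trans nd1; rewrite ler_peMl// ltW. Qed.

(* f is p |-> p + p displaced by less than 1/2: this defines its lift to R^n. *)
Definition disp x : 'rV[R]_n := tlog (f (tproj x) - tproj (x + x)).

Definition lift x : 'rV[R]_n := x + x + disp x.

Lemma tproj_lift x : tproj (lift x) = f (tproj x).
Proof. by rewrite tprojD tlogK addrC subrK. Qed.

Lemma disp_le x : `|disp x| <= d.
Proof. by have := nd_map hf (tproj x); rewrite -tprojD. Qed.

Lemma disp_lattice x y : tproj x = tproj y -> disp x = disp y.
Proof. by move=> xy; rewrite /disp !tprojD xy. Qed.

(** At most 2/8 from doubling and 2/16 from the displacements: below 1/2, where [tlog] inverts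
    [tproj]. This fixes the radius 1/8 used for charts. *)
Lemma lift_sub_near x h : `|h| < 8^-1 -> `|lift (x + h) - lift x| < 2^-1.
Proof.
move=> h8; have := disp_le x; have := disp_le (x + h) => u1 u2.
have -> : lift (x + h) - lift x = h + h + (disp (x + h) - disp x).
  by rewrite /lift opprD addrACA; congr (_ + _); rewrite !opprD addrACA [x + h]addrC addrK.
have := ler_normD (h + h) (disp (x + h) - disp x); have := ler_normD h h.
have := ler_normB (disp (x + h)) (disp x).
by move: d1 => ? ? ? ?; lra.
Qed.

Lemma local_rep_lift x h : `|h| < 8^-1 -> local_rep f (tproj x) h = lift (x + h) - lift x.
Proof.
move=> h8; rewrite /local_rep -tprojD -!tproj_lift -tprojN -tprojD tlog_tproj//.
exact: lift_sub_near.
Qed.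

Lemma expand_lift x i :
  expand (fun t => lift (x + t *: delta_mx 0 i)) (row i (tderiv f (tproj x))).
Proof.
have hd : is_derive (0 : 'rV[R]_n) (delta_mx 0 i) (local_rep f (tproj x)) (row i (tderiv f (tproj x))).
  by rewrite rowK; apply: DeriveDef => //; exact: (C2_on_derivable (nd_C2 hf) (p := tproj x)).
have [r r0 hr] : exists2 r : R, 0 < r & forall t, `|t| < r -> `|t *: (delta_mx 0 i : 'rV[R]_n)| < 8^-1.
  exists 8^-1 => [|t t8]; first by rewrite invr_gt0.
  rewrite normrZ (le_lt_trans _ t8)// ler_piMr//; apply: rV_norm_le => // j.
  by rewrite mxE; case: (_ && _); rewrite ?normr0 ?normr1.
have := expandD ((expandP _ _ _ _).1 hd) (expand_linear (lift x) 0); rewrite addr0.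
apply: expand_local r0 _ => t tr; rewrite add0r local_rep_lift ?hr// scaler0 addr0.
by rewrite subrK.
Qed.

Lemma expand_disp x i j : expand (fun t => disp (x + t *: delta_mx 0 i) 0 j)
  (tderiv f (tproj x) i j - (2%:M : 'M[R]_n) i j).
Proof.
have h1 := expand_lift x i.
have h2 := expand_linear (- (x + x)) (- (row i (2%:M : 'M[R]_n))).
have := expand_entry 0 j (expandD h1 h2); rewrite !mxE.
apply: expand_local ltr01 _ => t _; congr (fun v : 'rV_n => v 0 j).
rewrite /lift rowE mul_mx_scalar scalerN scalerA mulrC -scalerA -opprD.
by rewrite [2 *: _]scaler_nat mulr2n [x + x + _]addrACA (addrAC _ (disp _)) subrr add0r.
Qed.

Lemma expand_tderiv x i :
  expand (fun t => tderiv f (tproj (x + t *: delta_mx 0 i))) (tderiv2 f i (tproj x)).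
Proof.
have hd : is_derive (0 : 'rV[R]_n) (delta_mx 0 i) (fun h => tderiv f (tproj x + tproj h))
    (tderiv2 f i (tproj x)).
  by apply: DeriveDef => //; exact: (C2_on_derivable2 (nd_C2 hf) (p := tproj x)).
apply: expand_local ltr01 _ ((expandP _ _ _ _).1 hd) => t _ /=.
by rewrite add0r tprojD.
Qed.

Lemma disp_lip x y : `|disp x - disp y| <= n%:R * d * `|x - y|.
Proof.
apply: rV_norm_le => [|j]; first by rewrite !mulr_ge0// ltW.
have := @partials_expand R n (fun z => disp z 0 j)
  (fun i z => tderiv f (tproj z) i j - (2%:M : 'M[R]_n) i j) (fun=> 0) d y (x - y) (ltW d0).
rewrite subrKC big1 ?subr0 => [|i _]; last by rewrite mulr0.
rewrite !mxE; apply => z i _; rewrite subr0; split; [exact: expand_disp|exact: nd_tderiv].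
Qed.

Lemma tderiv_lip x w i j :
  `|tderiv f (tproj (x + w)) i j - tderiv f (tproj x) i j| <= n%:R * d * `|w|.
Proof.
have := @partials_expand R n (fun z => tderiv f (tproj z) i j)
  (fun k z => tderiv2 f k (tproj z) i j) (fun=> 0) d x w (ltW d0).
rewrite big1 ?subr0 => [|k _]; last by rewrite mulr0.
apply => z k _; rewrite subr0; split; last exact: nd_tderiv2.
exact: expand_entry (expand_tderiv z k).
Qed.

(** A bound on second differences: the partials of z -> disp (z + w) - disp z are of order d |w|
    because the second derivatives are at most d. *)
Lemma disp_diff2 x y w :
  `|disp (x + w) - disp x - (disp (y + w) - disp y)| <= n%:R * (n%:R * d * `|w|) * `|x - y|.
Proof.
have B0 : 0 <= n%:R * d * `|w| by rewrite !mulr_ge0// ltW.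
apply: rV_norm_le => [|j]; first by rewrite mulr_ge0// mulr_ge0.
have := @partials_expand R n (fun z => disp (z + w) 0 j - disp z 0 j)
  (fun i z => tderiv f (tproj (z + w)) i j - tderiv f (tproj z) i j) (fun=> 0) _ y (x - y) B0.
rewrite subrKC big1 ?subr0 => [|i _]; last by rewrite mulr0.
rewrite !mxE; apply => z i _; rewrite subr0; split; last exact: tderiv_lip.
rewrite -[X in expand _ X](subrKA ((2%:M : 'M[R]_n) i j)) -[_ - tderiv f (tproj z) i j]opprB.
apply: expand_local ltr01 _ (expandD (expand_disp (z + w) i j) (expandN (expand_disp z i j))).
by move=> t _; rewrite addrAC.
Qed.

Lemma lift_quadratic x h :
  `|lift (x + h) - lift x - h *m tderiv f (tproj x)| <= n%:R * (n%:R * d * `|h|) * `|h|.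
Proof.
have B0 : 0 <= n%:R * d * `|h| by rewrite !mulr_ge0// ltW.
apply: rV_norm_le => [|j]; first by rewrite mulr_ge0// mulr_ge0.
have := @partials_expand R n (fun z => lift z 0 j)
  (fun i z => tderiv f (tproj z) i j) (fun i => tderiv f (tproj x) i j) _ x h B0.
have -> : \sum_i h 0 i * tderiv f (tproj x) i j = (h *m tderiv f (tproj x)) 0 j by rewrite mxE.
have -> : (lift (x + h) - lift x - h *m tderiv f (tproj x)) 0 j =
    lift (x + h) 0 j - lift x 0 j - (h *m tderiv f (tproj x)) 0 j by rewrite !mxE.
apply => z i zx; split.
  by have := expand_entry 0 j (expand_lift z i); rewrite mxE.
have := tderiv_lip x (z - x) i j; rewrite subrKC => /le_trans; apply.
by rewrite ler_wpM2l// mulr_ge0// ltW.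
Qed.

Lemma disp_contract x y : `|disp x - disp y| <= 16^-1 * `|x - y|.
Proof. by rewrite (le_trans (disp_lip x y))// ler_wpM2r. Qed.

Lemma lift_expanding x y : 3 / 2 * `|x - y| <= `|lift x - lift y|.
Proof.
have -> : lift x - lift y = 2 *: (x - y) + (disp x - disp y).
  by rewrite /lift scaler_nat mulr2n opprD addrACA; congr (_ + _); rewrite opprD addrACA.
have := disp_contract x y; have := ler_normB (2 *: (x - y) + (disp x - disp y)) (disp x - disp y).
rewrite addrK normrZ ger0_norm// => h1 h2.
by have := normr_ge0 (x - y); lra.
Qed.

Lemma lift_le x y : `|lift x - lift y| <= 3 * `|x - y|.
Proof.
have -> : lift x - lift y = 2 *: (x - y) + (disp x - disp y).
  by rewrite /lift scaler_nat mulr2n opprD addrACA; congr (_ + _); rewrite opprD addrACA.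
rewrite (le_trans (ler_normD _ _))// normrZ ger0_norm//.
by have := disp_contract x y; have := normr_ge0 (x - y); lra.
Qed.

Lemma lift_inj : injective lift.
Proof.
move=> x y xy; apply/subr0_eq/eqP; rewrite -normr_le0.
by have := lift_expanding x y; rewrite xy subrr normr0; lra.
Qed.

(** A solution is a fixed point of x -> (y - disp x) / 2, a contraction of R^n. *)
Lemma lift_surj y : exists x, lift x = y.
Proof.
pose g (x : 'rV[R]_n) : 'rV[R]_n := 2^-1 *: (y - disp x).
have gT : {homo g : x / [set: 'rV[R]_n] x >-> [set: 'rV[R]_n] x} by [].
have q0 : (0 : R) <= 16^-1 by rewrite invr_ge0.
have ctr : is_contraction (mkfun gT).
  exists (NngNum q0); split => /=; first by lra.
  move=> [x1 x2] _ /=; rewrite /g -scalerBr opprB addrC subrKA normrZ ger0_norm ?invr_ge0//.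
  have := disp_contract x2 x1; rewrite [`|x2 - x1|]distrC => h.
  by have := normr_ge0 (x1 - x2); lra.
have [x _ xE] := banach_fixed_point ctr closedT (ex_intro _ 0 I).
exists x; rewrite /lift {1 2}xE /= /g -scalerDl.
by rewrite (_ : 2^-1 + 2^-1 = 1) ?scale1r ?subrK//; lra.
Qed.

Definition lift_inv y : 'rV[R]_n := projT1 (cid (lift_surj y)).

Lemma lift_invK y : lift (lift_inv y) = y.
Proof. by rewrite /lift_inv; case: cid. Qed.

Lemma liftK x : lift_inv (lift x) = x.
Proof. by apply: lift_inj; rewrite lift_invK. Qed.

Lemma lift_inv_le x y : `|lift_inv x - lift_inv y| <= 2 / 3 * `|x - y|.
Proof.
have := lift_expanding (lift_inv x) (lift_inv y); rewrite !lift_invK => h.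
by move: (`|_|) (`|x - y|) h => a b h; lra.
Qed.

(** The lift sends x + k to lift x + 2 k for k in the lattice, so x -> lift_inv (lift x + v)
    commutes with lattice translations and descends to the torus. *)
Lemma lift_inv_lattice x y v : tproj x = tproj y ->
  tproj (lift_inv (lift x + v)) = tproj (lift_inv (lift y + v)).
Proof.
move=> xy.
suff -> : lift_inv (lift x + v) = lift_inv (lift y + v) + (x - y).
  by rewrite tprojD [tproj (x - y)]tprojD tprojN xy subrr addr0.
apply: lift_inj; rewrite lift_invK.
set w := lift_inv _; have hw : lift w = lift y + v by rewrite lift_invK.
rewrite [RHS]/lift (@disp_lattice (w + _) w); last by rewrite tprojD [tproj (x - y)]tprojD tprojN xy subrr addr0.
rewrite [RHS](_ : _ = lift w + (x + x - (y + y))); last first.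
  by rewrite /lift; move: (disp w) => u; apply/rowP => j; rewrite !mxE; ring.
rewrite hw /lift (disp_lattice xy).
by move: (disp y) => u; apply/rowP => j; rewrite !mxE; ring.
Qed.

(** Let a and b be the displacements of x and y. Subtracting their equations writes 2 (a - b) as a
    second difference of [disp], at most |a| |x - y| / 16, plus a term at most |a - b| / 16 that is
    absorbed. The factor |v| in the bound comes from |a| <= 2/3 |v|; a mere Lipschitz bound on
    [disp] would not produce it. *)
Lemma lift_inv_diff x y v :
  `|lift_inv (lift x + v) - lift_inv (lift y + v)| <= (1 + `|v|) * `|x - y|.
Proof.
set x' := lift_inv _; set y' := lift_inv _.
have hx : lift x' = lift x + v by rewrite lift_invK.
have hy : lift y' = lift y + v by rewrite lift_invK.
pose a := x' - x; pose b := y' - y.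
have a_le : `|a| <= 2 / 3 * `|v|.
  by have := lift_inv_le (lift x + v) (lift x); rewrite liftK [lift x + v - lift x]addrAC subrr add0r.
have e1 : x' = x + a by rewrite subrKC.
have e2 : y' = y + b by rewrite subrKC.
clearbody a b.
have key : 2 *: (a - b) = (disp (y + b) - disp (y + a))
    - (disp (x + a) - disp x - (disp (y + a) - disp y)).
  have : lift x' - lift x = lift y' - lift y by rewrite hx hy [lift x + v]addrC [lift y + v]addrC !addrK.
  rewrite /lift e1 e2; move: (disp _) (disp _) (disp _) (disp _) (disp (y + a)) => u1 u2 u3 u4 u5.
  move=> /rowP h; apply/rowP => j; have := h j; rewrite !mxE; lra.
have d2 := disp_diff2 x y a.
have hd : `|disp (x + a) - disp x - (disp (y + a) - disp y)| <= 16^-1 * `|a| * `|x - y|.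
  by rewrite (le_trans d2)// ler_wpM2r// !mulrA ler_wpM2r// -mulrA.
have hc := disp_contract (y + b) (y + a).
have eb : y + b - (y + a) = - (a - b) by rewrite opprD addrACA subrr add0r opprB.
rewrite eb normrN in hc.
have hn : 2 * `|a - b| <= 16^-1 * `|a - b| + 16^-1 * `|a| * `|x - y|.
  rewrite -[2 in leLHS]ger0_norm// -normrZ key.
  by rewrite (le_trans (ler_normB _ _))// lerD.
have -> : x' - y' = (x - y) + (a - b) by rewrite e1 e2 opprD addrACA.
rewrite (le_trans (ler_normD _ _))// mulrDl mul1r lerD2l.
have hv : `|a| * `|x - y| <= 2 / 3 * `|v| * `|x - y| by rewrite ler_wpM2r.
move: hn hv (normr_ge0 (a - b)) (mulr_ge0 (normr_ge0 v) (normr_ge0 (x - y))).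
by rewrite -!mulrA; move: (`|a| * _) (`|v| * _) (`|a - b|) => r1 r2 r3; lra.
Qed.

Lemma tuc_lip (g : T -> T) (C : R) : 0 < C ->
  (forall p q, tnorm (g p - g q) <= C * tnorm (p - q)) -> tuc g.
Proof.
move=> C0 hg e e0; exists (e / C) => [|p q]; first by rewrite divr_gt0.
by rewrite ltr_pdivlMr// mulrC; apply: le_lt_trans.
Qed.

Lemma tproj_near p q : exists x y, [/\ tproj x = p, tproj y = q & `|x - y| = tnorm (p - q)].
Proof.
exists (tlog (p - q) + tlog q), (tlog q); split; rewrite ?tprojD ?tlogK ?subrK//.
by rewrite addrK.
Qed.

Definition translate_lift v p : T := tproj (lift_inv (lift (tlog p) + v)).

Lemma translate_liftE v x : translate_lift v (tproj x) = tproj (lift_inv (lift x + v)).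
Proof. by apply: lift_inv_lattice; rewrite tlogK. Qed.

Lemma translate_lift_lip v p q :
  tnorm (translate_lift v p - translate_lift v q) <= (1 + `|v|) * tnorm (p - q).
Proof.
have [x [y [<- <- <-]]] := tproj_near p q; rewrite !translate_liftE.
rewrite (le_trans _ (lift_inv_diff x y v))//; apply: tnorm_le.
by rewrite tprojD tprojN.
Qed.

Lemma near_doubling_tuc : tuc f.
Proof.
apply: (@tuc_lip _ 3) => // p q; have [x [y [<- <- <-]]] := tproj_near p q.
rewrite -!tproj_lift (le_trans _ (lift_le x y))//; apply: tnorm_le.
by rewrite tprojD tprojN.
Qed.

Lemma near_doubling_good : good 1 f.
Proof.
split=> [|v]; first exact: near_doubling_tuc.
exists (translate_lift v), (translate_lift (- v)); split.
- by move=> p; rewrite [translate_lift v p]/translate_lift translate_liftE lift_invK addrK liftK tlogK.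
- by apply: (@tuc_lip _ (1 + `|v|)); [rewrite ltr_pwDl|exact: translate_lift_lip].
- move=> p; exists (lift_inv (lift (tlog p) + v) - tlog p).
    by rewrite /translate_lift -{2}(tlogK p) -tprojD subrKC.
  have := lift_inv_le (lift (tlog p) + v) (lift (tlog p)).
  by rewrite liftK [_ + v - _]addrAC subrr add0r.
- by move=> p q; rewrite mul1r -[`|v|]normrN; exact: translate_lift_lip.
- by move=> p; rewrite -tproj_lift lift_invK tprojD tproj_lift tlogK.
Qed.

Lemma enormZ (a : R) w : enorm (a *: w) = `|a| * enorm w.
Proof.
rewrite -sqrtr_sqr /enorm -sqrtrM ?sqr_ge0// mulr_sumr; congr Num.sqrt.
by apply: eq_bigr => j _; rewrite mxE exprMn.
Qed.

Lemma enorm_eq0 w : enorm w = 0 -> w = 0.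
Proof.
move=> w0; apply/rowP => j; rewrite mxE; apply/eqP; rewrite -normr_le0 -w0.
exact: coord_le_enorm.
Qed.

Lemma enorm_le_nnorm w : enorm w <= n%:R * `|w|.
Proof.
rewrite (le_trans (enorm_le_norm w))// ler_wpM2r//.
by rewrite -[leRHS]ger0_norm// -sqrtr_sqr ler_sqrt ?sqr_ge0// expr2 ler_peMl.
Qed.

Lemma tderiv_expanding p w : 3 / 2 * enorm w <= enorm (w *m tderiv f p).
Proof.
pose E := tderiv f p - 2%:M.
have hE : enorm (w *m E) <= 16^-1 * enorm w.
  rewrite (le_trans (enorm_le_nnorm _))//.
  apply: (@le_trans _ _ (n%:R * (n%:R * d * enorm w))); last first.
    by rewrite mulrA ler_wpM2r// enorm_ge0.
  rewrite ler_wpM2l//; apply: rV_norm_le => [|j]; first by rewrite !mulr_ge0 ?enorm_ge0// ltW.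
  rewrite mxE (le_trans (ler_norm_sum _ _ _))//.
  have -> : n%:R * d * enorm w = \sum_(i < n) enorm w * d.
    by rewrite sumr_const card_ord -[RHS]mulr_natl; ring.
  apply: ler_sum => i _; rewrite normrM ler_pM//; first exact: coord_le_enorm.
  by rewrite /E mxE [(- 2%:M) i j]mxE; exact: nd_tderiv.
have h2 : 2 * enorm w = enorm (w *m tderiv f p - w *m E).
  by rewrite -mulmxBr opprB addrC subrK mul_mx_scalar enormZ ger0_norm.
have := enormD (w *m tderiv f p) (- (w *m E)); rewrite enormN -h2.
by have := enorm_ge0 w; lra.
Qed.

Lemma tderiv_unit p : tderiv f p \in unitmx.
Proof.
rewrite -row_free_unit; apply: inj_row_free => w w0.
have := tderiv_expanding p w; rewrite w0 enorm0 => h.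
by apply: enorm_eq0; apply/eqP; rewrite eq_le enorm_ge0 andbT; lra.
Qed.

Lemma enorm_invmx_tderiv p w : enorm (w *m invmx (tderiv f p)) <= 2 / 3 * enorm w.
Proof.
have := tderiv_expanding p (w *m invmx (tderiv f p)).
by rewrite mulmxKV ?tderiv_unit//; lra.
Qed.

(** Strict positivity is required for the logarithm: [ln] is 0 at 0 by convention, so a zero norm
    would spoil the negative bound. A unit vector, available since n > 0, witnesses it. *)
Lemma opnorm_invmx_tderiv p : 0 < opnorm (invmx (tderiv f p)) <= 2 / 3.
Proof.
set B := invmx _; pose S := [set enorm (v *m B) | v in [set v | enorm v <= 1]].
rewrite /opnorm -/S.
have ubS : ubound S (2 / 3).
  move=> _ [w /= w1 <-]; rewrite (le_trans (enorm_invmx_tderiv p w))//.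
  by lra.
apply/andP; split; last first.
  by apply: sup_le_ub => //; exists (enorm (0 *m B)), 0 => //=; rewrite enorm0.
pose e : 'rV[R]_n := delta_mx 0 (Ordinal n0).
have e1 : enorm e = 1.
  rewrite /enorm (bigD1 (Ordinal n0))//= mxE !eqxx expr1n big1 ?addr0 ?sqrtr1// => j j0.
  by rewrite mxE (negbTE j0) andbF expr0n.
have : 0 < enorm (e *m B).
  rewrite lt_neqAle enorm_ge0 andbT eq_sym; apply/eqP => /enorm_eq0 eB.
  have := mulmxKV (tderiv_unit p) e; rewrite -/B eB mul0mx => e0.
  by have := e1; rewrite -e0 enorm0 => /esym/eqP; rewrite oner_eq0.
move=> /lt_le_trans; apply; apply: ub_le_sup; first by exists (2 / 3).
by exists e => //=; rewrite e1.
Qed.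

Lemma near_doubling_nonuniformly_expanding : nonuniformly_expanding f.
Proof.
exists (- ln (2 / 3)); first by rewrite oppr_gt0 ln_lt0//; lra.
apply: aeW => x; rewrite opprK /limn_esup /limf_esup.
set u := fun k : nat => _.
(* The tail starts at k = 1: the average for k = 0 is 0 by convention and exceeds ln (2 / 3). *)
apply: (@le_trans _ _ (ereal_sup (u @` [set k | (0 < k)%N]))).
  by apply: ereal_inf_lbound; exists [set k | (0 < k)%N] => //; exists 1%N.
apply: ge_ereal_sup => _ [k /= k0 <-]; rewrite lee_fin ler_pdivrMl ?ltr0n//.
have -> : k%:R * ln (2 / 3 : R) = \sum_(j < k) ln (2 / 3) by rewrite sumr_const card_ord mulr_natl.
apply: ler_sum => j _; have /andP[h0 h1] := opnorm_invmx_tderiv (iter j f x).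
by rewrite ler_ln// posrE; lra.
Qed.

Local Notation A x := (tderiv f (tproj x)).
Local Notation B x := (invmx (tderiv f (tproj x))).

Lemma invmx_tderiv_row x v : `|v *m B x| <= n%:R * `|v|.
Proof.
rewrite (le_trans (norm_le_enorm _))// (le_trans (enorm_invmx_tderiv _ _))//.
rewrite (le_trans _ (enorm_le_nnorm v))//.
by have := enorm_ge0 v; lra.
Qed.

Lemma norm_delta i : `|delta_mx 0 i : 'rV[R]_n| <= 1.
Proof.
by apply: rV_norm_le => // j; rewrite mxE; case: (_ && _); rewrite ?normr0 ?normr1.
Qed.

Lemma invmx_tderiv_norm x : `|B x| <= n%:R.
Proof.
apply: mx_norm_le => // i j.
have -> : B x i j = row i (B x) 0 j by rewrite mxE.
rewrite (le_trans (rV_norm_coord _ _))// rowE (le_trans (invmx_tderiv_row _ _))//.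
by rewrite ler_piMr// norm_delta.
Qed.

Lemma invmx_sub (X Y : 'M[R]_n) : X \in unitmx -> Y \in unitmx ->
  invmx X - invmx Y = - (invmx X *m (X - Y) *m invmx Y).
Proof.
move=> uX uY; rewrite mulmxBr mulVmx// mulmxBl mul1mx -mulmxA mulmxV// mulmx1.
by rewrite opprB.
Qed.

Lemma invmx_tderiv_lip x w : `|B (x + w) - B x| <= n%:R * n%:R * n%:R * `|w|.
Proof.
rewrite invmx_sub ?tderiv_unit// normrN (le_trans (mulmx_norm_le _ _))//.
have hA : `|A (x + w) - A x| <= n%:R * d * `|w|.
  apply: mx_norm_le => [|i j]; first by rewrite !mulr_ge0// ltW.
  by rewrite mxE [(- A x) i j]mxE; exact: tderiv_lip.
have := mulmx_norm_le (B (x + w)) (A (x + w) - A x).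
have b1 := invmx_tderiv_norm (x + w); have b2 := invmx_tderiv_norm x.
have h : n%:R * (n%:R * (n%:R * d * `|w|)) <= n%:R * `|w|.
  by rewrite ler_wpM2l// mulrA -[leRHS]mul1r ler_wpM2r// (le_trans nd c16).
move=> h1; have h2 : `|B (x + w) *m (A (x + w) - A x)| <= n%:R * `|w|.
  apply: (le_trans h1); apply: le_trans h; apply: ler_wpM2l => //.
  exact: (ler_pM (normr_ge0 _) (normr_ge0 _) b1 hA).
have -> : n%:R * n%:R * n%:R * `|w| = n%:R * (n%:R * `|w| * n%:R) by ring.
apply: ler_wpM2l => //; exact: (ler_pM (normr_ge0 _) (normr_ge0 _) h2 b2).
Qed.

Lemma lift_inv_dist y h : `|lift_inv (y + h) - lift_inv y| <= `|h|.
Proof.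
have := lift_inv_le (y + h) y; rewrite [y + h - y]addrAC subrr add0r => /le_trans; apply.
by have := normr_ge0 h; lra.
Qed.

(** Inverts the Taylor expansion of the lift at x: the increment k of the inverse satisfies k - h B
    = - (h - k A) B, where h - k A is quadratic in k and |k| <= |h|. *)
Lemma lift_inv_quadratic y h :
  `|lift_inv (y + h) - lift_inv y - h *m B (lift_inv y)| <= n%:R * `|h| ^+ 2.
Proof.
set x := lift_inv y; set k := lift_inv (y + h) - x.
have kh : `|k| <= `|h| := lift_inv_dist y h.
have hk := lift_quadratic x k.
have e1 : lift (x + k) - lift x = h.
  by rewrite /k subrKC /x !lift_invK [y + h - y]addrAC subrr add0r.
rewrite e1 in hk.
have -> : k - h *m B x = - ((h - k *m A x) *m B x).
  by rewrite mulmxBl mulmxK ?tderiv_unit// opprB.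
rewrite normrN (le_trans (invmx_tderiv_row _ _))// ler_wpM2l// (le_trans hk)//.
have -> : n%:R * (n%:R * d * `|k|) * `|k| = n%:R * (n%:R * d) * `|k| ^+ 2 by ring.
apply: (@le_trans _ _ (1 * `|k| ^+ 2)).
  by rewrite ler_wpM2r ?sqr_ge0// (le_trans nd c16).
by rewrite mul1r lerXn2r ?nnegrE.
Qed.

Lemma expand_lift_inv y i :
  expand (fun t => lift_inv (y + t *: delta_mx 0 i)) (row i (B (lift_inv y))).
Proof.
move=> e e0; exists (e / n%:R) => [|t]; first by rewrite divr_gt0// ltr0n.
rewrite ltr_pdivlMr ?ltr0n// => te; rewrite scale0r addr0 rowE scalemxAl.
rewrite (le_trans (lift_inv_quadratic _ _))//.
have h : `|t *: (delta_mx 0 i : 'rV[R]_n)| <= `|t| by rewrite normrZ ler_piMr// norm_delta.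
apply: (@le_trans _ _ (n%:R * `|t| ^+ 2)); first by rewrite ler_wpM2l// lerXn2r ?nnegrE.
by rewrite expr2 mulrA ler_wpM2r// mulrC ltW.
Qed.

(** The derivative of [tderiv f] at p in the direction b. *)
Definition tderiv2_along (b : 'rV[R]_n) p : 'M[R]_n := \sum_j b 0 j *: tderiv2 f j p.

(** The chain rule along t -> lift_inv (y + t e_i), whose velocity at 0 is b. The increment w is t b
    up to a quadratic error, and continuity of the second partials at x controls the remainder. *)
Lemma expand_tderiv_lift_inv y i :
  expand (fun t => A (lift_inv (y + t *: delta_mx 0 i)))
    (tderiv2_along (row i (B (lift_inv y))) (tproj (lift_inv y))).
Proof.
set x := lift_inv y; set b := row i (B x).
apply: expand_mx => k l e e0.
pose c j := tderiv2 f j (tproj x) k l.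
have n0' : 0 < n%:R :> R by rewrite ltr0n.
pose e1 := e / 2 / n%:R; pose D : R := n%:R * (n%:R * d) + 1.
have e10 : 0 < e1 by rewrite !divr_gt0.
have [r r0 hr] : exists2 r : R, 0 < r & forall z j, `|z - x| < r ->
    `|tderiv2 f j (tproj z) k l - c j| <= e1.
  have h j : \forall z \near x, `|c j - tderiv2 f j (tproj z) k l| <= e1.
    have ct : (fun z => tderiv2 f j (tproj z)) @ x --> tderiv2 f j (tproj x).
      have cc := C2_on_cont2 (nd_C2 hf) (i := j) (I : setT (tproj x)).
      by apply: continuous_comp; [exact: tproj_continuous|exact: cc].
    move/cvgrPdist_le/(_ _ e10): ct; apply: filterS => z; apply: le_trans.
    have -> : c j - tderiv2 f j (tproj z) k l = (tderiv2 f j (tproj x) - tderiv2 f j (tproj z)) k l.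
      by rewrite /c; move: (tderiv2 f j _) (tderiv2 f j _) => X Y; rewrite !mxE.
    exact: mx_norm_entry.
  have /nbhs_ballP[r /= r0 hr] : \forall z \near x, forall j, `|c j - tderiv2 f j (tproj z) k l| <= e1.
    exact: filter_forall h.
  exists r => // z j zr; rewrite distrC; apply: hr.
  by rewrite -ball_normE /= distrC.
exists (Num.min r (e / 2 / D)) => [|t].
  by rewrite lt_min r0 !divr_gt0// ltr_pwDr// !mulr_ge0// ltW.
rewrite lt_min => /andP[tr]; rewrite ltr_pdivlMr; last first.
  by rewrite ltr_pwDr// !mulr_ge0// ltW.
move=> tD; rewrite scale0r addr0 -/x.
set w := lift_inv (y + t *: delta_mx 0 i) - x.
have tE : `|t *: (delta_mx 0 i : 'rV[R]_n)| <= `|t| by rewrite normrZ ler_piMr// norm_delta.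
have wt : `|w| <= `|t| by apply: le_trans tE; exact: lift_inv_dist.
have wb : `|w - t *: b| <= n%:R * `|t| ^+ 2.
  rewrite /b rowE scalemxAl (le_trans (lift_inv_quadratic _ _))//.
  by rewrite ler_wpM2l// lerXn2r ?nnegrE.
have -> : lift_inv (y + t *: delta_mx 0 i) = x + w by rewrite subrKC.
have h1 := @partials_expand R n (fun z => A z k l) (fun j z => tderiv2 f j (tproj z) k l) c e1 x w (ltW e10).
have {}h1 : `|A (x + w) k l - A x k l - \sum_j w 0 j * c j| <= n%:R * e1 * `|w|.
  apply: h1 => z j zx; split; first exact: expand_entry (expand_tderiv z j).
  by apply: hr; rewrite (le_lt_trans zx)// (le_lt_trans wt).
have h2 : `|\sum_j w 0 j * c j - t * tderiv2_along b (tproj x) k l| <= n%:R * (n%:R * `|t| ^+ 2 * d).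
  have -> : \sum_j w 0 j * c j - t * tderiv2_along b (tproj x) k l = \sum_j (w - t *: b) 0 j * c j.
    rewrite /tderiv2_along summxE mulr_sumr -sumrB; apply: eq_bigr => j _.
    have aux (u v : 'rV[R]_n) (X : 'M[R]_n) :
      u 0 j * X k l - t * (v 0 j *: X) k l = (u - t *: v) 0 j * X k l by rewrite !mxE; ring.
    exact: aux.
  rewrite (le_trans (ler_norm_sum _ _ _))//.
  have -> : n%:R * (n%:R * `|t| ^+ 2 * d) = \sum_(j < n) n%:R * `|t| ^+ 2 * d.
    by rewrite sumr_const card_ord mulr_natl.
  apply: ler_sum => j _; rewrite normrM; apply: ler_pM => //; last exact: nd_tderiv2.
  exact: le_trans (rV_norm_coord _ _) wb.
have -> : A (x + w) k l - A x k l - t *: tderiv2_along b (tproj x) k l =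
    (A (x + w) k l - A x k l - \sum_j w 0 j * c j) +
    (\sum_j w 0 j * c j - t * tderiv2_along b (tproj x) k l) by rewrite subrKA.
rewrite (le_trans (ler_normD _ _))// (splitr e) mulrDl lerD//.
  apply: (le_trans h1); have -> : e / 2 = n%:R * e1 by rewrite /e1; field; rewrite gt_eqF.
  by rewrite ler_wpM2l// mulr_ge0// ltW.
apply: (le_trans h2).
have -> : n%:R * (n%:R * `|t| ^+ 2 * d) = n%:R * (n%:R * d) * `|t| * `|t| by ring.
rewrite ler_wpM2r// (le_trans _ (ltW tD))// mulrC ler_wpM2l//.
by rewrite /D lerDl.
Qed.

Lemma expand_invmx_tderiv y i :
  expand (fun t => B (lift_inv (y + t *: delta_mx 0 i)))
    (- (B (lift_inv y) *m
        tderiv2_along (row i (B (lift_inv y))) (tproj (lift_inv y)) *m B (lift_inv y))).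
Proof.
have n3 : 0 < n%:R * n%:R * n%:R :> R by rewrite !mulr_gt0// ltr0n.
have := expand_invmx n3 _ _ _ (expand_tderiv_lift_inv y i).
rewrite scale0r addr0; apply => [t|t|t]; first exact: tderiv_unit.
  by rewrite (le_trans (invmx_tderiv_norm _))// ler_peMl// mulr_ege1.
rewrite -[lift_inv (_ + _)](subrKC (lift_inv y)) (le_trans (invmx_tderiv_lip _ _))//.
apply: ler_wpM2l; first exact: ltW.
rewrite (le_trans (lift_inv_dist _ _))//.
by rewrite normrZ ler_piMr// norm_delta.
Qed.

(** * Inverse branches of f are C^2 *)

Section inverse_branch.
Variable x0 : 'rV[R]_n.

Let Y q : 'rV[R]_n := lift x0 + tlog (q - f (tproj x0)).

Definition inverse_branch q : T := tproj (lift_inv (Y q)).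

(** With radius 1/8, a further increment below 1/8 keeps the logarithm below 1/2, so [tlog] is
    additive there and the branch is given by [lift_inv] in a chart. *)
Definition branch_domain : set T := [set q | tnorm (q - f (tproj x0)) < 8^-1].

Local Notation g := inverse_branch.
Local Notation V := branch_domain.

Lemma inverse_branchK q : f (g q) = q.
Proof.
by rewrite -tproj_lift lift_invK tprojD tproj_lift tlogK subrKC.
Qed.

Lemma branch_domain_near q : V q -> exists2 r : R, 0 < r & forall q', tnorm (q' - q) < r -> V q'.
Proof.
rewrite /V /= => Vq; exists (8^-1 - tnorm (q - f (tproj x0))); first by rewrite subr_gt0.
move=> q' h; have := tnorm_tri q q' (f (tproj x0)); lra.
Qed.

Lemma open_branch_domain : open V.
Proof.
rewrite openE => q /branch_domain_near[r r0 hr]; apply/nbhs_tnormP; exists r => //.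
Qed.

Lemma inverse_branch_near q h : V q -> `|h| < 8^-1 -> g (q + tproj h) = tproj (lift_inv (Y q + h)).
Proof.
rewrite /V /= => Vq h8; rewrite /g /Y.
have -> : q + tproj h - f (tproj x0) = tproj (tlog (q - f (tproj x0)) + h).
  by rewrite tprojD tlogK addrAC.
rewrite tlog_tproj ?addrA//; have := ler_normD (tlog (q - f (tproj x0))) h.
by rewrite -/(tnorm _) => /le_lt_trans; apply; lra.
Qed.

Lemma local_rep_inverse_branch q h : V q -> `|h| < 8^-1 ->
  local_rep g q h = lift_inv (Y q + h) - lift_inv (Y q).
Proof.
move=> Vq h8; rewrite /local_rep inverse_branch_near// /g -tprojN -tprojD tlog_tproj//.
by rewrite (le_lt_trans (lift_inv_dist _ _))//; lra.
Qed.

Lemma tproj_small t i : `|t| < 8^-1 -> `|t *: (delta_mx 0 i : 'rV[R]_n)| < 8^-1.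
Proof. by move=> t8; rewrite (le_lt_trans _ t8)// normrZ ler_piMr// norm_delta. Qed.

Lemma is_derive_inverse_branch q i : V q ->
  is_derive (0 : 'rV[R]_n) (delta_mx 0 i) (local_rep g q) (row i (invmx (tderiv f (g q)))).
Proof.
move=> Vq; apply/expandP.
have := expandD (expand_lift_inv (Y q) i) (expand_linear (- lift_inv (Y q)) 0); rewrite addr0.
apply: expand_local (_ : 0 < 8^-1) _ => [|t t8]; first by rewrite invr_gt0.
by rewrite add0r local_rep_inverse_branch ?tproj_small// scaler0 addr0.
Qed.

Lemma tderiv_inverse_branch q : V q -> tderiv g q = invmx (tderiv f (g q)).
Proof.
move=> Vq; apply/row_matrixP => i; rewrite rowK.
by have [_ ->] := is_derive_inverse_branch i Vq.
Qed.

Definition tderiv2_branch i q : 'M[R]_n :=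
  - (invmx (tderiv f (g q)) *m tderiv2_along (row i (invmx (tderiv f (g q)))) (g q)
     *m invmx (tderiv f (g q))).

Lemma is_derive2_inverse_branch q i : V q ->
  is_derive (0 : 'rV[R]_n) (delta_mx 0 i) (fun h => tderiv g (q + tproj h)) (tderiv2_branch i q).
Proof.
move=> Vq; apply/expandP; have [r r0 hr] := branch_domain_near Vq.
have := expand_invmx_tderiv (Y q) i.
apply: expand_local (_ : 0 < Num.min r 8^-1) _ => [|t]; first by rewrite lt_min r0 /= invr_gt0.
rewrite lt_min => /andP[tr t8]; rewrite add0r.
rewrite tderiv_inverse_branch; last first.
  apply: hr; rewrite addrAC subrr add0r (le_lt_trans _ tr)//.
  by rewrite (le_trans (tnorm_le (erefl (tproj _))))// normrZ ler_piMr// norm_delta.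
by rewrite inverse_branch_near ?tproj_small.
Qed.

Lemma inverse_branch_continuous q : V q -> {for q, continuous g}.
Proof.
move=> Vq U /nbhs_tnormP[r r0 hr]; apply/nbhs_tnormP.
exists (Num.min r 8^-1) => [|q']; first by rewrite lt_min r0 /= invr_gt0.
rewrite lt_min => /andP[qr q8]; apply: hr.
have -> : q' = q + tproj (tlog (q' - q)) by rewrite tlogK subrKC.
rewrite inverse_branch_near// /g -tprojN -tprojD (le_lt_trans _ qr)//.
exact: le_trans (tnorm_le (erefl _)) (lift_inv_dist _ _).
Qed.

Lemma cvg_invmx_tderiv q : V q ->
  (fun q' => invmx (tderiv f (g q'))) @ q --> invmx (tderiv f (g q)).
Proof.
move=> Vq; apply/(@cvgrPdist_le _ _ _ _ (nbhs_filter q)) => e e0.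
have N0 : 0 < n%:R * n%:R * n%:R :> R by rewrite !mulr_gt0// ltr0n.
apply/nbhs_tnormP; exists (Num.min (e / (n%:R * n%:R * n%:R)) 8^-1) => [|q'].
  by rewrite lt_min divr_gt0//= invr_gt0.
rewrite lt_min => /andP[qr q8].
have -> : q' = q + tproj (tlog (q' - q)) by rewrite tlogK subrKC.
rewrite inverse_branch_near// /g distrC -[lift_inv (_ + _)](subrKC (lift_inv (Y q))).
rewrite (le_trans (invmx_tderiv_lip _ _))//.
apply: (@le_trans _ _ (n%:R * n%:R * n%:R * tnorm (q' - q))).
  by apply: ler_wpM2l; [exact: ltW|exact: lift_inv_dist].
by rewrite mulrC -ler_pdivlMr// ltW.
Qed.

Lemma cvg_tderiv2_branch i q : V q -> tderiv2_branch i @ q --> tderiv2_branch i q.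
Proof.
move=> Vq; have cB := cvg_invmx_tderiv Vq.
have FF : Filter (nbhs q) := nbhs_filter q.
apply: (@cvgN _ _ _ _ FF); apply: (cvg_mulmx (FF := FF)) => //; apply: (cvg_mulmx (FF := FF)) => //.
apply: (cvg_sum (FF := FF)) => j; apply: (@cvgZ _ _ _ _ FF).
  under eq_cvg do rewrite mxE; rewrite mxE.
  exact: cvg_comp cB (@coord_continuous _ _ _ _ _ _).
exact: (@continuous_comp _ _ _ g (tderiv2 f j) q (inverse_branch_continuous Vq)
  (C2_on_cont2 (nd_C2 hf) (i := j) (I : setT (g q)))).
Qed.

Lemma C2_inverse_branch : C2_on V g.
Proof.
have nV q : V q -> nbhs q V by move=> Vq; apply: open_nbhs_nbhs; split=> //; exact: open_branch_domain.
split=> [q Vq|q i Vq|q Vq|q i Vq|q i Vq].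
- exact: inverse_branch_continuous.
- by have [] := is_derive_inverse_branch i Vq.
- suff : tderiv g @ q --> tderiv g q by [].
  rewrite [tderiv g q]tderiv_inverse_branch//; apply: cvg_trans (cvg_invmx_tderiv Vq).
  have h : \forall q' \near nbhs q, invmx (tderiv f (g q')) = tderiv g q'.
    by apply: (@filterS _ _ (nbhs_filter q) _ _ _ (nV q Vq)) => q' Vq'; rewrite tderiv_inverse_branch.
  exact: near_eq_cvg h.
- by have [] := is_derive2_inverse_branch i Vq.
- have e2 q' : V q' -> tderiv2 g i q' = tderiv2_branch i q'.
    by move=> Vq'; have [_ <-] := is_derive2_inverse_branch i Vq'.
  suff : tderiv2 g i @ q --> tderiv2 g i q by [].
  rewrite (e2 q Vq).
  have h : \forall q' \near nbhs q, tderiv2_branch i q' = tderiv2 g i q'.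
    by apply: (@filterS _ _ (nbhs_filter q) _ _ _ (nV q Vq)) => q' Vq'; rewrite e2.
  have h1 := near_eq_cvg h; have h2 := cvg_tderiv2_branch (i := i) Vq.
  exact: (cvg_trans (h1 _) h2).
Qed.

End inverse_branch.

(** Intersecting the ball about p with the preimage of the branch domain makes the image of W
    exactly that domain; the branch maps it back into the ball because [lift_inv] does not increase
    distances. *)
Lemma near_doubling_local_diffeo : local_diffeo f.
Proof.
split=> [|p]; first exact: (nd_C2 hf).
pose x0 := tlog p; have px0 : tproj x0 = p by rewrite tlogK.
pose W : set T := [set q | tnorm (q - p) < 8^-1] `&` f @^-1` branch_domain x0.
have gf q : tnorm (q - p) < 8^-1 -> inverse_branch x0 (f q) = q.
  move=> qp; have -> : q = tproj (x0 + tlog (q - p)) by rewrite tprojD px0 tlogK subrKC.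
  rewrite /inverse_branch -!tproj_lift -tprojN -tprojD tlog_tproj ?lift_sub_near//.
  by rewrite subrKC liftK.
have fW : f @` W = branch_domain x0.
  apply/seteqP; split=> [_ [q [_ h] <-]//|q Vq]; exists (inverse_branch x0 q); last exact: inverse_branchK.
  split; last by rewrite /= inverse_branchK.
  rewrite /= -[p]px0 /inverse_branch -tprojN -tprojD (le_lt_trans (tnorm_le (erefl _)))//.
  rewrite -[X in _ - X](liftK x0) (le_lt_trans (lift_inv_dist _ _))//.
have V0 : branch_domain x0 (f p) by rewrite /branch_domain /= px0 subrr tnorm0 invr_gt0.
exists W; split.
- apply: openI.
    rewrite openE => q /= qp; apply/nbhs_tnormP; exists (8^-1 - tnorm (q - p)).
      by rewrite subr_gt0.
    by move=> q' h; have := tnorm_tri q q' p; rewrite /=; lra.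
  apply: open_comp; last exact: open_branch_domain.
  by move=> q _; exact: (C2_on_cont (nd_C2 hf) (I : setT q)).
- by split; [rewrite /= subrr tnorm0 invr_gt0|].
- by rewrite fW; exact: open_branch_domain.
- exists (inverse_branch x0); rewrite fW; split; last exact: C2_inverse_branch.
  by move=> q; rewrite inE => -[/gf].
Qed.

End lift.

(** * The doubling map as the centre of the open set *)

Section doubling.
Context {R : realType} {n : nat}.
Local Notation T := (torus R n).

Definition doubling (p : T) : T := p + p.

Lemma local_rep_doubling p (h : 'rV[R]_n) : `|h| < 4^-1 -> local_rep doubling p h = 2 *: h.
Proof.
move=> h4; rewrite /local_rep /doubling.
have -> : p + tproj h + (p + tproj h) - (p + p) = tproj (2 *: h).
  by rewrite scaler_nat mulr2n tprojD addrACA [p + p + _]addrC addrK.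
by rewrite tlog_tproj// normrZ ger0_norm//; lra.
Qed.

Lemma is_derive_doubling p i :
  is_derive (0 : 'rV[R]_n) (delta_mx 0 i) (local_rep doubling p) (row i (2%:M : 'M[R]_n)).
Proof.
apply/expandP; have := expand_linear 0 (row i (2%:M : 'M[R]_n)).
apply: expand_local (_ : 0 < 4^-1) _ => [|t t4]; first by rewrite invr_gt0.
rewrite !add0r local_rep_doubling.
  by rewrite rowE mul_mx_scalar !scalerA mulrC.
by rewrite (le_lt_trans _ t4)// normrZ ler_piMr// norm_delta.
Qed.

Lemma tderiv_doubling p : tderiv doubling p = 2%:M.
Proof.
by apply/row_matrixP => i; rewrite rowK; have [_ ->] := is_derive_doubling p i.
Qed.

Lemma is_derive2_doubling p i :
  is_derive (0 : 'rV[R]_n) (delta_mx 0 i) (fun h => tderiv doubling (p + tproj h)) 0.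
Proof.
apply/expandP; apply: expand_local ltr01 _ (expand_linear (2%:M : 'M[R]_n) 0) => t _.
by rewrite scaler0 addr0 tderiv_doubling.
Qed.

Lemma tderiv2_doubling i p : tderiv2 doubling i p = 0.
Proof. by have [_ E] := is_derive2_doubling p i; exact: E. Qed.

Lemma C2_doubling : C2_on setT doubling.
Proof.
split=> [p _|p i _|p _|p i _|p i _].
- move=> U /nbhs_tnormP[r r0 hr]; apply/nbhs_tnormP.
  exists (r / 2) => [|q qr]; first by rewrite divr_gt0.
  apply: hr; rewrite /doubling opprD addrACA.
  by rewrite (le_lt_trans (tnormD _ _))//; lra.
- by have [] := is_derive_doubling p i.
- have -> : tderiv doubling = cst 2%:M by apply/funext => q; exact: tderiv_doubling.
  exact: cst_continuous.
- by have [] := is_derive2_doubling p i.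
- have -> : tderiv2 doubling i = cst 0 by apply/funext => q; exact: tderiv2_doubling.
  exact: cst_continuous.
Qed.

Definition doubling_map : C2map R n := Build_C2map C2_doubling.

Lemma ball_near_doubling (d : R) (f : C2map R n) : ball doubling_map d f -> near_doubling d f.
Proof.
move=> h; split=> [|p|p i j|p i k l].
- exact: C2mapP.
- by have [/ball_tnorm/ltW] := h p.
- have [_ [_ +] _] := h p; rewrite tderiv_doubling => /(_ i j).
  by rewrite /ball /= distrC => /ltW.
- have [_ _ /(_ i)[_ /(_ k l)]] := h p; rewrite tderiv2_doubling.
  by rewrite /ball /= mxE sub0r normrN => /ltW.
Qed.

End doubling.

Theorem corollary6p3 (R : realType) (n : nat) (n_gt0 : (0 < n)%N) :
  exists U : set (C2map R n), [/\ open U, U !=set0 &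
    forall f : C2map R n, U f ->
      [/\ local_diffeo f, nonuniformly_expanding f & stochastically_stable f]].
Proof.
(* Makes n (n d) equal to 1/16: each bound by partial derivatives loses a factor n, and second
   differences and the comparison with the Euclidean norm lose another. *)
pose d : R := (16 * (n%:R * n%:R))^-1.
have n0 : 0 < n%:R :> R by rewrite ltr0n.
have d0 : 0 < d by rewrite invr_gt0 !mulr_gt0.
have nd : n%:R * (n%:R * d) <= 16^-1.
  by rewrite le_eqVlt; apply/orP; left; apply/eqP; rewrite /d; field; rewrite gt_eqF.
(* The interior is open at once, and each of its maps has a whole ball of maps close to doubling
   around it, as stability requires. *)
exists (ball doubling_map d)^°; split.
- exact: open_interior.
- by exists doubling_map; apply: nbhsx_ballx.
- move=> f /nbhs_ballP[r /= r0 hr].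
  have nf := ball_near_doubling (hr f (ballxx f r0)).
  split.
  + exact: near_doubling_local_diffeo nd nf n_gt0.
  + exact: near_doubling_nonuniformly_expanding nd nf n_gt0.
  + apply: (good_ball_stable ler01 r0) => g fg.
    exact: near_doubling_good nd (ball_near_doubling (hr g fg)) n_gt0.
Qed.
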